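(* Let $\rho>0$, let $p_{hp}=\sum_{i=1}^Np_i\,\phi_i\in Q_{hp}$ and $\lambda_{hp}=\sum_{i=1}^N\lambda_i\,\varphi_i\in\Lambda^{(w)}_{hp}$ with $p_i,\lambda_i\in\mathbb{S}_{d,0}$, and set $$\chi_i(p_i,\lambda_i):=\max\{\sigma_i,\,|\lambda_i+\rho\,p_i|_F\}\,\lambda_i-\sigma_i\,(\lambda_i+\rho\,p_i),\qquad i=1,\dots,N.$$ Then $\lambda_{hp}$ satisfies $$(\mu_{hp}-\lambda_{hp},p_{hp})_{0,\Omega}\le0\qquad\forall\mu_{hp}\in\Lambda^{(w)}_{hp}$$ if and only if $\chi_i(p_i,\lambda_i)=0$ for all $i\in\{1,\dots,N\}$.
   Context: Let $d\in\{2,3\}$ and $\Omega\subset\mathbb{R}^d$ a bounded Lipschitz domain. $\mathbb{S}_{d,0}$ is the space of symmetric real $d\times d$ matrices with vanishing trace, $:$ the Frobenius inner product, $|\cdot|_F$ the Frobenius norm, $Q:=L^2(\Omega,\mathbb{S}_{d,0})$, $(\cdot,\cdot)_{0,\Omega}$ the $L^2(\Omega)$ inner product (for scalar or matrix-valued functions). $\sigma_y>0$ is a constant. $\mathcal{T}_h$ is a locally quasi-uniform finite element mesh of $\Omega$ of convex, shape regular quadrilaterals ($d=2$) or hexahedrons ($d=3$); $\widehat T=[-1,1]^d$; $F_T:\widehat T\to T$ is the bi-/tri-linear bijective element mapping; $p_T\in\mathbb{N}$, $p_T\ge1$, is the polynomial degree of $T$ (degrees of neighboring elements being comparable). $\mathbb{P}_r(\widehat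 T)$ is the space of polynomials on $\widehat T$ of degree at most $r$ in each variable. $$Q_{hp}:=\{q\in Q: q|_T\circ F_T\in(\mathbb{P}_{p_T-1}(\widehat T))^{d\times d}\ \forall T\in\mathcal{T}_h\}.$$ For $T\in\mathcal{T}_h$, $\hat x_{k,T}$, $k=1,\dots,n_T:=p_T^d$, are the tensor product Gauss quadrature points on $\widehat T$ ($p_T$ per direction) with positive weights $\hat\omega_{k,T}$, and $$\psi_{hp}(q_{hp}):=\sum_{T\in\mathcal{T}_h}\mathcal{Q}_{hp,T}(\sigma_y|q_{hp}|_F),\qquad \mathcal{Q}_{hp,T}(\varphi):=\begin{cases}|T|\,\varphi(F_T(0)),&p_T=1,\\ \sum_{k=1}^{n_T}\hat\omega_{k,T}\,|\det\nabla F_T(\hat x_{k,T})|\,\varphi(F_T(\hat x_{k,T})),&p_T\ge2,\end{cases}$$ $$\Lambda^{(w)}_{hp}:=\{\mu_{hp}\in Q_{hp}: (\mu_{hp},q_{hp})_{0,\Omega}\le\psi_{hp}(q_{hp})\ \forall q_{hp}\in Q_{hp}\}.$$ Bases. Let $\widehat\phi_{k,T}\in\mathbb{P}_{p_T-1}(\widehat T)$ be the Lagrange basis for the Gauss points: $\widehat\phi_{k,T}(\hat x_{l,T})=\delta_{kl}$, $k,l=1,\dots,n_T$. With $N:=\sum_{T}n_T$ and a one-to-one numbering $\zeta:\{(k,T):T\in\mathcal{T}_h,\,1\le k\le n_T\}\to\{1,\dots,N\}$, define $\phi_{\zeta(k,T)}:=\widehat\phi_{k,T}\circ F_T^{-1}$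 on $T$ and $\phi_{\zeta(k,T)}:=0$ on all other elements. The biorthogonal functions $\varphi_1,\dots,\varphi_N$ are uniquely determined by $\varphi_j|_T\circ F_T\in\mathbb{P}_{p_T-1}(\widehat T)$ for all $T\in\mathcal{T}_h$ and $(\phi_i,\varphi_j)_{0,\Omega}=\delta_{ij}\,(\phi_i,1)_{0,\Omega}$ for all $i,j$. One has $Q_{hp}=\{\sum_iq_i\phi_i: q_i\in\mathbb{S}_{d,0}\}=\{\sum_i\mu_i\varphi_i:\mu_i\in\mathbb{S}_{d,0}\}$. Finally $D_i:=(\phi_i,1)_{0,\Omega}$ and $\sigma_i:=D_i^{-1}(\sigma_y,\phi_i)_{0,\Omega}$. *)

(* Defs.v *)
From HB Require Import structures.
From mathcomp Require Import all_boot all_order all_algebra.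
From mathcomp Require Import all_classical all_reals all_analysis.
Import numFieldNormedType.Exports.
Set Implicit Arguments.
Unset Strict Implicit.
Unset Printing Implicit Defensive.
Import Order.TTheory GRing.Theory Num.Theory.
Local Open Scope classical_set_scope.
Local Open Scope ring_scope.

(* 'rV[R]_n carries the sigma-algebra generated by the coordinate functions,
   i.e. the Borel sigma-algebra of R^n. *)
Section measurable_row_vectors.
Context (R : realType) (n : nat).

Let coord (i : 'I_n) (x : 'rV[R]_n) : R := x ord0 i.

Let row_set0 : g_sigma_preimage coord set0.
Proof. exact: sigma_algebra0. Qed.

Let row_setC A : g_sigma_preimage coord A -> g_sigma_preimage coord (~` A).
Proof. exact: sigma_algebraC. Qed.

Let row_bigcup (F : (set _)^nat) : (forall i, g_sigma_preimage coord (F i)) ->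
  g_sigma_preimage coord (\bigcup_i F i).
Proof. exact: sigma_algebra_bigcup. Qed.

HB.instance Definition _ :=
  @isMeasurable.Build (measure_tuple_display default_measure_display)
    'rV[R]_n (g_sigma_preimage coord) row_set0 row_setC row_bigcup.

Lemma measurable_row_coord (i : 'I_n) :
  measurable_fun [set: 'rV[R]_n] (fun x : 'rV[R]_n => x ord0 i).
Proof.
move=> _ Y mY; rewrite setTI; apply: sub_sigma_algebra => /=.
rewrite -bigcup_seq/=; exists i => /=; first by rewrite mem_index_enum.
by exists Y => //; rewrite setTI.
Qed.

Lemma measurable_row d (T : measurableType d) (f : T -> 'rV[R]_n) :
  (forall i, measurable_fun [set: T] (fun x => f x ord0 i)) ->
  measurable_fun [set: T] f.
Proof.
move=> mf _ Y mY; rewrite setTI.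
suff: g_sigma_preimage coord `<=`
    [set B | (measurable : set (set T)) (f @^-1` B)].
  by move=> /(_ _ mY).
apply: smallest_sub.
  split => /=; first by rewrite preimage_set0; exact: measurable0.
  - by move=> A mA; rewrite setTD preimage_setC; exact: measurableC.
  - by move=> F mF; rewrite preimage_bigcup; exact: bigcup_measurable.
rewrite -bigcup_seq/=; apply: bigcup_sub => i _ B [C mC <-] /=.
by rewrite setTI; have := mf i measurableT C mC; rewrite setTI.
Qed.

End measurable_row_vectors.

Section lebesgue_measure_succ.
Context (R : realType) (n : nat).
Variable m : {sigma_finite_measure set 'rV[R]_n -> \bar R}.

Definition row_cons (z : measurableTypeR R * 'rV[R]_n) : 'rV[R]_n.+1 :=
  row_mx (z.1 : R)%:M z.2 : 'rV_(1 + n).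

Definition row_uncons (x : 'rV[R]_n.+1) : measurableTypeR R * 'rV[R]_n :=
  (x ord0 ord0, rsubmx (x : 'rV_(1 + n))).

Lemma row_consK : cancel row_cons row_uncons.
Proof.
case=> t y; rewrite /row_uncons /row_cons /=; congr pair; last by rewrite row_mxKr.
have -> : (ord0 : 'I_n.+1) = lshift n (ord0 : 'I_1) by exact/val_inj.
by rewrite (row_mxEl (t%:M : 'M[R]_1)) mxE eqxx mulr1n.
Qed.

Lemma measurable_row_cons : measurable_fun setT row_cons.
Proof.
apply: measurable_row => i; rewrite /row_cons.
have [j ->|j ->] := split_ordP (i : 'I_(1 + n)).
  apply: (eq_measurable_fun (fun z : measurableTypeR R * 'rV[R]_n => z.1)).
    by move=> z _ /=; rewrite (row_mxEl (z.1%:M : 'M[R]_1)) mxE !ord1 eqxx mulr1n.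
  exact: measurable_fst.
apply: (eq_measurable_fun (fun z : measurableTypeR R * 'rV[R]_n => z.2 ord0 j)).
  by move=> z _ /=; rewrite (row_mxEr (z.1%:M : 'M[R]_1)).
exact: measurableT_comp (measurable_row_coord j) measurable_snd.
Qed.

Lemma measurable_row_uncons : measurable_fun setT row_uncons.
Proof.
apply/measurable_fun_pairP; split; first exact: measurable_row_coord.
apply: measurable_row => i /=.
apply: (eq_measurable_fun (fun x : 'rV[R]_n.+1 => x ord0 (rshift 1 i : 'I_n.+1))).
  by move=> x _ /=; rewrite mxE.
exact: measurable_row_coord.
Qed.

Definition lebesgue_succ : set 'rV[R]_n.+1 -> \bar R :=
  pushforward (@lebesgue_measure R \x m)%E row_cons.

Let lebesgue_succ0 : lebesgue_succ set0 = 0%E.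
Proof. by rewrite /lebesgue_succ /pushforward preimage_set0 measure0. Qed.

Let lebesgue_succ_ge0 A : (0 <= lebesgue_succ A)%E.
Proof. exact: (measure_ge0 (@lebesgue_measure R \x m)%E). Qed.

Let lebesgue_succ_sigma_additive : semi_sigma_additive lebesgue_succ.
Proof.
have mpre A : measurable A -> measurable (row_cons @^-1` A).
  by move=> mA; rewrite -[X in measurable X]setTI; exact: measurable_row_cons.
move=> F mF tF mUF; rewrite /lebesgue_succ /pushforward preimage_bigcup.
apply: measure_semi_sigma_additive.
- by move=> k; exact: mpre.
- apply/trivIsetP => /= i j _ _ ij; rewrite -preimage_setI.
  by move/trivIsetP : tF => /(_ _ _ _ _ ij) ->//; rewrite preimage_set0.
- by rewrite -preimage_bigcup; exact: mpre.
Qed.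

HB.instance Definition _ := isMeasure.Build _ _ _ lebesgue_succ
  lebesgue_succ0 lebesgue_succ_ge0 lebesgue_succ_sigma_additive.

Let lebesgue_succ_sigma_finite : sigma_finite setT lebesgue_succ.
Proof.
have /sigma_finiteP[F [TF ndF Foo]] := sigma_finiteT (@lebesgue_measure R).
have /sigma_finiteP[G [TG ndG Goo]] := sigma_finiteT m.
exists (fun k => row_uncons @^-1` (F k `*` G k)).
  apply/esym; rewrite -subTset => x _.
  have [i _ Fi] : (\bigcup_i F i) (row_uncons x).1 by rewrite -TF.
  have [j _ Gj] : (\bigcup_i G i) (row_uncons x).2 by rewrite -TG.
  exists (maxn i j) => //; split.
    by move: Fi; exact/subsetPset/ndF/leq_maxl.
  by move: Gj; exact/subsetPset/ndG/leq_maxr.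
move=> k; have [mF Fk] := Foo k; have [mG Gk] := Goo k.
have mFG : measurable (F k `*` G k) by exact: measurableX.
split; first by have := measurable_row_uncons measurableT mFG; rewrite setTI.
rewrite /lebesgue_succ /pushforward -comp_preimage
  (_ : row_uncons \o row_cons = id) /=; last exact/funext/row_consK.
by rewrite preimage_id product_measure1E// lte_mul_pinfty// ge0_fin_numE.
Qed.

HB.instance Definition _ := Measure_isSigmaFinite.Build _ _ _ lebesgue_succ
  lebesgue_succ_sigma_finite.

End lebesgue_measure_succ.

(* Lebesgue measure on R^n, as the iterated product of the one on R *)
Fixpoint lebesgue_row (R : realType) n :
    {sigma_finite_measure set 'rV[R]_n -> \bar R} :=
  if n is n'.+1 then lebesgue_succ (lebesgue_row R n')
  else \d_(0 : 'rV[R]_0).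

Section matrices.
Context (R : realType).

Definition frob_inner m n (A B : 'M[R]_(m, n)) : R :=
  \sum_i \sum_j A i j * B i j.

(* On row vectors this is the Euclidean norm, whereas the library norm of a
   matrix is the maximum norm. *)
Definition frob m n (A : 'M[R]_(m, n)) : R := Num.sqrt (frob_inner A A).

Definition sym_traceless d (A : 'M[R]_d) : Prop := A^T = A /\ \tr A = 0.

End matrices.

(* Near every boundary point, Omega is the strict hypograph of a Lipschitz
   function in some orthonormal coordinate system y *m U, the k-th coordinate
   playing the role of the height. *)
Definition lipschitz_domain (R : realType) d (Omega : set 'rV[R]_d) : Prop :=
  [/\ Omega !=set0, open Omega, connected Omega, bounded_set Omega &
   forall x, (closure Omega `\` Omega) x ->
     exists (U : 'M[R]_d) (k : 'I_d) (g : 'rV[R]_d.-1 -> R),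
       [/\ U *m U^T = 1%:M, lipschitz g &
        \forall y \near x,
          Omega y <-> (y *m U) ord0 k < g (col' k (y *m U))]].

Section inner_products.
Context (R : realType) (d : nat) (Omega : set 'rV[R]_d).
Let mu := lebesgue_row R d.

Definition L2 (f : 'rV[R]_d -> R) : Prop :=
  measurable_fun Omega f /\ mu.-integrable Omega (fun x => (f x ^+ 2)%:E).

Definition L2_sym_traceless (q : 'rV[R]_d -> 'M[R]_d) : Prop :=
  (forall i j, L2 (fun x => q x i j)) /\
  (forall x, Omega x -> sym_traceless (q x)).

Definition ip (f g : 'rV[R]_d -> R) : R := \int[mu]_(x in Omega) (f x * g x).

Definition ip_mx (p q : 'rV[R]_d -> 'M[R]_d) : R :=
  \int[mu]_(x in Omega) frob_inner (p x) (q x).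

End inner_products.

Section reference_element.
Context (R : realType).

Definition ref_cube d : set 'rV[R]_d := [set x | forall i, -1 <= x ord0 i <= 1].
Definition open_ref_cube d : set 'rV[R]_d :=
  [set x | forall i, -1 < x ord0 i < 1].

Definition in_P d (r : nat) (f : 'rV[R]_d -> R) : Prop :=
  exists c : {ffun 'I_d -> 'I_r.+1} -> R,
    forall x, f x = \sum_a c a * \prod_i x ord0 i ^+ a i.

(* Rodrigues' formula *)
Definition legendre (p : nat) : {poly R} :=
  (2 ^+ p * p`!%:R)^-1 *: (('X^2 - 1) ^+ p)^`(p).

Definition gauss_nodes (p : nat) (t : 'I_p -> R) : Prop :=
  [/\ injective t, forall k, -1 < t k < 1 & forall k, root (legendre p) (t k)].

Definition gauss_weight (p : nat) (t : 'I_p -> R) (k : 'I_p) : R :=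
  \int[lebesgue_measure]_(s in `[-1, 1])
    \prod_(j < p | j != k) ((s - t j) / (t k - t j)).

(* The p ^ d tensor product points are numbered by the multi-indices
   {ffun 'I_d -> 'I_p} instead of 1, ..., p ^ d. *)
Definition gauss_point d p (t : 'I_p -> R) (k : {ffun 'I_d -> 'I_p}) :
  'rV[R]_d := \row_i t (k i).

Definition gauss_point_weight d p (t : 'I_p -> R) (k : {ffun 'I_d -> 'I_p}) :
  R := \prod_i gauss_weight t (k i).

End reference_element.
Arguments ref_cube {R d}.
Arguments open_ref_cube {R d}.

(* The vertices of an element are numbered by the vertices of the reference
   cube, s i being true when the i-th coordinate of the latter is 1. *)
Record mesh (R : realType) (d : nat) (E : finType) := Mesh {
  vertex : E -> {ffun 'I_d -> bool} -> 'rV[R]_d ;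
  degree : E -> nat }.

Section meshes.
Context (R : realType) (d : nat) (E : finType) (M : mesh R d E).

Definition elt_map (T : E) (x : 'rV[R]_d) : 'rV[R]_d :=
  \sum_(s : {ffun 'I_d -> bool})
    (\prod_i ((if s i then 1 + x ord0 i else 1 - x ord0 i) / 2))
      *: vertex M T s.

Definition elt (T : E) : set 'rV[R]_d := elt_map T @` ref_cube.

Definition diam (T : E) : R :=
  sup [set frob (z.1 - z.2) | z in elt T `*` elt T].

Definition tiling (Omega : set 'rV[R]_d) : Prop :=
  closure Omega = \bigcup_T elt T /\
  forall T T', T != T' -> interior (elt T) `&` interior (elt T') = set0.

Definition bijective_convex_elements : Prop :=
  forall T, {in ref_cube &, injective (elt_map T)} /\
    convex_set (elt T : set (convex_lmodType 'rV[R]_d)).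

(* Jacobian matrices act on row vectors in the library, so J is the transpose
   of the usual gradient; this affects neither det J nor the Frobenius norms. *)
Definition shape_regular (kappa : R) : Prop :=
  forall T x, ref_cube x ->
    let J := 'J (elt_map T) x in
    [/\ J \in unitmx, frob J <= kappa * diam T &
        frob (invmx J) <= kappa / diam T].

Definition neighbors (T T' : E) : Prop := elt T `&` elt T' !=set0.

Definition locally_quasi_uniform (kappa : R) : Prop :=
  forall T T', neighbors T T' -> diam T <= kappa * diam T'.

Definition comparable_degrees (kappa : R) : Prop :=
  (forall T, (1 <= degree M T)%N) /\
  forall T T', neighbors T T' ->
    (degree M T)%:R <= kappa * (degree M T')%:R.

(* No conformity is required: hanging nodes are allowed. *)
Definition fe_mesh (Omega : set 'rV[R]_d) (kappa : R) : Prop :=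
  [/\ tiling Omega, bijective_convex_elements, shape_regular kappa,
      locally_quasi_uniform kappa & comparable_degrees kappa].

(* Two elements may share a face, so a discontinuous function is only required
   to be polynomial on the image of the open cube; the skeleton of the mesh is
   a null set. *)
Definition piecewise_P (f : 'rV[R]_d -> R) : Prop :=
  forall T, exists2 p, in_P (degree M T).-1 p &
    forall x, open_ref_cube x -> f (elt_map T x) = p x.

Definition Q_hp (Omega : set 'rV[R]_d) (q : 'rV[R]_d -> 'M[R]_d) : Prop :=
  L2_sym_traceless Omega q /\ forall i j, piecewise_P (fun x => q x i j).

Context (t : forall p, 'I_p -> R).
Arguments t : clear implicits.

Definition quadrature (T : E) (f : 'rV[R]_d -> R) : R :=
  if degree M T == 1%N then fine (lebesgue_row R d (elt T)) * f (elt_map T 0)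
  else \sum_(k : {ffun 'I_d -> 'I_(degree M T)})
    let x := gauss_point (t (degree M T)) k in
    gauss_point_weight (t (degree M T)) k * `|\det ('J (elt_map T) x)|
      * f (elt_map T x).

(* For q in Q_hp the values below are those of the polynomial representing q in
   T, since 0 and the Gauss points lie in the open reference cube. *)
Definition psi_hp (sigma_y : R) (q : 'rV[R]_d -> 'M[R]_d) : R :=
  \sum_T quadrature T (fun x => sigma_y * frob (q x)).

Definition Lambda_hp (Omega : set 'rV[R]_d) (sigma_y : R)
    (mu : 'rV[R]_d -> 'M[R]_d) : Prop :=
  Q_hp Omega mu /\
  forall q, Q_hp Omega q -> ip_mx Omega mu q <= psi_hp sigma_y q.

Definition dof : finType := {T : E & {ffun 'I_d -> 'I_(degree M T)}}.
Definition ndof : nat := (\sum_T degree M T ^ d)%N.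

Definition lagrange_basis
    (phihat : forall T, {ffun 'I_d -> 'I_(degree M T)} -> 'rV[R]_d -> R) :=
  forall T k, in_P (degree M T).-1 (phihat T k) /\
    forall l, phihat T k (gauss_point (t (degree M T)) l) = (k == l)%:R.

(* On a face shared by two elements the basis functions of both sides take
   their one-sided values; this only concerns a null set. *)
Definition push_elt (T : E) (phihat : 'rV[R]_d -> R) : 'rV[R]_d -> R :=
  (phihat \o pinv ref_cube (elt_map T)) \_ (elt T).

Definition global_basis
    (phihat : forall T, {ffun 'I_d -> 'I_(degree M T)} -> 'rV[R]_d -> R)
    (zeta : dof -> 'I_ndof) (phi : 'I_ndof -> 'rV[R]_d -> R) : Prop :=
  bijective zeta /\
  forall T k, phi (zeta (existT _ T k)) = push_elt T (phihat T k).

Definition biorthogonal (Omega : set 'rV[R]_d)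
    (phi varphi : 'I_ndof -> 'rV[R]_d -> R) : Prop :=
  (forall j, L2 Omega (varphi j) /\ piecewise_P (varphi j)) /\
  forall i j, ip Omega (phi i) (varphi j)
    = (i == j)%:R * ip Omega (phi i) (fun=> 1).

End meshes.

Definition lincomb (R : realType) d N (c : 'I_N -> 'M[R]_d)
    (phi : 'I_N -> 'rV[R]_d -> R) (x : 'rV[R]_d) : 'M[R]_d :=
  \sum_i phi i x *: c i.

Definition sigma_i (R : realType) d (Omega : set 'rV[R]_d) (sigma_y : R)
    (phi : 'rV[R]_d -> R) : R :=
  (ip Omega phi (fun=> 1))^-1 * ip Omega (fun=> sigma_y) phi.

Definition chi (R : realType) d (rho sigma : R) (p lambda : 'M[R]_d) :
  'M[R]_d :=
  Num.max sigma (frob (lambda + rho *: p)) *: lambda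
    - sigma *: (lambda + rho *: p).

(* Main.v *)
Require Import Defs.
From HB Require Import structures.
From mathcomp Require Import all_boot all_order all_algebra.
From mathcomp Require Import all_classical all_reals all_analysis.
From mathcomp Require Import perm measurable_realfun ring lra.
Import numFieldNormedType.Exports.
Set Implicit Arguments.
Unset Strict Implicit.
Unset Printing Implicit Defensive.
Import Order.TTheory GRing.Theory Num.Theory.
Local Open Scope classical_set_scope.
Local Open Scope ring_scope.

(** Everything is local to the nodes. Write [D_i] for the integral of [phi_i],
    [x_i] for the i-th node and, for a field [m], [m_i] for the matrix of
    integrals of [m] against [phi_i] ([moment]).

    Gauss quadrature with p points per direction is exact up to degree 2p - 1
    in each variable ([gauss_exact], [tensor_quadrature_exact]). On an
    element, a function of degree p - 1 times the Jacobian determinant, whose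
    degree is at most d - 1 in each variable, stays in that range if p >= 2
    and d <= 3; if p = 1 the midpoint rule integrates constants exactly. So
    the weight of [psi_hp] at [x_i] is [D_i], which is therefore positive, and
    [psi_hp q = \sum_i D_i * sigma_y * |q x_i|] ([psi_hpE]).

    Off the skeleton of the mesh, a null set, [q = \sum_i q x_i phi_i]
    ([nodal_expansion]), so [(m, q) = \sum_i m_i : q x_i]
    ([ip_mx_nodal]). Hence m in the multiplier set satisfies
    [|m_i| <= D_i * sigma_y] ([Lambda_hp_moment]). For
    [m = \sum_i c_i varphi_i] biorthogonality gives [m_i = D_i c_i]
    ([moment_lincomb]), and membership is equivalent to [|c_i| <= sigma_y]
    for all i ([Lambda_hp_lincomb]). As [sigma_i = sigma_y], the variational
    inequality decouples into [(nu - lambda_i) : p_i <= 0] for all nu in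
    the ball of radius [sigma_y]: [lambda_i] is the projection of
    [lambda_i + rho p_i] onto this ball, which is what [chi_i = 0] says
    ([projection_chi]).

    The analytic input is the formula for the change of variables y = F x when
    F is affine in each coordinate ([change_of_variables]). Linear maps scale
    Lebesgue measure by the determinant, by block elimination and Tonelli's
    theorem ([scales_volume_unit]). Near a point, F maps a small cube to a set
    between the linear images of slightly smaller and larger cubes, the inner
    inclusion being an instance of the Banach fixed point theorem
    ([ccube_sub_image]). Hence two charts of the same density give a small
    cell nearly the same mass; by compactness this holds uniformly, and a sum
    over a grid compares the total masses ([chart_mass_le]). Upper bounds use
    closed cells and lower bounds open ones, so that the images of the faces
    are null sets at no extra cost ([lebesgue_image_boundary]). The Lipschitz
    property of the domain makes the interior of its closure part of the
    domain ([interior_closure_lipschitz]), so the open elements lie in the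
    domain and cover it up to a null set. *)

(** * Affine changes of variables for Lebesgue measure *)

(** [`|a|] times the image measure agrees with Lebesgue measure on half-open
    intervals, which determine it. *)
Lemma lebesgue_measure_affine (R : realType) (a b : R)
    (S : set (measurableTypeR R)) : a != 0 -> measurable S ->
  lebesgue_measure [set t | S (a * t + b)] =
  (`|a|^-1%:E * lebesgue_measure S)%E.
Proof.
move=> a0 mS.
pose f : measurableTypeR R -> measurableTypeR R := fun t => a * t + b.
have mf : measurable_fun setT f.
  by apply: measurable_funD => //; exact: measurable_funM.
pose m' : {measure set (measurableTypeR R) -> \bar R} :=
  mscale (NngNum (normr_ge0 a))
    (measure_function_pushforward__canonical__measure_function_Measure
       lebesgue_measure mf).
suff /(_ _ mS) -> : forall A, measurable A -> lebesgue_measure A = m' A.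
  rewrite /= /mscale/= muleA -EFinM mulVf ?normr_eq0// mul1e.
  by rewrite /pushforward.
apply: lebesgue_measure_unique => _ [[x y]] _ <-.
rewrite /m' /= /mscale/= /pushforward.
have an0 : `|a| != 0 by rewrite normr_eq0.
have pos (c : R) : 0 < `|a| * c = (0 < c) by rewrite pmulr_rgt0// normr_gt0.
have [ap|an|] := ltgtP 0 a; last by move/esym/eqP; rewrite (negPf a0).
  have -> : f @^-1` [set` `]x, y]] = [set` `](x - b) / a, (y - b) / a]].
    apply/seteqP; split => t/=; rewrite !in_itv/= /f => /andP[h1 h2];
    rewrite ?ltr_pdivrMr ?ler_pdivlMr// in h1 h2 *; apply/andP; split; lra.
  rewrite !lebesgue_measure_itv/= !lte_fin ltr_pM2r ?invr_gt0// ltrD2r.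
  case: ifP => _; last by rewrite mule0.
  by rewrite -!EFinD -EFinM gtr0_norm//; congr EFin; field.
have -> : f @^-1` [set` `]x, y]] = [set` `[(y - b) / a, (x - b) / a[].
  apply/seteqP; split => t/=; rewrite !in_itv/= /f => /andP[h1 h2];
  rewrite ?ltr_ndivlMr ?ler_ndivrMr// in h1 h2 *; apply/andP; split; lra.
rewrite !lebesgue_measure_itv/= !lte_fin ltr_nM2r ?invr_lt0// ltrD2r.
case: ifP => _; last by rewrite mule0.
by rewrite -!EFinD -EFinM ltr0_norm//; congr EFin; field; apply/eqP => h;
  rewrite h eqxx in a0.
Qed.

Lemma measurable_row_affine (R : realType) m n (A : 'M[R]_(m, n)) (c : 'rV[R]_n) :
  measurable_fun setT (fun x : 'rV[R]_m => x *m A + c).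
Proof.
apply: measurable_row => i.
apply: (eq_measurable_fun
  (fun x : 'rV[R]_m => \sum_j x ord0 j * A j i + c ord0 i)).
  by move=> x _; rewrite !mxE.
apply: measurable_funD => //; apply: measurable_sum => j.
by apply: measurable_funM => //; exact: measurable_row_coord.
Qed.

Lemma measurable_preimage d d' (T : measurableType d) (T' : measurableType d')
    (f : T -> T') (S : set T') :
  measurable_fun setT f -> measurable S -> measurable (f @^-1` S).
Proof. by move=> mf mS; rewrite -[X in measurable X]setTI; exact: mf. Qed.

Lemma lebesgue_rowS (R : realType) n (S : set 'rV[R]_n.+1) :
  lebesgue_row R n.+1 S =
  (\int[@lebesgue_measure R]_t
     lebesgue_row R n [set y | S (row_cons (t, y))])%E.
Proof.
rewrite /= /lebesgue_succ /pushforward /product_measure1.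
apply: eq_integral => t _ /=; congr (lebesgue_row R n _).
by rewrite /xsection; apply/seteqP; split => y/=; rewrite inE.
Qed.

(** The n+1-dimensional measure is defined by slicing along the first
    coordinate. Tonelli's theorem allows the opposite order, in which each
    slice is a line; a map that moves only the first coordinate is then
    handled by [lebesgue_measure_affine]. *)
Lemma lebesgue_rowSy (R : realType) n (S : set 'rV[R]_n.+1) : measurable S ->
  lebesgue_row R n.+1 S =
  (\int[lebesgue_row R n]_y
     @lebesgue_measure R [set t | S (row_cons (t, y))])%E.
Proof.
move=> mS; have mS' := measurable_preimage (@measurable_row_cons R n) mS.
transitivity ((@lebesgue_measure R \x^ lebesgue_row R n)%E (@row_cons R n @^-1` S)).
  by apply: product_measure_unique => //= A B mA mB; rewrite product_measure2E.
apply: eq_integral => y _ /=; congr lebesgue_measure.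
by rewrite /ysection; apply/seteqP; split => t/=; rewrite inE.
Qed.


(** The translation [c] is part of the definition because slicing a block
    triangular map leaves in the remaining block a translation depending on
    the sliced coordinate. *)
Definition scales_volume (R : realType) n (M : 'M[R]_n) : Prop :=
  forall (c : 'rV[R]_n) (S : set 'rV[R]_n), measurable S ->
    lebesgue_row R n [set x | S (x *m M + c)] =
    (`|\det M|^-1%:E * lebesgue_row R n S)%E.

Lemma scales_volumeM (R : realType) n (A B : 'M[R]_n) :
  scales_volume A -> scales_volume B -> scales_volume (A *m B).
Proof.
move=> hA hB c S mS.
have mSB := measurable_preimage (measurable_row_affine B c) mS.
have /= := hA 0 _ mSB.
rewrite [X in lebesgue_row R n X](_ : _ = [set x | S (x *m (A *m B) + c)]).
  by move=> ->; rewrite hB// det_mulmx normrM invfM EFinM muleA.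
by apply/seteqP; split=> x /=; rewrite addr0 mulmxA.
Qed.

Lemma row_consE (R : realType) n (t : R) (y : 'rV[R]_n) :
  row_cons (t, y) = row_mx t%:M y.
Proof. by []. Qed.

Lemma measurable_section_row (R : realType) n (S : set 'rV[R]_n.+1) (t : R) :
  measurable S -> measurable [set y : 'rV[R]_n | S (row_cons (t, y))].
Proof.
move=> mS; have := measurable_xsection t
  (measurable_preimage (@measurable_row_cons R n) mS).
by rewrite /xsection; congr measurable; apply/seteqP; split => y/=; rewrite inE.
Qed.

Lemma measurable_section_head (R : realType) n (S : set 'rV[R]_n.+1)
    (y : 'rV[R]_n) :
  measurable S ->
  measurable [set t : measurableTypeR R | S (row_cons (t, y))].
Proof.
move=> mS; have := measurable_ysection y
  (measurable_preimage (@measurable_row_cons R n) mS).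
by rewrite /ysection; congr measurable; apply/seteqP; split => t/=; rewrite inE.
Qed.

Lemma measurable_lebesgue_row_section (R : realType) n (S : set 'rV[R]_n.+1) :
  measurable S -> measurable_fun setT (fun t : measurableTypeR R =>
    lebesgue_row R n [set y | S (row_cons (t, y))]).
Proof.
move=> mS; have := measurable_fun_xsection (lebesgue_row R n)
  (measurable_preimage (@measurable_row_cons R n) mS).
congr measurable_fun; apply/funext => t /=; congr (lebesgue_row R n _).
by rewrite /xsection; apply/seteqP; split => y/=; rewrite inE.
Qed.

Lemma measurable_lebesgue_head_section (R : realType) n (S : set 'rV[R]_n.+1) :
  measurable S -> measurable_fun setT (fun y : 'rV[R]_n =>
    @lebesgue_measure R [set t | S (row_cons (t, y))]).
Proof.
move=> mS; have := measurable_fun_ysection (@lebesgue_measure R)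
  (measurable_preimage (@measurable_row_cons R n) mS).
congr measurable_fun; apply/funext => y /=; congr (lebesgue_measure _).
by rewrite /ysection; apply/seteqP; split => t/=; rewrite inE.
Qed.

Lemma lebesgue_row_shiftS (R : realType) n (c : 'rV[R]_n.+1)
    (S : set 'rV[R]_n.+1) :
  scales_volume (1%:M : 'M[R]_n) -> measurable S ->
  lebesgue_row R n.+1 [set x | S (x + c)] = lebesgue_row R n.+1 S.
Proof.
move=> s1 mS.
have mshift (e : 'rV[R]_n.+1) S' : measurable S' -> measurable [set x | S' (x + e)].
  move=> mS'; have := measurable_preimage (measurable_row_affine 1%:M e) mS'.
  by congr measurable; apply/seteqP; split=> x /=; rewrite mulmx1.
pose c1 := row_cons (c ord0 ord0, 0 : 'rV_n).
pose c2 := row_cons (0, rsubmx (c : 'rV_(1 + n))).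
have cE : c = c1 + c2.
  rewrite /c1 /c2 !row_consE (@add_row_mx _ 1 1 n) add0r raddf0 addr0.
  rewrite -[LHS](@hsubmxK _ 1 1 n) [lsubmx _]mx11_scalar mxE.
  by congr (row_mx (c _ _)%:M _); apply/val_inj.
transitivity (lebesgue_row R n.+1 [set x | S (x + c2)]); last first.
  rewrite [LHS]lebesgue_rowS [RHS]lebesgue_rowS; apply: eq_integral => t _.
  have := s1 (rsubmx (c : 'rV_(1 + n))) _ (measurable_section_row t mS).
  rewrite det1 normr1 invr1 mul1e => <-; congr (lebesgue_row R n _).
  apply/seteqP; split=> y /=;
    by rewrite !row_consE mulmx1 (@add_row_mx _ 1 1 n) raddf0 addr0.
rewrite lebesgue_rowSy; last exact: mshift.
rewrite lebesgue_rowSy; last exact: mshift.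
apply: eq_integral => y _.
have := lebesgue_measure_affine (c ord0 ord0) (oner_neq0 R)
  (measurable_section_head y (mshift c2 _ mS)).
rewrite normr1 invr1 mul1e /= => <-; congr (lebesgue_measure _).
have tE t : row_cons (t + c ord0 ord0, y) + c2 = row_cons (t, y) + c.
  by rewrite [in RHS]cE addrA !row_consE !(@add_row_mx _ 1 1 n) addr0 raddfD.
by apply/seteqP; split=> t /=; rewrite mul1r tE.
Qed.

(** By translation invariance, which in dimension n+1 follows from the same in
    dimension n by slicing. *)
Lemma scales_volume_linear (R : realType) n (M : 'M[R]_n.+1) :
  scales_volume (1%:M : 'M[R]_n) ->
  (forall S : set 'rV[R]_n.+1, measurable S ->
    lebesgue_row R n.+1 [set x | S (x *m M)] =
    (`|\det M|^-1%:E * lebesgue_row R n.+1 S)%E) ->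
  scales_volume M.
Proof.
move=> s1 hM c S mS.
rewrite (hM [set x | S (x + c)]) ?lebesgue_row_shiftS//.
have := measurable_preimage (measurable_row_affine 1%:M c) mS.
by congr measurable; apply/seteqP; split=> x /=; rewrite mulmx1.
Qed.

(** For a fixed first coordinate [t] the remaining coordinates undergo the
    affine map [y |-> y *m D + t *: b], so slice along the first
    coordinate. *)
Lemma scales_volume_ublock (R : realType) n (b : 'rV[R]_n) (D : 'M[R]_n) :
  scales_volume (1%:M : 'M[R]_n) -> scales_volume D ->
  scales_volume (block_mx 1%:M b 0 D : 'M[R]_(1 + n)).
Proof.
move=> s1 hD; apply: scales_volume_linear => // S mS.
rewrite (@det_ublock _ 1 n) det1 mul1r [LHS]lebesgue_rowS [in RHS]lebesgue_rowS.
rewrite -ge0_integralZl//; last exact: (measurable_lebesgue_row_section mS).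
apply: eq_integral => t _.
rewrite -(hD (t *: b) _ (measurable_section_row t mS)).
congr (lebesgue_row R n _); apply/seteqP; split=> y /=;
  by rewrite !row_consE (@mul_row_block _ 1 1 n 1 n) mulmx1 mulmx0 addr0
    mul_scalar_mx addrC.
Qed.

(** For fixed remaining coordinates [y] the first one undergoes the affine map
    [t |-> a * t + y *m b], so slice the other way. *)
Lemma scales_volume_lblock (R : realType) n (a : R) (b : 'cV[R]_n) :
  scales_volume (1%:M : 'M[R]_n) -> a != 0 ->
  scales_volume (block_mx a%:M 0 b 1%:M : 'M[R]_(1 + n)).
Proof.
move=> s1 a0; apply: scales_volume_linear => // S mS.
have mS' : measurable [set x : 'rV[R]_n.+1 | S (x *m block_mx a%:M 0 b 1%:M)].
  have := measurable_preimage
    (measurable_row_affine (block_mx a%:M 0 b 1%:M : 'M[R]_(1 + n)) 0) mS.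
  by congr measurable; apply/seteqP; split=> x /=; rewrite addr0.
rewrite (@det_lblock _ 1 n) det1 mulr1 det_scalar1.
rewrite [LHS]lebesgue_rowSy// [in RHS]lebesgue_rowSy//.
rewrite -ge0_integralZl//; last exact: (measurable_lebesgue_head_section mS).
apply: eq_integral => y _.
rewrite -(lebesgue_measure_affine ((y *m b) ord0 ord0) a0
  (measurable_section_head y mS)).
congr (lebesgue_measure _); apply/seteqP; split=> t /=;
  by rewrite !row_consE (@mul_row_block _ 1 1 n 1 n) mulmx1 mulmx0 add0r
    -scalar_mxM [y *m b]mx11_scalar -raddfD /= mulrC !mxE eqxx mulr1n.
Qed.

(** Block elimination: when the first entry of [M] is not zero, [M] is the
    product of a lower and an upper block triangular matrix, the latter built
    on the Schur complement, to which the induction applies. *)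
Lemma scales_volume_unit (R : realType) n (M : 'M[R]_n) :
  M \in unitmx -> scales_volume M.
Proof.
elim: n M => [|n IHn] M uM.
  move=> c S mS; rewrite det_mx00 normr1 invr1 mul1e; congr (lebesgue_row R 0 _).
  by apply/seteqP; split => x /=; rewrite [x *m M + c]thinmx0 [x]thinmx0.
have s1 : scales_volume (1%:M : 'M[R]_n) by apply: IHn; exact: unitmx1.
have pivot (N : 'M[R]_(1 + n)) : N \in unitmx -> ulsubmx N ord0 ord0 != 0 ->
    scales_volume N.
  move=> uN N0.
  set a := ulsubmx N ord0 ord0 in N0.
  have aE : ulsubmx N = a%:M by rewrite [LHS]mx11_scalar.
  pose D := drsubmx N - a^-1 *: (dlsubmx N *m ursubmx N).
  have NE : N = block_mx a%:M 0 (dlsubmx N) 1%:M *m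
                block_mx 1%:M (a^-1 *: ursubmx N) 0 D.
    rewrite mulmx_block !mulmx1 !mulmx0 !mul0mx !addr0 !mul1mx mul_scalar_mx.
    rewrite scalerA divff// scale1r -scalemxAr addrC addrNK -aE.
    by rewrite submxK.
  rewrite NE; apply: scales_volumeM; first exact: scales_volume_lblock.
  apply: scales_volume_ublock => //; apply: IHn; move: uN; rewrite NE !unitmxE det_mulmx.
  by rewrite det_ublock det1 mul1r unitrM => /andP[].
have [M0|] := eqVneq (ulsubmx (M : 'M[R]_(1 + n)) ord0 ord0) 0; last exact: pivot.
(* Zero pivot: let [c] be the rest of the first column, nonzero since [M] is
   invertible. Adding to the first row the others weighted by [c] makes the
   pivot the sum of the squares of the entries of [c]. *)
pose c := dlsubmx (M : 'M[R]_(1 + n)).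
pose V (e : 'rV[R]_n) : 'M[R]_(1 + n) := block_mx 1%:M e 0 1%:M.
have VV : V (- c^T) *m V c^T = 1%:M.
  rewrite mulmx_block !mulmx1 !mulmx0 !mul0mx !addr0 !mul1mx add0r subrr.
  by rewrite -scalar_mx_block.
have uV e : V e \in unitmx by rewrite unitmxE det_ublock !det1 mulr1 unitr1.
have -> : M = V (- c^T) *m (V c^T *m (M : 'M[R]_(1 + n))).
  by rewrite mulmxA VV mul1mx.
apply: scales_volumeM; first exact: scales_volume_ublock.
apply: pivot; first by rewrite unitmx_mul uV.
have c0 : c != 0.
  apply/eqP => c0; have := uM; rewrite -[M](@submxK R 1 n 1 n) -/c c0 unitmxE.
  by rewrite (@det_ublock _ 1 n) det_mx11 M0 mul0r unitr0.
rewrite -[M in X in ulsubmx X](@submxK R 1 n 1 n) mulmx_block block_mxKul mul1mx.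
rewrite mxE M0 add0r -/c; move: (c) c0 => e; apply: contraNneq; rewrite mxE.
under eq_bigr do rewrite mxE -expr2.
move/eqP; rewrite psumr_eq0 => [/allP e0|j _]; last exact: sqr_ge0.
apply/eqP/colP => i; rewrite mxE; apply/eqP.
by rewrite -sqrf_eq0; apply: e0; rewrite mem_index_enum.
Qed.


(** * Cubes and Borel sets of R^n *)

Lemma row_cons0 (R : realType) n (t : R) (y : 'rV[R]_n) :
  row_cons (t, y) ord0 ord0 = t.
Proof. by have /(congr1 fst) := row_consK (t, y). Qed.

Lemma row_consS (R : realType) n (t : R) (y : 'rV[R]_n) i :
  row_cons (t, y) ord0 (lift ord0 i) = y ord0 i.
Proof.
rewrite row_consE (_ : lift ord0 i = rshift 1 i); last exact/val_inj.
by rewrite (@row_mxEr _ 1 1 n).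
Qed.

Lemma ord_0_or_lift n (i : 'I_n.+1) : i = ord0 \/ exists j, i = lift ord0 j.
Proof. by case: (unliftP ord0 i) => [j ->|->]; [right; exists j|left]. Qed.

Lemma rV_normrP (R : realType) n (x : 'rV[R]_n) (r : R) : 0 <= r ->
  `|x| <= r <-> forall i, `|x ord0 i| <= r.
Proof.
move=> r0; rewrite {1}/Num.norm/= mx_normrE; split.
  move=> /bigmax_leP[_ h] i; exact: (h (ord0, i)).
by move=> h; apply/bigmax_leP; split => // -[i j] _ /=; rewrite ord1.
Qed.

Lemma rV_norm_coord (R : realType) n (x : 'rV[R]_n) i : `|x ord0 i| <= `|x|.
Proof. by move: i; apply/rV_normrP. Qed.

Definition ccube (R : realType) n (c : 'rV[R]_n) (r : R) : set 'rV[R]_n :=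
  [set x | forall i, `|x ord0 i - c ord0 i| <= r].

Definition ocube (R : realType) n (c : 'rV[R]_n) (r : R) : set 'rV[R]_n :=
  [set x | forall i, `|x ord0 i - c ord0 i| < r].

Lemma ocube_ball (R : realType) n (c : 'rV[R]_n) (r : R) : 0 < r ->
  ocube c r = ball c r.
Proof.
move=> r0; apply/seteqP; split => x.
  by move=> h; split=> // i j; rewrite ord1 /ball/= distrC; exact: h.
by move=> [_ h] i; have := h ord0 i; rewrite /ball/= distrC.
Qed.

Lemma ccubeP (R : realType) n (c x : 'rV[R]_n) (r : R) : 0 <= r ->
  ccube c r x <-> `|x - c| <= r.
Proof.
by move=> r0; split=> [h|/(rV_normrP _ r0) h] => [|i];
  [apply/rV_normrP => // i|]; have := h i; rewrite !mxE.
Qed.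

Lemma sub_ocube (R : realType) n (c : 'rV[R]_n) (r : R) : ocube c r `<=` ccube c r.
Proof. by move=> x h i; exact/ltW. Qed.

Lemma sub_ccube_ocube (R : realType) n (c : 'rV[R]_n) (r s : R) : r < s ->
  ccube c r `<=` ocube c s.
Proof. by move=> rs x h i; rewrite (le_lt_trans _ rs). Qed.

Lemma open_ocube (R : realType) n (c : 'rV[R]_n) (r : R) : open (ocube c r).
Proof.
have [r0|r0] := ltP 0 r; first by rewrite ocube_ball//; exact: ball_open.
case: n c => [|n] c; last first.
  rewrite (_ : ocube c r = set0); first exact: open0.
  apply/seteqP; split=> // x /(_ ord0) /=; rewrite ltNge => /negP; apply.
  by rewrite (le_trans r0).
rewrite (_ : ocube c r = setT); first exact: openT.
by apply/seteqP; split=> // x _ [].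
Qed.

Lemma compact_ccube (R : realType) n (c : 'rV[R]_n) (r : R) : compact (ccube c r).
Proof.
rewrite (_ : ccube c r =
  [set x | forall i, `[c ord0 i - r, c ord0 i + r]%classic (x ord0 i)]).
  apply: (@rV_compact _ n
    (fun i => `[c ord0 i - r, c ord0 i + r]%classic)) => i.
  exact: segment_compact.
by apply/seteqP; split=> x h i; have := h i; rewrite /= in_itv/= ler_distl.
Qed.

Lemma closed_ccube (R : realType) n (c : 'rV[R]_n) (r : R) : closed (ccube c r).
Proof. by apply: compact_closed; [exact: norm_hausdorff | exact: compact_ccube]. Qed.

Lemma measurable_box (R : realType) n (I : 'I_n -> interval R) :
  measurable [set x : 'rV[R]_n | forall i, x ord0 i \in I i].
Proof.
rewrite (_ : [set _ | _] = \big[setI/setT]_(i < n)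
    ((fun x : 'rV[R]_n => x ord0 i) @^-1` [set` I i])).
  apply: bigsetI_measurable => i _.
  apply: measurable_preimage; first exact: measurable_row_coord.
  exact: measurable_itv.
rewrite -bigcap_seq; apply/seteqP; split=> x /=.
  by move=> h i _; exact: h.
by move=> h i; apply: h; rewrite /= mem_index_enum.
Qed.

Lemma lebesgue_row_box (R : realType) n (I : 'I_n -> interval R) :
  lebesgue_row R n [set x : 'rV[R]_n | forall i, x ord0 i \in I i] =
  (\prod_(i < n) lebesgue_measure [set` I i])%E.
Proof.
elim: n I => [|n IHn] I.
  rewrite big_ord0 /= diracE mem_set//; by case.
rewrite big_ord_recl /= -IHn /lebesgue_succ /pushforward.
rewrite -product_measure1E; [|exact: measurable_itv|exact: measurable_box].
congr (product_measure1 _ _ _); apply/seteqP; split => -[t y]/=.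
  move=> h; split=> [|i]; first by have := h ord0; rewrite row_cons0.
  by have := h (lift ord0 i); rewrite row_consS.
move=> [ht hy] i; have [->|[j ->]] := ord_0_or_lift i; first by rewrite row_cons0.
by rewrite row_consS.
Qed.

Lemma ccube_box (R : realType) n (c : 'rV[R]_n) (r : R) : ccube c r =
  [set x | forall i, x ord0 i \in `[c ord0 i - r, c ord0 i + r]].
Proof.
by apply/seteqP; split=> x h i; have := h i; rewrite /= in_itv/= ler_distl.
Qed.

Lemma ocube_box (R : realType) n (c : 'rV[R]_n) (r : R) : ocube c r =
  [set x | forall i, x ord0 i \in `]c ord0 i - r, c ord0 i + r[].
Proof.
by apply/seteqP; split=> x h i; have := h i; rewrite /= in_itv/= ltr_distl.
Qed.

Lemma measurable_ccube (R : realType) n (c : 'rV[R]_n) (r : R) :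
  measurable (ccube c r).
Proof. by rewrite ccube_box; exact: measurable_box. Qed.

Lemma measurable_ocube (R : realType) n (c : 'rV[R]_n) (r : R) :
  measurable (ocube c r).
Proof. by rewrite ocube_box; exact: measurable_box. Qed.

Lemma lebesgue_row_ccube (R : realType) n (c : 'rV[R]_n) (r : R) : 0 < r ->
  lebesgue_row R n (ccube c r) = ((2 * r) ^+ n)%:E.
Proof.
move=> r0; rewrite ccube_box lebesgue_row_box.
under eq_bigr => i _.
  rewrite lebesgue_measure_itv/= lte_fin.
  rewrite (_ : c ord0 i - r < c ord0 i + r); last lra.
  rewrite -EFinB (_ : _ + r - _ = 2 * r); last by ring.
  over.
by rewrite prodEFin prodr_const card_ord.
Qed.

(** The sigma-algebra is generated by the coordinates, so it contains the
    cubes, and an open set is a countable union of cubes of rational centre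
    and radius [1/(k+1)]. *)
Lemma open_measurable_row (R : realType) n (U : set 'rV[R]_n) :
  open U -> measurable U.
Proof.
move=> oU.
pose F (k : {ffun 'I_n -> rat} * nat) : set 'rV[R]_n :=
  ocube (\row_i ratr (k.1 i)) (k.2.+1%:R^-1).
rewrite (_ : U = \bigcup_(k in [set k | F k `<=` U]) F k).
  rewrite bigcup_mkcond; apply: countable_bigcupT_measurable => //.
  by move=> k; case: ifP => _; [exact: measurable_ocube | exact: measurable0].
apply/seteqP; split => [x Ux|x [k kU]]; last exact: kU.
have [e /= e0 xeU] := (nbhs_ballP _ _).1 (open_nbhs_nbhs (conj oU Ux)).
have [k] := ltr_add_invr (divr_gt0 e0 (ltr0n R 2)); rewrite add0r => ke.
have k0 : 0 < k.+1%:R^-1 :> R by rewrite invr_gt0.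
suff [q xFq Fqe] : exists2 q : {ffun 'I_n -> rat},
    F (q, k) x & F (q, k) `<=` ball x e.
  by exists (q, k) => // y /Fqe /xeU.
rewrite /F /=; move: k.+1%:R^-1 ke k0 => r ke k0 {F}.
have hq i : {q : rat | ratr q \in `]x ord0 i - r, x ord0 i + r[}.
  by apply/cid/rat_in_itvoo; lra.
exists [ffun i => sval (hq i)].
  move=> i; rewrite !mxE ffunE; case: (hq i) => q /=; rewrite in_itv/=.
  by rewrite ltr_distl => /andP[? ?]; apply/andP; split; lra.
move=> y /= Fy; rewrite -ocube_ball// => i.
have := Fy i; rewrite !mxE ffunE; case: (hq i) => q /=; rewrite in_itv/=.
by rewrite !ltr_distl => /andP[? ?] /andP[? ?]; apply/andP; split; lra.
Qed.

Lemma compact_measurable_row (R : realType) n (K : set 'rV[R]_n) :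
  compact K -> measurable K.
Proof.
move=> /(compact_closed (@norm_hausdorff _ _)) cK.
rewrite -[K]setCK; apply: measurableC; apply: open_measurable_row.
exact: closed_openC.
Qed.

Lemma continuous_measurable_row (R : realType) n (f : 'rV[R]_n -> R) :
  continuous f -> measurable_fun setT f.
Proof.
move=> cf; apply: (measurability _ (RGenOInfty.measurableE R)) => //.
move=> _ [_ [a ->] <-]; rewrite setTI; apply: open_measurable_row.
by move/continuousP: cf; apply; exact: rray_open.
Qed.


(** * Maps affine in each coordinate *)

Definition upd (R : realType) n (x : 'rV[R]_n) (i : 'I_n) (s : R) : 'rV[R]_n :=
  \row_j (if j == i then s else x ord0 j).

Definition multi_affine (R : realType) n m (F : 'rV[R]_n -> 'rV[R]_m) : Prop :=
  forall x i s, F (upd x i s) =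
    F (upd x i 0) + s *: (F (upd x i 1) - F (upd x i 0)).

(** The i-th partial derivative: a difference quotient over a unit step is
    exact for a map affine in the i-th coordinate, and does not depend on that
    coordinate ([slope_upd]). *)
Definition slope (R : realType) n m (F : 'rV[R]_n -> 'rV[R]_m) (i : 'I_n)
  (x : 'rV[R]_n) : 'rV[R]_m := F (upd x i 1) - F (upd x i 0).

Definition slope_mx (R : realType) n m (F : 'rV[R]_n -> 'rV[R]_m)
  (x : 'rV[R]_n) : 'M[R]_(n, m) := \matrix_(i < n) slope F i x.

Section lipschitz_continuity.
Context (R : realType) (V W : normedModType R).

Lemma dist_continuous (f : V -> W) (C : R) :
  (forall x y, `|f x - f y| <= C * `|x - y|) -> continuous f.
Proof.
move=> fC x; apply/cvgrPdist_lt => e e0.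
have C1 : 0 < `|C| + 1 by rewrite ltr_wpDl.
near=> y.
rewrite (le_lt_trans (fC _ _))//.
rewrite (@le_lt_trans _ _ ((`|C| + 1) * `|x - y|))//.
  by rewrite ler_wpM2r// (le_trans (ler_norm C))// lerDl.
rewrite mulrC -ltr_pdivlMr//; near: y; apply/nbhs_ballP.
exists (e / (`|C| + 1)) => /=; first by rewrite divr_gt0.
by move=> y; rewrite -ball_normE.
Unshelve. all: by end_near. Qed.

End lipschitz_continuity.

Section multi_affine_maps.
Context (R : realType) (n : nat).
Implicit Types (x y : 'rV[R]_n).

Lemma upd_id x i : upd x i (x ord0 i) = x.
Proof. by apply/rowP => j; rewrite mxE; case: eqP => [->|]. Qed.

Lemma upd_upd x i s t : upd (upd x i s) i t = upd x i t.
Proof. by apply/rowP => j; rewrite !mxE; case: eqP. Qed.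

Lemma upd_same x i s : upd x i s ord0 i = s.
Proof. by rewrite mxE eqxx. Qed.

Lemma upd_other x i j s : j != i -> upd x i s ord0 j = x ord0 j.
Proof. by rewrite mxE => /negPf ->. Qed.

Lemma upd_comm x i j s t : i != j ->
  upd (upd x i s) j t = upd (upd x j t) i s.
Proof.
move=> ij; apply/rowP => k; rewrite !mxE; case: eqP => [->|//].
by rewrite eq_sym (negPf ij).
Qed.

Lemma continuous_upd i s : continuous (fun x => upd x i s).
Proof.
apply: (@dist_continuous _ _ _ _ 1) => x y; rewrite mul1r.
apply/rV_normrP => // j; rewrite !mxE; case: eqP => _; first by rewrite subrr normr0.
by have := rV_norm_coord (x - y) j; rewrite !mxE.
Qed.

Lemma mulmx_norm m (A : 'M[R]_(n, m)) x :
  `|x *m A| <= (\sum_i `|row i A|) * `|x|.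
Proof.
rewrite mulmx_sum_row (le_trans (ler_norm_sum _ _ _))// mulr_suml ler_sum// => i _.
by rewrite normrZ mulrC ler_wpM2l// rV_norm_coord.
Qed.

Lemma continuous_mulmxr m (A : 'M[R]_(n, m)) : continuous (fun x => x *m A).
Proof.
apply: (@dist_continuous _ _ _ _ (\sum_i `|row i A|)) => x y.
by rewrite -mulmxBl mulmx_norm.
Qed.

Context (m : nat) (F : 'rV[R]_n -> 'rV[R]_m).

Lemma slope_upd i x s : slope F i (upd x i s) = slope F i x.
Proof. by rewrite /slope !upd_upd. Qed.

Lemma continuous_slope i : continuous F -> continuous (slope F i).
Proof.
move=> cF.
have c s : continuous (fun z => F (upd z i s)).
  move=> z; apply: (@continuous_comp _ _ _ (fun z => upd z i s) F z).
    exact: continuous_upd.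
  exact: cF.
by move=> x; apply: (@continuousB _ _ _ _ _ _ (c 1 x) (c 0 x)).
Qed.

Hypothesis maF : multi_affine F.

Lemma multi_affine_upd x i s t :
  F (upd x i s) - F (upd x i t) = (s - t) *: slope F i x.
Proof.
rewrite maF [F (upd x i t)]maF -/(slope F i x).
by rewrite scalerBl opprD addrACA subrr add0r.
Qed.

(* the vertices of a path from y to x along the coordinate axes *)
Let path x y (k : nat) : 'rV[R]_n :=
  \row_(j < n) (if (j < k)%N then x ord0 j else y ord0 j).

(** Each step of an axis-parallel path from [y] to [x] changes [F] by a
    multiple of a slope. This replaces the mean value theorem, and the
    vertices [z i] stay in any box containing [x] and [y]. *)
Lemma multi_affine_diff x y : exists z : 'I_n -> 'rV[R]_n,
  (forall i j, z i ord0 j = x ord0 j \/ z i ord0 j = y ord0 j) /\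
  F x - F y = \sum_i (x ord0 i - y ord0 i) *: slope F i (z i).
Proof.
exists (fun i => path x y i); split.
  by move=> i j; rewrite mxE; case: ifP; [left|right].
have pathS (i : 'I_n) : path x y i.+1 = upd (path x y i) i (x ord0 i).
  apply/rowP => j; rewrite !mxE; have [->|ji] := eqVneq j i.
    by rewrite ltnSn.
  by rewrite ltnS leq_eqVlt val_eqE (negPf ji).
have path0 (i : 'I_n) : path x y i = upd (path x y i) i (y ord0 i).
  apply/rowP => j; rewrite !mxE; have [->|//] := eqVneq j i.
  by rewrite ltnn.
transitivity (\sum_(0 <= k < n) (F (path x y k.+1) - F (path x y k))).
  rewrite telescope_sumr//; congr (F _ - F _); apply/rowP => j; rewrite mxE//.
  by rewrite ltn_ord.
rewrite big_mkord; apply: eq_bigr => i _.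
by rewrite pathS {2}path0 multi_affine_upd.
Qed.

(** Strict differentiability, uniform in both points: the slopes in
    [multi_affine_diff] are taken near [x0], where they are almost those at
    [x0]. *)
Lemma multi_affine_strict (x0 : 'rV[R]_n) (e : R) : continuous F -> 0 < e ->
  exists2 r, 0 < r & forall x y, ball x0 r x -> ball x0 r y ->
    `|F x - F y - (x - y) *m slope_mx F x0| <= e * `|x - y|.
Proof.
move=> cF e0.
have n0 : 0 < n.+1%:R :> R by [].
have : \forall z \near x0, forall i, `|slope F i z - slope F i x0| <= e / n.+1%:R.
  refine (@filter_forall _ _
    (fun i z => `|slope F i z - slope F i x0| <= e / n.+1%:R)
    _ (nbhs_filter x0) _) => i.
  have := @continuous_slope i cF x0.
  move=> /cvgrPdist_le/(_ _ (divr_gt0 e0 n0)).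
  by apply: filterS => z; rewrite distrC.
move=> /nbhs_ballP[r /= r0 hr]; exists r => // x y xr yr.
have [z [zxy ->]] := multi_affine_diff x y.
rewrite mulmx_sum_row -sumrB (le_trans (ler_norm_sum _ _ _))//.
apply: (@le_trans _ _ (\sum_(i < n) (e / n.+1%:R * `|x - y|))).
  apply: ler_sum => i _; rewrite rowK !mxE -scalerBr normrZ mulrC ler_pM//.
    apply: hr; rewrite -ocube_ball// in xr yr *.
    by move=> j; have [->|->] := zxy i j.
  by have := rV_norm_coord (x - y) i; rewrite !mxE.
rewrite sumr_const card_ord -[leLHS]mulr_natl mulrA ler_wpM2r//.
by rewrite mulrCA ler_piMr ?(ltW e0)// ler_pdivrMr// mul1r ler_nat.
Qed.

Lemma jacobian_multi_affine x : continuous F -> 'J F x = slope_mx F x.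
Proof.
move=> cF; rewrite /jacobian.
have -> : 'd F x = (mulmxr (slope_mx F x) : {linear _ -> _}) :> (_ -> _).
  apply: diff_unique; first exact: continuous_mulmxr.
  apply/eqaddoP => e e0; have [r r0 hr] := multi_affine_strict x cF e0.
  apply/nbhs_ballP; exists r => //= h h0.
  have xhr : ball x r (h + x).
    by move: h0; rewrite -!ball_normE /= sub0r opprD addrCA subrr addr0.
  have := hr _ _ xhr (ballxx x r0); rewrite addrK.
  by rewrite opprD addrA.
by apply/matrixP => i j; rewrite mxE /= -rowE mxE.
Qed.

End multi_affine_maps.

(** The form in which strict differentiability is used: after composition with
    the inverse of its derivative, [F] is a small perturbation of the
    identity. *)
Lemma multi_affine_linearization (R : realType) n (F : 'rV[R]_n -> 'rV[R]_n)
    (x : 'rV[R]_n) (e : R) :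
  multi_affine F -> continuous F -> slope_mx F x \in unitmx -> 0 < e ->
  exists2 r, 0 < r & forall y z, ball x r y -> ball x r z ->
    `|(F y - F z) *m invmx (slope_mx F x) - (y - z)| <= e * `|y - z|.
Proof.
set A := slope_mx F x => maF cF uA e0.
pose C := \sum_i `|row i (invmx A)| + 1.
have C0 : 0 < C by rewrite ltr_wpDl// sumr_ge0.
have [r r0 hr] := multi_affine_strict maF x cF (divr_gt0 e0 C0).
exists r => // y z xy xz.
rewrite -[X in _ - X](mulmxK uA) -mulmxBl (le_trans (mulmx_norm _ _))//.
rewrite (@le_trans _ _ (C * (e / C * `|y - z|)))//.
  rewrite ler_pM// ?sumr_ge0//; last exact: hr.
  by rewrite /C lerDl.
by rewrite mulrA mulrCA divff ?gt_eqF// mulr1.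
Qed.


(** * Images of small cubes under nearly linear maps *)

(** Makes matrices a complete normed module, the setting of the fixed point
    theorem. *)
HB.instance Definition _ (R : realType) m n := Complete.on 'M[R]_(m, n).

Section near_linear_image.
Context (R : realType) (n : nat) (F : 'rV[R]_n -> 'rV[R]_n) (A : 'M[R]_n)
  (c : 'rV[R]_n) (r e : R).
Hypotheses (uA : A \in unitmx) (r0 : 0 < r) (e0 : 0 <= e) (e1 : e < 1).
Hypothesis linF : forall x y, ccube c r x -> ccube c r y ->
  `|(F x - F y) *m invmx A - (x - y)| <= e * `|x - y|.

Let cc : ccube c r c.
Proof. by move=> i; rewrite subrr normr0 ltW. Qed.

Lemma image_ccube_sub : F @` ccube c r `<=`
  [set y | ccube 0 ((1 + e) * r) ((y - F c) *m invmx A)].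
Proof.
move=> _ [x xr <-] /=; have xc := (ccubeP c x (ltW r0)).1 xr.
apply/ccubeP; first by rewrite mulr_ge0 ?(ltW r0)// addr_ge0.
rewrite subr0 mulrDl mul1r [leRHS]addrC.
rewrite -[X in `|X|](subrK (x - c)) (le_trans (ler_normD _ _))// lerD//.
by rewrite (le_trans (linF xr cc))// ler_wpM2l.
Qed.

(** A solution of [F x = y] is a fixed point of
    [x |-> x - (F x - y) *m invmx A], an [e]-contraction on the
    cube; it maps the cube to itself because it moves the centre by at most
    [(1 - e) * r]. *)
Lemma ccube_sub_image :
  [set y | ccube 0 ((1 - e) * r) ((y - F c) *m invmx A)] `<=` F @` ccube c r.
Proof.
move=> y /= yr.
have {yr} := (ccubeP _ _ (_ : 0 <= (1 - e) * r)).1 yr.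
rewrite subr0 mulr_ge0 ?(ltW r0)// ?subr_ge0 ?(ltW e1)// => /(_ isT) yr.
pose G x := x - (F x - y) *m invmx A.
have GB x z : ccube c r x -> ccube c r z -> `|G x - G z| <= e * `|x - z|.
  move=> xr zr; rewrite (le_trans _ (linF xr zr))// -normrN.
  rewrite [X in X <= _](_ : _ = `|(F x - F z) *m invmx A - (x - z)|)//.
  congr (`|_|); rewrite /G !mulmxBl.
  move: (F x *m _) (F z *m _) (y *m _) => u v w.
  by apply/rowP => i; rewrite !mxE; ring.
have Gc : `|G c - c| <= (1 - e) * r.
  by rewrite /G addrAC subrr add0r -mulNmx opprB.
have GU x : ccube c r x -> ccube c r (G x).
  move=> xr; apply/ccubeP; first exact: ltW.
  rewrite -(subrKA (G c)) (le_trans (ler_normD _ _))//.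
  have -> : r = e * r + (1 - e) * r by ring.
  rewrite lerD// (le_trans (GB _ _ xr cc))// ler_wpM2l//.
  by apply/ccubeP => //; exact: ltW.
pose Gf := isFun.Build _ _ _ _ G GU.
pose f : {fun ccube c r >-> ccube c r} := HB.pack G Gf.
have fc : is_contraction f.
  exists (NngNum e0); split=> //= -[x z] [xr zr]; exact: GB.
have [||x xr xG] := @banach_fixed_point R _ (ccube c r) f fc.
- exact: closed_ccube.
- by exists c.
exists x => //; apply/eqP; rewrite -subr_eq0; apply/eqP.
have : (F x - y) *m invmx A = 0.
  by move: xG; rewrite /= /G => /(congr1 (fun v => x - v)); rewrite subrr subKr.
by move/(congr1 (mulmx^~ A)); rewrite mulmxKV// mul0mx.
Qed.

Let affine_preimage (s : R) : [set y | ccube 0 s ((y - F c) *m invmx A)] =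
  [set y | ccube 0 s (y *m invmx A + - (F c *m invmx A))].
Proof. by apply/seteqP; split=> y /=; rewrite mulmxBl. Qed.

Lemma measurable_affine_ccube (s : R) :
  measurable [set y | ccube 0 s ((y - F c) *m invmx A)].
Proof.
rewrite affine_preimage.
have := measurable_preimage (measurable_row_affine (invmx A)
  (- (F c *m invmx A))) (measurable_ccube 0 s).
by congr measurable; apply/seteqP; split.
Qed.

Lemma lebesgue_row_affine_ccube (s : R) : 0 < s ->
  lebesgue_row R n [set y | ccube 0 s ((y - F c) *m invmx A)] =
  (`|\det A| * (2 * s) ^+ n)%:E.
Proof.
move=> s0; rewrite affine_preimage.
have uV : invmx A \in unitmx by rewrite unitmx_inv.
rewrite (scales_volume_unit uV _ (measurable_ccube 0 s)) lebesgue_row_ccube//.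
by rewrite det_inv normrV ?invrK// -unitmxE.
Qed.

End near_linear_image.


(** * Masses of small cells *)

Lemma lebesgue_row_le (R : realType) n (A B : set 'rV[R]_n) :
  measurable A -> measurable B -> A `<=` B ->
  (lebesgue_row R n A <= lebesgue_row R n B)%E.
Proof. by move=> mA mB; apply: le_measure; rewrite inE. Qed.

Section integral_cover.
Context d (T : measurableType d) (R : realType)
  (mu : {measure set T -> \bar R}).
Local Open Scope ereal_scope.

Lemma ge0_integral_setU_le (A B : set T) (g : T -> \bar R) :
  measurable A -> measurable B -> measurable_fun (A `|` B) g ->
  (forall x, (A `|` B) x -> 0 <= g x) ->
  \int[mu]_(x in A `|` B) g x <= \int[mu]_(x in A) g x + \int[mu]_(x in B) g x.
Proof.
move=> mA mB mg g0.
have AB : A `|` B = A `|` (B `\` A).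
  apply/seteqP; split=> x; last by move=> [|[]]; [left|right].
  have [Ax|nAx] := pselect (A x); first by left.
  by move=> [//|Bx]; right.
have mBA : measurable (B `\` A) by exact: measurableD.
rewrite AB ge0_integral_setU//; last 3 first.
- by rewrite -AB.
- by rewrite -AB.
- by apply/disj_setPS => x [Ax []].
rewrite leeD2l//; apply: ge0_subset_integral => //.
- apply: measurable_funS mg; first exact: measurableU.
  by move=> x; right.
- by move=> x Bx; apply: g0; right.
Qed.

Lemma ge0_integral_cover (I : Type) (s : seq I) (B : I -> set T) (D : set T)
    (g : T -> \bar R) :
  measurable D -> (forall i, measurable (B i)) -> (forall i, B i `<=` D) ->
  measurable_fun D g -> (forall x, D x -> 0 <= g x) ->
  \int[mu]_(x in \big[setU/set0]_(i <- s) B i) g x <=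
  \sum_(i <- s) \int[mu]_(x in B i) g x.
Proof.
move=> mD mB BD mg g0; elim: s => [|i s IHs].
  by rewrite !big_nil integral_set0.
have sD : \big[setU/set0]_(i <- s) B i `<=` D.
  by elim/big_ind : _ => // *; rewrite subUset.
have ms : measurable (\big[setU/set0]_(i <- s) B i).
  by elim/big_ind : _ => // *; exact: measurableU.
rewrite !big_cons; apply: (@le_trans _ _ (\int[mu]_(x in B i) g x +
    \int[mu]_(x in \big[setU/set0]_(i <- s) B i) g x)); last by rewrite leeD2l.
apply: ge0_integral_setU_le => //.
  by apply: measurable_funS mg => //; rewrite subUset.
by move=> x [/BD|/sD]; exact: g0.
Qed.

End integral_cover.

Section charts.
Context (R : realType) (n : nat).
Implicit Types (F : 'rV[R]_n -> 'rV[R]_n) (f g : 'rV[R]_n -> R).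

Notation K := (ccube (0 : 'rV[R]_n) 1).
Notation Ko := (ocube (0 : 'rV[R]_n) 1).

(** The properties of element maps that the change of variables rests on. *)
Record regular_map F : Prop := RegularMap {
  reg_continuous : continuous F ;
  reg_multi_affine : multi_affine F ;
  reg_inj : forall x y, K x -> K y -> F x = F y -> x = y ;
  reg_unit : forall x, K x -> slope_mx F x \in unitmx }.

Definition volume_factor F (x : 'rV[R]_n) : R := `|\det (slope_mx F x)|.

Lemma volume_factor_gt0 F x : regular_map F -> K x -> 0 < volume_factor F x.
Proof.
by move=> rF Kx; rewrite normr_gt0 -unitfE -unitmxE; exact: (reg_unit rF).
Qed.

(** [g] is the weight on the image and [f] its pullback to the cube. The
    weight is positive so that masses of cells can be compared by ratios. *)
Record chart F f g : Prop := Chart {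
  chart_regular : regular_map F ;
  chart_fun_continuous : continuous f ;
  chart_gt0 : forall x, K x -> 0 < f x ;
  chart_funE : forall x, K x -> g (F x) = f x }.

Definition chart_mass F g (A : set 'rV[R]_n) : \bar R :=
  (\int[lebesgue_row R n]_(y in F @` A) (g y)%:E)%E.

Definition chart_density F f (x : 'rV[R]_n) : R :=
  f x * volume_factor F x.

Section one_chart.
Context F f g (ch : chart F f g).
Let cF := reg_continuous (chart_regular ch).
Let maF := reg_multi_affine (chart_regular ch).
Let cf : continuous f := chart_fun_continuous ch.

Lemma measurable_image_compact (B : set 'rV[R]_n) :
  compact B -> measurable (F @` B).
Proof.
move=> cB; apply: compact_measurable_row; apply: continuous_compact => //.
exact: continuous_subspaceT.
Qed.

(** Injectivity turns the image of a difference into a difference of images of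
    compact sets. Open cubes and superlevel sets of [f] both have this
    form. *)
Lemma measurable_image_diff (B : set 'rV[R]_n) :
  closed B -> measurable (F @` (K `\` B)).
Proof.
move=> cB.
rewrite (_ : F @` _ = F @` K `\` F @` (K `&` B)).
  apply: measurableD; apply: measurable_image_compact; first exact: compact_ccube.
  by apply: compact_closedI => //; exact: compact_ccube.
apply/seteqP; split=> [_ [x [Kx nBx] <-]|y [[x Kx <-] h]].
  split; first by exists x.
  by move=> [z [Kz Bz] /(reg_inj (chart_regular ch) Kz Kx) zx]; apply: nBx; rewrite -zx.
by exists x => //; split=> // Bx; apply: h; exists x.
Qed.

Lemma measurable_image_ocube c r : ocube c r `<=` K ->
  measurable (F @` ocube c r).
Proof.
move=> crK; rewrite (_ : ocube c r = K `\` (~` ocube c r)).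
  by apply: measurable_image_diff; apply: open_closedC; exact: open_ocube.
apply/seteqP; split=> x; first by move=> h; split; [exact: crK|exact].
by move=> [_ /contrapT].
Qed.

Lemma measurable_chart_fun : measurable_fun (F @` K) g.
Proof.
move=> mT; apply: (measurability _ (RGenOInfty.measurableE R)) => //.
move=> _ [_ [a ->] <-]; rewrite (_ : _ `&` _ =
    F @` (K `\` (f @^-1` [set x | x <= a]))).
  apply: measurable_image_diff.
  have /continuous_closedP/(_ _ (@closed_le R a)) := chart_fun_continuous ch.
  exact.
apply/seteqP; split=> [y [[x Kx <-]]|_ [x [Kx /= /negP h] <-]].
  rewrite /= in_itv/= andbT (chart_funE ch)// => h; exists x => //; split=> //=.
  by apply/negP; rewrite -ltNge.
rewrite -ltNge in h; split; first by exists x.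
by rewrite /= in_itv/= andbT (chart_funE ch).
Qed.

Let mK : measurable (F @` K).
Proof. by apply: measurable_image_compact; exact: compact_ccube. Qed.

Let g_ge0 y : (F @` K) y -> 0 <= g y.
Proof. by move=> [x Kx <-]; rewrite (chart_funE ch)// ltW// (chart_gt0 ch). Qed.

(** Near [x] the weight is [f x] up to a factor [1 - e] or [1 + e], and
    the image of a cube lies between linear images of slightly smaller and
    larger cubes. The lower bound concerns the open cube and the upper one the
    closed cube: the boundary costs nothing here, and its image is found to be
    a null set only afterwards. *)
Lemma chart_mass_density x (e : R) : K x -> 0 < e -> e < 1 ->
  exists2 r0, 0 < r0 & forall c r, 0 < r -> ccube c r `<=` K ->
    ccube c r `<=` ball x r0 ->
    (((1 - e) ^+ (2 * n).+1 * (chart_density F f x * (2 * r) ^+ n))%:E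
       <= chart_mass F g (ocube c r))%E /\
    (chart_mass F g (ccube c r) <=
      ((1 + e) ^+ (2 * n).+1 * (chart_density F f x * (2 * r) ^+ n))%:E)%E.
Proof.
move=> Kx e0 e1.
pose A := slope_mx F x.
have uA : A \in unitmx by exact: (reg_unit (chart_regular ch)).
have fx0 : 0 < f x by exact: (chart_gt0 ch).
have [r1 r10 linF] : exists2 r, 0 < r & forall y z, ball x r y -> ball x r z ->
    `|(F y - F z) *m invmx A - (y - z)| <= e * `|y - z|.
  exact: multi_affine_linearization.
have [r2 r20 fr2] : exists2 r, 0 < r & forall y, ball x r y ->
    (1 - e) * f x <= f y <= (1 + e) * f x.
  have /cvgrPdist_le/(_ _ (mulr_gt0 e0 fx0)) := @cf x.
  move=> /nbhs_ballP[r /= r0 hr]; exists r => // y /hr /=.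
  by rewrite distrC ler_distl => /andP[? ?]; apply/andP; split; lra.
exists (Num.min r1 r2) => [|c r r0 crK crx]; first by rewrite lt_min r10.
have sub1 : ccube c r `<=` ball x r1.
  by move=> y /crx; apply: le_ball; rewrite ge_min lexx.
have sub2 : ccube c r `<=` ball x r2.
  by move=> y /crx; apply: le_ball; rewrite ge_min lexx orbT.
have lin y z : ccube c r y -> ccube c r z ->
    `|(F y - F z) *m invmx A - (y - z)| <= e * `|y - z|.
  by move=> /sub1 ? /sub1 ?; exact: linF.
have ocK : ocube c r `<=` K by move=> y /sub_ocube /crK.
have mo := measurable_image_ocube ocK.
have mc := measurable_image_compact (@compact_ccube _ _ c r).
have oE : F @` ocube c r `<=` F @` K by exact: image_subset.
have cE : F @` ccube c r `<=` F @` K by exact: image_subset.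
have w0 : 0 < `|\det A| by rewrite normr_gt0 -unitfE -unitmxE.
have e1' : 0 < 1 - e by rewrite subr_gt0.
have ge1 : 1 <= 1 + e by lra.
split.
(* The cube shrinks twice by the factor [1 - e], once to fit a closed cube
   into the open one and once for the inner inclusion; with the weight this
   gives the exponent [2 * n + 1]. *)
- have rr : (1 - e) * r < r by rewrite gtr_pMl//; lra.
  have r'0 : 0 < (1 - e) * r by rewrite mulr_gt0.
  apply: (@le_trans _ _ (\int[lebesgue_row R n]_(y in F @` ocube c r)
    ((1 - e) * f x)%:E)%E); last first.
    apply: ge0_le_integral => //.
    + by move=> y _; rewrite lee_fin mulr_ge0 ?ltW.
    + by apply/measurable_EFinP; apply: measurable_funS measurable_chart_fun.
    + move=> _ [y yr <-]; rewrite lee_fin (chart_funE ch); last exact: ocK.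
      by have /andP[] := fr2 _ (sub2 _ (sub_ocube yr)).
  rewrite integral_cst//.
  have lin' y z : ccube c ((1 - e) * r) y -> ccube c ((1 - e) * r) z ->
      `|(F y - F z) *m invmx A - (y - z)| <= e * `|y - z|.
    move=> yr zr; apply: lin; apply: sub_ocube.
      exact: sub_ccube_ocube yr.
    exact: sub_ccube_ocube zr.
  have := ccube_sub_image uA r'0 (ltW e0) e1 lin'.
  move=> /(subset_trans)/(_ (@image_subset _ _ F _ _ (sub_ccube_ocube rr))).
  move=> /(lebesgue_row_le (measurable_affine_ccube _ _ _ _) mo).
  rewrite lebesgue_row_affine_ccube//; last by rewrite mulr_gt0.
  move=> h; apply: le_trans (lee_wpmul2l _ h).
    rewrite -EFinM lee_fin /chart_density /volume_factor -/A !exprMn mulnC exprS exprM.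
    rewrite -(exprMn _ (1 - e)) le_eqVlt; apply/orP; left; apply/eqP.
    rewrite expr2 exprMn; ring.
  by rewrite lee_fin mulr_ge0 ?ltW.
- apply: (@le_trans _ _ (\int[lebesgue_row R n]_(y in F @` ccube c r)
    ((1 + e) * f x)%:E)%E).
    apply: ge0_le_integral => //.
    + by move=> y yo; rewrite lee_fin; apply: g_ge0; exact: cE.
    + by apply/measurable_EFinP; apply: measurable_funS measurable_chart_fun.
    + move=> _ [y yr <-]; rewrite lee_fin (chart_funE ch); last exact: crK.
      by have /andP[] := fr2 _ (sub2 _ yr).
  rewrite integral_cst//.
  have := image_ccube_sub r0 (ltW e0) lin.
  move=> /(lebesgue_row_le mc (measurable_affine_ccube _ _ _ _)).
  rewrite lebesgue_row_affine_ccube//; last by rewrite mulr_gt0// addr_gt0.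
  move=> h; apply: le_trans (lee_wpmul2l _ h) _.
    by rewrite lee_fin mulr_ge0 ?ltW// ltr_wpDr// ltW.
  rewrite -EFinM lee_fin /chart_density /volume_factor -/A !exprMn exprS.
  rewrite mulnC muln2 -addnn exprD -[leLHS]mul1r.
  have -> :
    1 * ((1 + e) * f x * (`|\det A| * (2 ^+ n * ((1 + e) ^+ n * r ^+ n)))) =
    1 * ((1 + e) ^+ n * ((1 + e) * (f x * `|\det A| * (2 ^+ n * r ^+ n)))).
    by ring.
  have -> : (1 + e) * ((1 + e) ^+ n * (1 + e) ^+ n) *
      (f x * `|\det A| * (2 ^+ n * r ^+ n)) =
    (1 + e) ^+ n *
      ((1 + e) ^+ n * ((1 + e) * (f x * `|\det A| * (2 ^+ n * r ^+ n)))).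
    by ring.
  rewrite ler_wpM2r ?exprn_ege1//.
  have ge0 : 0 <= 1 + e by lra.
  by rewrite !mulr_ge0 ?exprn_ge0// ltW.
Qed.

End one_chart.

End charts.

(** * Comparison of two charts over a grid *)

(** As [e] tends to 0 the two powers have ratio tending to 1. Explicitly,
    multiply by [(1 - e) ^+ m]: since [(1 - e) * (1 + e) <= 1] it
    suffices that [q <= (1 - e) ^+ (2 * m)], which is Bernoulli's
    inequality for a suitable [e]. *)
Lemma exists_near1_ratio (R : realType) (q : R) m : 0 < q < 1 ->
  exists2 e : R, 0 < e < 1 & q * (1 + e) ^+ m <= (1 - e) ^+ m.
Proof.
move=> /andP[q0 q1].
have bern (x : R) k : 0 <= x -> x <= 1 -> 1 - k%:R * x <= (1 - x) ^+ k.
  move=> x0 x1; elim: k => [|k IHk]; first by rewrite mul0r subr0 expr0.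
  rewrite exprSr (@le_trans _ _ ((1 - k%:R * x) * (1 - x)))//.
    have : 0 <= k%:R * x * x by rewrite !mulr_ge0.
    by rewrite -natr1; move: (k%:R) => u; nra.
  by rewrite ler_wpM2r// subr_ge0.
have m0 : 0 < (m * 2).+1%:R + 1 :> R by rewrite ltr_wpDl.
pose e := (1 - q) / ((m * 2).+1%:R + 1).
have e0 : 0 < e by rewrite divr_gt0// subr_gt0.
have me : (m * 2)%:R * e <= 1 - q.
  rewrite /e mulrCA ler_piMr ?subr_ge0 ?(ltW q1)// ler_pdivrMr// mul1r -natr1.
  by rewrite -addrA lerDl addr_ge0.
have e1 : e < 1.
  rewrite ltr_pdivrMr// mul1r (@lt_le_trans _ _ 1)//; first lra.
  by rewrite lerDr.
exists e; first by rewrite e0.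
have qe : q <= (1 - e) ^+ (m * 2).
  apply: le_trans (bern e (m * 2)%N (ltW e0) (ltW e1)).
  by rewrite lerBrDl -lerBrDr.
rewrite (@le_trans _ _ ((1 - e) ^+ (m * 2) * (1 + e) ^+ m))//.
  by rewrite ler_wpM2r// exprn_ge0// addr_ge0// ltW.
rewrite mulnC exprM -exprMn lerXn2r// ?nnegrE ?subr_ge0 ?(ltW e1)//.
  by rewrite mulr_ge0//; [rewrite exprn_ge0// subr_ge0 ltW|rewrite addr_ge0// ltW].
have : 0 <= e * e * (1 - e) by rewrite !mulr_ge0// ?subr_ge0 ltW.
rewrite expr2; nra.
Qed.

Section grid.
Context (R : realType) (n N : nat).

(** The centres of the [N.+1 ^ n] congruent cells, of half-width [1/(N+1)],
    into which the cube splits. *)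
Definition cell_center (j : {ffun 'I_n -> 'I_N.+1}) : 'rV[R]_n :=
  \row_i ((2 * (j i)%:R + 1) / N.+1%:R - 1).

Let N0 : 0 < N.+1%:R :> R. Proof. by []. Qed.

Lemma cell_dist (j : {ffun 'I_n -> 'I_N.+1}) (x : 'rV[R]_n) (i : 'I_n) :
  `|x ord0 i - cell_center j ord0 i| =
  `|(x ord0 i + 1) * N.+1%:R - (2 * (j i)%:R + 1)| / N.+1%:R.
Proof.
rewrite mxE; move: (N.+1%:R : R) N0 => u u0.
rewrite (_ : _ - _ = ((x ord0 i + 1) * u - (2 * (j i)%:R + 1)) / u).
  by rewrite normf_div (gtr0_norm u0).
by field; rewrite gt_eqF.
Qed.

Lemma ccube_cell_sub j : ccube (cell_center j) N.+1%:R^-1 `<=` ccube 0 1.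
Proof.
move=> x h i; have := h i; rewrite cell_dist -[leRHS]mul1r ler_pM2r ?invr_gt0//.
rewrite mxE subr0 ler_distl ler_norml => /andP[h1 h2].
have jN : (j i)%:R <= N%:R :> R by rewrite ler_nat -ltnS.
have j0 : 0 <= (j i)%:R :> R by [].
rewrite -natr1 in h1 h2 *.
have N0' : 0 < N%:R + 1 :> R by rewrite natr1.
apply/andP; split.
  rewrite -subr_ge0 opprK -(pmulr_lge0 _ N0'); lra.
rewrite -subr_ge0 -(pmulr_lge0 _ N0').
rewrite mulrBl mul1r; nra.
Qed.

Lemma cell_cover : ccube (0 : 'rV[R]_n) 1 `<=`
  \bigcup_j ccube (cell_center j) N.+1%:R^-1.
Proof.
move=> x xK.
pose u i := (x ord0 i + 1) / 2 * N.+1%:R.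
have u0 i : 0 <= u i.
  have := xK i; rewrite mxE subr0 ler_norml => /andP[h1 h2].
  by rewrite /u mulr_ge0// divr_ge0//; lra.
have uN i : u i <= N.+1%:R.
  have := xK i; rewrite mxE subr0 ler_norml => /andP[h1 h2].
  by rewrite /u ler_piMl//; lra.
have k i : {k : 'I_N.+1 | k%:R <= u i <= k%:R + 1}.
  have /andP[t1 t2] := truncn_itv (u0 i).
  have [tN|tN] := ltnP (Num.truncn (u i)) N.+1.
    by exists (Ordinal tN); rewrite /= t1 natr1 ltW.
  exists ord_max; rewrite /= natr1 uN andbT (le_trans _ t1)// ler_nat.
  by rewrite (leq_trans _ tN).
exists [ffun i => sval (k i)] => // i.
rewrite cell_dist -[leRHS]mul1r ler_pM2r ?invr_gt0// ffunE.
case: (k i) => /= l /andP[]; rewrite /u ler_distl => h1 h2.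
by apply/andP; split; lra.
Qed.

Lemma cell_disjoint (j k : {ffun 'I_n -> 'I_N.+1}) (x : 'rV[R]_n) :
  ocube (cell_center j) N.+1%:R^-1 x ->
  ocube (cell_center k) N.+1%:R^-1 x -> j = k.
Proof.
move=> hj hk; apply/ffunP => i; apply/val_inj/eqP.
have bnd (l : {ffun 'I_n -> 'I_N.+1}) : ocube (cell_center l) N.+1%:R^-1 x ->
    2 * (l i)%:R < (x ord0 i + 1) * N.+1%:R < 2 * (l i)%:R + 2.
  move=> /(_ i); rewrite cell_dist -[ltRHS]mul1r ltr_pM2r ?invr_gt0// ltr_distl.
  by move=> /andP[? ?]; apply/andP; split; lra.
have /andP[h1 h2] := bnd _ hj; have /andP[h3 h4] := bnd _ hk.
have jk : (j i)%:R < (k i).+1%:R :> R by rewrite -natr1; lra.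
have kj : (k i)%:R < (j i).+1%:R :> R by rewrite -natr1; lra.
by move: jk kj; rewrite !ltr_nat !ltnS => jk kj; rewrite eqn_leq jk.
Qed.

End grid.

Section compare_charts.
Context (R : realType) (n : nat).
Implicit Types (F : 'rV[R]_n -> 'rV[R]_n) (f g : 'rV[R]_n -> R).

Notation K := (ccube (0 : 'rV[R]_n) 1).
Notation Ko := (ocube (0 : 'rV[R]_n) 1).

Lemma chart_mass_ge0 F f g A : chart F f g -> A `<=` K ->
  (0 <= chart_mass F g A)%E.
Proof.
move=> ch AK; apply: integral_ge0 => _ [x /AK Kx <-].
by rewrite lee_fin (chart_funE ch)// ltW// (chart_gt0 ch).
Qed.

Lemma ocube_sub_ocube1 c r : ccube c r `<=` K -> ocube c r `<=` Ko.
Proof.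
move=> crK x xr i; have := xr i.
pose s : R := if x ord0 i < 0 then - r else r.
have r0 : 0 < r by rewrite (le_lt_trans _ (xr i)).
have : ccube c r (upd c i (c ord0 i + s)).
  move=> j; have [->|ji] := eqVneq j i; last by rewrite upd_other// subrr normr0 ltW.
  by rewrite upd_same addrAC subrr add0r /s; case: ifP => _; rewrite ?normrN gtr0_norm.
move=> /crK/(_ i); rewrite upd_same !mxE !subr0 /s ltr_distl.
case: ltP => x0; rewrite ?(ltr0_norm x0) ?(ger0_norm x0) ler_norml.
  by move=> /andP[? ?] /andP[? ?]; lra.
by move=> /andP[? ?] /andP[? ?]; lra.
Qed.

(** On every small enough cell the masses differ from density times volume by
    a factor near 1, so for [q < 1] the first mass of the closed cell, times
    [q], is at most the second mass of the open cell. Compactness makes one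
    cell size work everywhere; summing over the grid, closed cells cover the
    cube and open cells are disjoint. *)
Lemma chart_mass_le F1 f1 g1 F2 f2 g2 : chart F1 f1 g1 -> chart F2 f2 g2 ->
  (forall x, K x -> chart_density F1 f1 x = chart_density F2 f2 x) ->
  (chart_mass F1 g1 K <= chart_mass F2 g2 Ko)%E.
Proof.
move=> ch1 ch2 dE.
have KoK : Ko `<=` K by exact: sub_ocube.
apply/lee_mul01Pr => [|q q01]; first exact: (chart_mass_ge0 ch1).
have q0 : 0 <= q by case/andP: q01 => /ltW.
have [e /andP[e0 e1] qe] := exists_near1_ratio (2 * n).+1 q01.
have loc x : K x -> exists2 s, 0 < s & forall c r, 0 < r -> ccube c r `<=` K ->
    ccube c r `<=` ball x s ->
    (q%:E * chart_mass F1 g1 (ccube c r) <= chart_mass F2 g2 (ocube c r))%E.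
  move=> Kx.
  have [s1 s10 h1] := chart_mass_density ch1 Kx e0 e1.
  have [s2 s20 h2] := chart_mass_density ch2 Kx e0 e1.
  exists (Num.min s1 s2) => [|c r r0 crK crx]; first by rewrite lt_min s10.
  have le1 : Num.min s1 s2 <= s1 by rewrite ge_min lexx.
  have le2 : Num.min s1 s2 <= s2 by rewrite ge_min lexx orbT.
  have [_ u1] := h1 c r r0 crK (subset_trans crx (le_ball le1)).
  have [u2 _] := h2 c r r0 crK (subset_trans crx (le_ball le2)).
  apply: le_trans u2; apply: le_trans (lee_wpmul2l _ u1) _; first by rewrite lee_fin.
  rewrite -EFinM lee_fin [leLHS]mulrA (dE _ Kx) ler_wpM2r// mulr_ge0//.
    by rewrite mulr_ge0 ?normr_ge0// ltW// (chart_gt0 ch2).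
  by rewrite exprn_ge0// mulr_ge0// ltW.
have [N hN] : exists N, forall c, K c -> ccube c N.+1%:R^-1 `<=` K ->
    (q%:E * chart_mass F1 g1 (ccube c N.+1%:R^-1) <=
       chart_mass F2 g2 (ocube c N.+1%:R^-1))%E.
  have cK : compact K by exact: compact_ccube.
  have := (compact_near_coveringP K).1 cK R 0^'+
    (fun r c => ccube c r `<=` K ->
      (q%:E * chart_mass F1 g1 (ccube c r) <= chart_mass F2 g2 (ocube c r))%E).
  have locn x : K x -> \forall c \near x & r \near 0^'+, ccube c r `<=` K ->
      (q%:E * chart_mass F1 g1 (ccube c r) <= chart_mass F2 g2 (ocube c r))%E.
    move=> /loc [s s0 hs].
    have s20 : 0 < s / 2 by rewrite divr_gt0.
    exists (ball x (s / 2), [set r | 0 < r < s / 2]) => /=.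
      split; first exact: nbhsx_ballx.
      near=> r; apply/andP; split; near: r; [exact: nbhs_right_gt|exact: nbhs_right_lt].
    move=> [c r] /= [xc /andP[r0 rs]] crK; apply: hs => // y /(ccubeP _ _ (ltW r0)).
    move=> ycr; rewrite [s]splitr; apply: ball_triangle xc _.
    by rewrite -ball_normE /= distrC (le_lt_trans ycr).
  move=> /(_ _ locn) [s /= s0 hs].
  have [N] := ltr_add_invr s0; rewrite add0r => Ns; exists N => c Kc.
  apply: (hs N.+1%:R^-1) => //=.
  by rewrite sub0r normrN gtr0_norm.
pose c := @cell_center R n N; pose r : R := N.+1%:R^-1.
have r0 : 0 < r by rewrite invr_gt0.
have cK j : ccube (c j) r `<=` K by exact: ccube_cell_sub.
have oK j : ocube (c j) r `<=` K by move=> x /sub_ocube /cK.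
have bE T (P : {ffun 'I_n -> 'I_N.+1} -> set T) :
    \big[setU/set0]_j P j = \bigcup_j P j.
  rewrite -bigcup_seq; apply/seteqP; split=> x [j _ Pj]; exists j => //=.
  by rewrite mem_index_enum.
apply: (@le_trans _ _ (q%:E * \sum_j chart_mass F1 g1 (ccube (c j) r))%E).
  apply: lee_wpmul2l; first by rewrite lee_fin.
  rewrite [leLHS](_ : _ = \int[lebesgue_row R n]_(y in
    \big[setU/set0]_j (F1 @` ccube (c j) r)) (g1 y)%:E)%E; last first.
    rewrite /chart_mass; congr integral; rewrite bE.
    apply/seteqP; split=> [_ [x Kx <-]|y [j _ [x /cK Kx <-]]]; last by exists x.
    by have [j _ xj] := @cell_cover R n N x Kx; exists j => //; exists x.
  apply: (@ge0_integral_cover _ _ _ _ _ _ _ (F1 @` K)).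
  - by apply: (measurable_image_compact ch1); exact: compact_ccube.
  - by move=> j; apply: (measurable_image_compact ch1); exact: compact_ccube.
  - by move=> j; exact: image_subset.
  - by apply/measurable_EFinP; exact: (measurable_chart_fun ch1).
  - by move=> _ [x Kx <-]; rewrite lee_fin (chart_funE ch1)// ltW// (chart_gt0 ch1).
rewrite ge0_sume_distrr; last by move=> j _; exact: (chart_mass_ge0 ch1).
apply: (@le_trans _ _ (\sum_j chart_mass F2 g2 (ocube (c j) r))%E).
  apply: lee_sum => j _; apply: hN; [apply: (cK j) => i|exact: cK].
  by rewrite subrr normr0 ltW.
rewrite -ge0_integral_bigsetU//=.
- rewrite bE; apply: ge0_subset_integral.
  + rewrite -bE; elim/big_ind : _ => // [*|j _]; first exact: measurableU.
    exact: (measurable_image_ocube ch2).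
  + exact: (measurable_image_ocube ch2).
  + apply/measurable_EFinP; apply: measurable_funS (measurable_chart_fun ch2).
      by apply: (measurable_image_compact ch2); exact: compact_ccube.
    exact: image_subset.
  + move=> _ [x /KoK Kx <-].
    by rewrite lee_fin (chart_funE ch2)// ltW// (chart_gt0 ch2).
  + move=> _ [j _ [x xj <-]]; exists x => //.
    exact: ocube_sub_ocube1 xj.
- by move=> j; exact: (measurable_image_ocube ch2).
- exact: index_enum_uniq.
- move=> j k _ _ [_ [[x xj <-] [y yk]]].
  move=> /(reg_inj (chart_regular ch2) (oK _ _ yk) (oK _ _ xj)) yx.
  by apply: cell_disjoint xj _; rewrite -yx.
- apply/measurable_EFinP; apply: measurable_funS (measurable_chart_fun ch2).
    by apply: (measurable_image_compact ch2); exact: compact_ccube.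
  by rewrite bE => _ [j _ [x /oK Kx <-]]; exists x.
- rewrite bE => _ [j _ [x /oK Kx <-]].
  by rewrite lee_fin (chart_funE ch2)// ltW// (chart_gt0 ch2).
Unshelve. all: by end_near. Qed.

End compare_charts.

(** * The change of variables formula *)

Section continuous_real.
Context (R : realType) (T : topologicalType).

Lemma continuous_sum_real (I : Type) (s : seq I) (f : I -> T -> R) :
  (forall i, continuous (f i)) -> continuous (fun x => \sum_(i <- s) f i x).
Proof.
move=> cf; elim: s => [|i s IHs].
  by under eq_fun do rewrite big_nil; exact: cst_continuous.
under eq_fun do rewrite big_cons.
by move=> x; apply: (@continuousD _ _ _ (f i) (fun x => \sum_(j <- s) f j x));
  [exact: cf|exact: IHs].
Qed.

Lemma continuous_prod_real (I : Type) (s : seq I) (f : I -> T -> R) :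
  (forall i, continuous (f i)) -> continuous (fun x => \prod_(i <- s) f i x).
Proof.
move=> cf; elim: s => [|i s IHs].
  by under eq_fun do rewrite big_nil; exact: cst_continuous.
under eq_fun do rewrite big_cons.
by move=> x; apply: (@continuousM _ _ (f i) (fun x => \prod_(j <- s) f j x));
  [exact: cf|exact: IHs].
Qed.

End continuous_real.

Section change_of_variables.
Context (R : realType) (n : nat).
Implicit Types (F : 'rV[R]_n -> 'rV[R]_n) (f g : 'rV[R]_n -> R).

Notation K := (ccube (0 : 'rV[R]_n) 1).
Notation Ko := (ocube (0 : 'rV[R]_n) 1).
Notation mu := (lebesgue_row R n).

Lemma continuous_det_slope F : continuous F ->
  continuous (fun x => \det (slope_mx F x)).
Proof.
move=> cF; apply: continuous_sum_real => s.
have c1 : continuous (fun x => \prod_i slope_mx F x i (s i)).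
  apply: continuous_prod_real => i x; under eq_fun do rewrite mxE.
  apply: (@continuous_comp _ _ _ (slope F i) (fun y : 'rV[R]_n => y ord0 (s i))).
    exact: continuous_slope.
  exact: coord_continuous.
have c2 : continuous (fun x : 'rV[R]_n => (-1) ^+ s : R) by exact: cst_continuous.
by move=> x; exact: (continuousM (@c2 x) (@c1 x)).
Qed.

Lemma continuous_volume_factor F : continuous F -> continuous (volume_factor F).
Proof.
move=> cF x; apply: (@continuous_comp _ _ _ (fun x => \det (slope_mx F x)) Num.norm).
  exact: continuous_det_slope.
exact: norm_continuous.
Qed.

Lemma slope_mx_id (x : 'rV[R]_n) : slope_mx idfun x = 1%:M.
Proof.
apply/matrixP => i j; rewrite !mxE eq_sym.
by case: eqP => _; rewrite ?subr0// subrr.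
Qed.

Lemma regular_id : regular_map (idfun : 'rV[R]_n -> 'rV[R]_n).
Proof.
split=> //.
- by move=> x; exact: cvg_id.
- move=> x i s; apply/rowP => j; rewrite !mxE.
  by case: eqP => _; rewrite ?subrr ?mulr0 ?addr0// subr0 mulr1 add0r.
- by move=> x _; rewrite slope_mx_id unitmx1.
Qed.

Lemma volume_factor_id (x : 'rV[R]_n) : volume_factor idfun x = 1.
Proof. by rewrite /volume_factor slope_mx_id det1 normr1. Qed.

(** The integral on the right is the mass of the identity chart with weight
    [f * volume_factor F], which has the same density as [chart F f g].
    Comparing the two charts both ways squeezes all masses, those of the open
    and of the closed cube, to one value. *)
Lemma chart_mass_pullback F f g : chart F f g ->
  chart_mass F g K = (\int[mu]_(x in K) (f x * volume_factor F x)%:E)%E /\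
  chart_mass F g Ko = (\int[mu]_(x in K) (f x * volume_factor F x)%:E)%E.
Proof.
move=> ch.
have ch' : chart idfun (fun x => f x * volume_factor F x)
    (fun x => f x * volume_factor F x).
  apply: (Chart regular_id) => [x|x Kx|//].
    apply: continuousM; first exact: (chart_fun_continuous ch).
    by apply: continuous_volume_factor; exact: (reg_continuous (chart_regular ch)).
  by rewrite mulr_gt0 ?(chart_gt0 ch)// volume_factor_gt0//; case: ch.
have dE x : chart_density F f x =
    chart_density idfun (fun x => f x * volume_factor F x) x.
  by rewrite /chart_density volume_factor_id mulr1.
have le1 := chart_mass_le ch ch' (fun x _ => dE x).
have le2 := chart_mass_le ch' ch (fun x _ => esym (dE x)).
have mK := measurable_image_compact ch (@compact_ccube _ n 0 1).
have mKo := measurable_image_ocube ch (@sub_ocube _ n 0 1).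
have le3 : (chart_mass F g Ko <= chart_mass F g K)%E.
  apply: ge0_subset_integral => //; last exact/image_subset/sub_ocube.
    by apply/measurable_EFinP; exact: (measurable_chart_fun ch).
  by move=> _ [x Kx <-]; rewrite lee_fin (chart_funE ch)// ltW// (chart_gt0 ch).
have le4 : (chart_mass idfun (fun x => f x * volume_factor F x)%R Ko <=
    chart_mass idfun (fun x => f x * volume_factor F x)%R K)%E.
  rewrite /chart_mass !image_id; apply: ge0_subset_integral => //.
  - exact: measurable_ocube.
  - exact: measurable_ccube.
  - apply/measurable_EFinP; have := measurable_chart_fun ch'.
    by rewrite image_id.
  - by move=> x Kx; rewrite lee_fin mulr_ge0 ?normr_ge0// ltW// (chart_gt0 ch).
  - exact: sub_ocube.
have <- : chart_mass idfun (fun x => f x * volume_factor F x) K =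
    (\int[mu]_(x in K) (f x * volume_factor F x)%:E)%E.
  by rewrite /chart_mass image_id.
split; apply/eqP; rewrite eq_le.
  by rewrite (le_trans le1 le4) (le_trans le2 le3).
by rewrite le2 andbT (le_trans le3)// (le_trans le1 le4).
Qed.

Lemma bounded_continuous_cube f : continuous f -> exists2 C, 0 < C &
  forall x, K x -> `|f x| <= C.
Proof.
move=> cf; have : compact (f @` K).
  apply: continuous_compact; first exact: continuous_subspaceT.
  exact: compact_ccube.
move=> /compact_bounded[M [_ hM]]; exists (`|M| + 1) => [|x Kx].
  by rewrite ltr_wpDl.
apply: hM; last by exists x.
by rewrite (le_lt_trans (ler_norm M))// ltrDl.
Qed.

Lemma integrable_bounded_fin d (T : measurableType d)
    (m : {measure set T -> \bar R}) (D : set T) (h : T -> R) (C : R) :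
  measurable D -> (m D < +oo)%E -> measurable_fun D h ->
  (forall x, D x -> `|h x| <= C) -> m.-integrable D (EFin \o h).
Proof.
move=> mD fD mh hC; apply: measurable_bounded_integrable => //.
exists C; split; first exact: num_real.
by move=> M CM x Dx /=; apply: (le_trans (hC _ Dx)); exact: ltW.
Qed.

Lemma lebesgue_cube_fin : (mu K < +oo)%E.
Proof. by rewrite lebesgue_row_ccube// ltry. Qed.

Lemma integrable_continuous_cube f : continuous f -> mu.-integrable K (EFin \o f).
Proof.
move=> cf; have [C C0 fC] := bounded_continuous_cube cf.
apply: (@integrable_bounded_fin _ _ _ _ _ C) => //.
- exact: measurable_ccube.
- exact: lebesgue_cube_fin.
- by apply: measurable_funS (continuous_measurable_row cf).
Qed.

Section regular.
Context F (rF : regular_map F).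
Let cF := reg_continuous rF.

Let chart1 : chart F (fun=> 1) (fun=> 1).
Proof. by apply: Chart => // x; exact: cst_continuous. Qed.

Lemma measurable_image_ccube1 : measurable (F @` K).
Proof. exact: (measurable_image_compact chart1 (@compact_ccube _ n 0 1)). Qed.

Lemma measurable_image_ocube1 : measurable (F @` Ko).
Proof. exact: (measurable_image_ocube chart1 (@sub_ocube _ n 0 1)). Qed.

Lemma lebesgue_image :
  mu (F @` K) = (\int[mu]_(x in K) volume_factor F x)%:E /\
  mu (F @` Ko) = (\int[mu]_(x in K) volume_factor F x)%:E.
Proof.
have cst1 (A : set 'rV[R]_n) : measurable A -> (\int[mu]_(y in A) 1%:E)%E = mu A.
  by move=> mA; rewrite integral_cst// mul1e.
have [] := chart_mass_pullback chart1; rewrite /chart_mass !cst1.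
- under eq_integral do rewrite mul1r.
  rewrite /Rintegral fineK => [-> ->//|].
  apply: integrable_fin_num; first exact: measurable_ccube.
  exact/integrable_continuous_cube/continuous_volume_factor.
- exact: measurable_image_ocube1.
- exact: measurable_image_ccube1.
Qed.

Lemma lebesgue_image_fin : (mu (F @` K) < +oo)%E.
Proof. by rewrite lebesgue_image.1 ltry. Qed.

(** With weight 1, [chart_mass_pullback] gives the images of the open and of
    the closed cube the same finite measure. *)
Lemma lebesgue_image_boundary : mu (F @` K `\` F @` Ko) = 0%E.
Proof.
have -> : mu (F @` K `\` F @` Ko) = (mu (F @` K) - mu (F @` K `&` F @` Ko))%E.
  apply: measureD; [exact: measurable_image_ccube1|exact: measurable_image_ocube1|].
  exact: lebesgue_image_fin.
rewrite setIidr; last exact/image_subset/sub_ocube.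
by rewrite lebesgue_image.1 lebesgue_image.2 subee.
Qed.

Lemma measurable_regular f g : continuous f -> (forall x, K x -> g (F x) = f x) ->
  measurable_fun (F @` K) g.
Proof.
move=> cf gF; have [C C0 fC] := bounded_continuous_cube cf.
have ch : chart F (fun x => f x + (C + 1)) (fun y => g y + (C + 1)).
  apply: Chart => // [x|x Kx|x Kx]; last by rewrite gF.
    exact: (continuousD (@cf x) (@cst_continuous _ _ (C + 1) x)).
  by have := fC x Kx; rewrite ler_norml => /andP[? _]; lra.
have := measurable_funD (measurable_chart_fun ch)
  (measurable_cst (- (C + 1)) : measurable_fun (F @` K) _).
by apply: eq_measurable_fun => y _ /=; rewrite addrK.
Qed.

Lemma integrable_regular f g : continuous f -> (forall x, K x -> g (F x) = f x) ->
  mu.-integrable (F @` K) (EFin \o g).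
Proof.
move=> cf gF; have [C C0 fC] := bounded_continuous_cube cf.
apply: (@integrable_bounded_fin _ _ _ _ _ C).
- exact: measurable_image_ccube1.
- exact: lebesgue_image_fin.
- exact: measurable_regular gF.
- by move=> _ [x Kx <-]; rewrite gF// fC.
Qed.

(** Adding a large constant makes the weight positive, so that
    [chart_mass_pullback] applies; subtract the formula for the constant. *)
Theorem change_of_variables f g : continuous f ->
  (forall x, K x -> g (F x) = f x) ->
  \int[mu]_(y in F @` K) g y = \int[mu]_(x in K) (f x * volume_factor F x).
Proof.
move=> cf gF; have [C C0 fC] := bounded_continuous_cube cf.
have ch : chart F (fun x => f x + (C + 1)) (fun y => g y + (C + 1)).
  apply: Chart => // [x|x Kx|x Kx]; last by rewrite gF.
    exact: (continuousD (@cf x) (@cst_continuous _ _ (C + 1) x)).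
  by have := fC x Kx; rewrite ler_norml => /andP[? _]; lra.
have := congr1 fine (chart_mass_pullback ch).1.
rewrite -[LHS]/(\int[mu]_(y in F @` K) (g y + (C + 1))) -[RHS]/(\int[mu]_(x in K) _).
have mK : measurable K by exact: measurable_ccube.
have mFK := measurable_image_ccube1.
have iw := integrable_continuous_cube (continuous_volume_factor cF).
have ifw : mu.-integrable K (EFin \o (fun x => f x * volume_factor F x)).
  apply: integrable_continuous_cube => x.
  by apply: continuousM; [exact: cf|exact: continuous_volume_factor].
rewrite RintegralD//; last 2 first.
- exact: integrable_regular gF.
- by apply: (@integrable_regular (fun=> C + 1)) => // x; exact: cst_continuous.
under [RHS]eq_Rintegral do rewrite mulrDl.
have icw : mu.-integrable K (EFin \o (fun x => (C + 1) * volume_factor F x)).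
  apply: integrable_continuous_cube => x.
  exact: (continuousM (@cst_continuous _ _ (C + 1) x)
    (@continuous_volume_factor _ cF x)).
have cstE : \int[mu]_(y in F @` K) (C + 1) =
    (C + 1) * \int[mu]_(x in K) volume_factor F x.
  rewrite Rintegral_cst//; congr (_ * _).
  by rewrite -[RHS]/(fine (_)%:E); congr fine; exact: lebesgue_image.1.
rewrite cstE [X in _ = X -> _]RintegralD// RintegralZl//.
exact: addIr.
Qed.

End regular.

End change_of_variables.

(** * Open images and Lipschitz domains *)

Section open_images.
Context (R : realType) (n : nat) (F : 'rV[R]_n -> 'rV[R]_n).
Hypothesis rF : regular_map F.

Notation K := (ccube (0 : 'rV[R]_n) 1).
Notation Ko := (ocube (0 : 'rV[R]_n) 1).

(** By [ccube_sub_image] the image of a small cube around [x] contains a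
    linear image of an open cube. *)
Lemma open_image_ocube : open (F @` Ko).
Proof.
rewrite openE => _ [x xo <-].
have uA := reg_unit rF (sub_ocube xo).
set A := slope_mx F x in uA.
have half0 : 0 < 2^-1 :> R by rewrite invr_gt0.
have [r1 r10 hr1] := multi_affine_linearization (reg_multi_affine rF)
  (reg_continuous rF) uA half0.
have [r2 /= r20 hr2] : exists2 r, 0 < r & ball x r `<=` Ko.
  by apply/nbhs_ballP/open_nbhs_nbhs; split=> //; exact: open_ocube.
pose r := Num.min r1 r2 / 2.
have m0 : 0 < Num.min r1 r2 by rewrite lt_min r10.
have r0 : 0 < r by rewrite divr_gt0.
have rm : r < Num.min r1 r2 by rewrite /r; lra.
have sub : ccube x r `<=` ball x (Num.min r1 r2).
  by rewrite -ocube_ball//; exact: sub_ccube_ocube.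
have lin y z : ccube x r y -> ccube x r z ->
    `|(F y - F z) *m invmx A - (y - z)| <= 2^-1 * `|y - z|.
  move=> /sub yr /sub zr.
  have le1 : Num.min r1 r2 <= r1 by rewrite ge_min lexx.
  exact: (hr1 y z (le_ball le1 yr) (le_ball le1 zr)).
have half1 : 2^-1 < 1 :> R by lra.
have sub_im := ccube_sub_image uA r0 (ltW half0) half1 lin.
have rr0 : 0 < (1 - 2^-1) * r by rewrite mulr_gt0//; lra.
apply: (@filterS _ (nbhs (F x)) _
    [set y | ocube 0 ((1 - 2^-1) * r) ((y - F x) *m invmx A)]).
  move=> y /sub_ocube/sub_im [z zr <-]; exists z => //.
  apply/hr2; apply: le_ball (sub _ zr); first by rewrite ge_min lexx orbT.
apply: open_nbhs_nbhs; split; last first.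
  by move=> i /=; rewrite subrr mul0mx mxE subrr normr0.
have co : continuous (fun y => (y - F x) *m invmx A).
  apply: (@dist_continuous _ _ _ _ (\sum_i `|row i (invmx A)|)) => y z.
  by rewrite -mulmxBl opprB addrA subrK mulmx_norm.
by move/continuousP: co; apply; exact: open_ocube.
Qed.

(** Shrinking towards 0 moves [x] into the open cube and [F x] as little as
    desired. So an open set meets the image of the closed cube only if it
    meets that of the open cube. *)
Lemma image_ccube_meets (U : set 'rV[R]_n) (x : 'rV[R]_n) : open U -> K x -> U (F x) ->
  exists2 z, Ko z & U (F z).
Proof.
move=> oU Kx Ux.
have : nbhs x (F @^-1` U).
  apply: open_nbhs_nbhs; split=> //.
  by have /continuousP := reg_continuous rF; exact.
move=> /nbhs_ballP[e /= e0 he].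
pose s := Num.min (1 / 2) (e / 2).
have s0 : 0 < s by rewrite lt_min !divr_gt0.
have s1 : s <= 1 / 2 by rewrite ge_min lexx.
have s2 : s <= e / 2 by rewrite ge_min lexx orbT.
have Kxi i : `|x ord0 i| <= 1 by have := Kx i; rewrite mxE subr0.
exists ((1 - s) *: x).
  move=> i; rewrite !mxE subr0 normrM gtr0_norm; last lra.
  by have := Kxi i; have := normr_ge0 (x ord0 i); nra.
apply: he; rewrite -ocube_ball// => i; rewrite !mxE.
rewrite (_ : _ - _ = - (s * x ord0 i)); last by ring.
rewrite normrN normrM gtr0_norm//.
by have := Kxi i; have := normr_ge0 (x ord0 i); nra.
Qed.

End open_images.

(** A Lipschitz domain has no slits: a boundary point can be moved upwards, in
    the coordinates of the local hypograph, out of the closure of the domain,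
    so it is not interior to that closure. *)
Lemma interior_closure_lipschitz (R : realType) d (Omega : set 'rV[R]_d) :
  lipschitz_domain Omega -> interior (closure Omega) `<=` Omega.
Proof.
move=> [_ oO _ _ lipO] x ix; apply: contrapT => nOx.
have [|U [k [g [UU lipg nearg]]]] := lipO x.
  by split=> //; exact: interior_subset ix.
have [L gL] : exists L, forall y z, `|g y - g z| <= L * `|y - z|.
  have [L [_ hL]] := lipg; exists (L + 1) => y z.
  by apply: (hL (L + 1) _ (y, z)); [rewrite ltrDl|split].
have : \forall y \near x, closure Omega y /\
    (Omega y <-> (y *m U) ord0 k < g (col' k (y *m U))).
  by apply: filterI => //.
move=> /nbhs_ballP[e /= e0 he].
have gx : g (col' k (x *m U)) <= (x *m U) ord0 k.
  rewrite leNgt; apply/negP => /(he x (ballxx x e0)).2.2.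
  exact: nOx.
(* [v] is the upward direction in the original coordinates, and the step [t]
   is short enough to stay in the ball where the hypograph describes the
   domain. *)
pose v : 'rV[R]_d := delta_mx ord0 k *m U^T.
pose t := e / 2 / (`|v| + 1).
have v1 : 0 < `|v| + 1 by rewrite ltr_wpDl.
have t0 : 0 < t by rewrite !divr_gt0.
pose y0 := x + t *: v.
have y0x : ball x e y0.
  rewrite -ball_normE /= /y0 opprD addNKr normrN normrZ gtr0_norm//.
  have tv : t * (`|v| + 1) = e / 2 by rewrite /t divfK ?gt_eqF.
  by have := normr_ge0 v; nra.
have vU : v *m U = delta_mx ord0 k.
  by rewrite -mulmxA (_ : U^T *m U = 1%:M) ?mulmx1//; exact: mulmx1C UU.
pose h y := (y *m U) ord0 k - g (col' k (y *m U)).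
have ch : continuous h.
  have cU : continuous (fun y : 'rV[R]_d => y *m U) by exact: continuous_mulmxr.
  have cc : continuous (fun z : 'rV[R]_d => col' k z).
    apply: (@dist_continuous _ _ _ _ 1) => z w; rewrite mul1r.
    apply/rV_normrP => // j; rewrite !mxE.
    by have := rV_norm_coord (z - w) (lift k j); rewrite !mxE.
  have cg : continuous g by exact: dist_continuous gL.
  have ck : continuous (fun z : 'rV[R]_d => z ord0 k) by exact: coord_continuous.
  have c1 : continuous (fun y : 'rV[R]_d => (y *m U) ord0 k).
    by move=> y; exact: (continuous_comp (@cU y) (@ck _)).
  have c2 : continuous (fun y : 'rV[R]_d => g (col' k (y *m U))).
    by move=> y; exact: (continuous_comp (continuous_comp (@cU y) (@cc _)) (@cg _)).
  by move=> y; exact: (continuousB (@c1 y) (@c2 y)).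
have h0 : 0 < h y0.
  rewrite /h /y0 mulmxDl -scalemxAl vU; move: (x *m U) gx => w gx.
  rewrite (_ : col' k _ = col' k w).
    by rewrite !mxE !eqxx mulr1 subr_gt0 (le_lt_trans gx)// ltrDl.
  apply/rowP => j; rewrite !mxE [lift k j == k]eq_sym.
  by rewrite (negPf (neq_lift k j)) andbF mulr0 addr0.
have [y0cl _] := he _ y0x.
have [|z [Oz [xz hz]]] := y0cl (ball x e `&` [set y | 0 < h y]).
  apply: open_nbhs_nbhs; split=> //; apply: openI; first exact: ball_open.
  by have /continuousP/(_ _ (@open_gt R 0)) := ch.
by have /(he z xz).2.1 := Oz; rewrite ltNge => /negP; apply; rewrite -subr_ge0 ltW.
Qed.


(** * Gauss-Legendre quadrature *)

Section poly_integral.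
Context (R : realType).
Implicit Types p q : {poly R}.

Definition polyint q : R := \int[lebesgue_measure]_(s in `[-1, 1]) q.[s].

Lemma integrable_poly q :
  lebesgue_measure.-integrable `[-1, 1] (EFin \o horner q).
Proof.
apply: continuous_compact_integrable; first exact: segment_compact.
by apply: continuous_subspaceT; exact: continuous_horner.
Qed.

Lemma polyintD p q : polyint (p + q) = polyint p + polyint q.
Proof.
rewrite /polyint -RintegralD//; try exact: integrable_poly.
by apply: eq_Rintegral => s _; rewrite hornerD.
Qed.

Lemma polyintZ a q : polyint (a *: q) = a * polyint q.
Proof.
rewrite /polyint -RintegralZl//; try exact: integrable_poly.
by apply: eq_Rintegral => s _; rewrite hornerZ.
Qed.

Lemma polyint0 : polyint 0 = 0.
Proof. by rewrite -[0 in LHS](scale0r 0) polyintZ mul0r. Qed.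

Lemma polyintB p q : polyint (p - q) = polyint p - polyint q.
Proof. by rewrite -scaleN1r polyintD polyintZ mulN1r. Qed.

Lemma polyint_sum I (s : seq I) (f : I -> {poly R}) :
  polyint (\sum_(i <- s) f i) = \sum_(i <- s) polyint (f i).
Proof.
elim: s => [|i s IHs]; first by rewrite !big_nil polyint0.
by rewrite !big_cons polyintD IHs.
Qed.

Lemma polyint_deriv q : polyint q^`() = q.[1] - q.[-1].
Proof.
rewrite /polyint /Rintegral (@continuous_FTC2 _ _ (horner q))//.
- by apply: continuous_subspaceT; exact: continuous_horner.
- split.
  + by move=> s _; exact: derivable_horner.
  + by apply: cvg_at_right_filter; exact: continuous_horner.
  + by apply: cvg_at_left_filter; exact: continuous_horner.
- by move=> s _; rewrite derivE.
Qed.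

Lemma polyint_gt0 q a : -1 < a < 1 -> 0 < q.[a] ->
  (forall s, 0 <= q.[s]) -> 0 < polyint q.
Proof.
move=> /andP[a1 a2] qa0 q0.
have [e e0 he] : exists2 e, 0 < e & forall s, `|a - s| < e -> q.[a] / 2 <= q.[s].
  have /cvgrPdist_le/(_ _ (divr_gt0 qa0 (ltr0n R 2))) := @continuous_horner _ q a.
  move=> /nbhs_ballP[e /= e0 he]; exists e => // s /he /=.
  by rewrite ler_distlC => /andP[]; lra.
pose d := Num.min e (1 - a) / 2.
have m0 : 0 < Num.min e (1 - a) by rewrite lt_min e0 subr_gt0.
have d0 : 0 < d by rewrite divr_gt0.
have de : d < e.
  by rewrite (@lt_le_trans _ _ (Num.min e (1 - a)))// /d; [lra|rewrite ge_min lexx].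
have d1 : d < 1 - a.
  rewrite (@lt_le_trans _ _ (Num.min e (1 - a)))// /d; first lra.
  by rewrite ge_min lexx orbT.
have fin : (\int[lebesgue_measure]_(s in `[(-1)%R, 1%R]) (q.[s])%:E)%E \is a fin_num.
  by apply: integrable_fin_num => //; exact: integrable_poly.
rewrite -lte_fin /polyint /Rintegral fineK//.
apply: (@lt_le_trans _ _
  (\int[lebesgue_measure]_(s in `[a, (a + d)%R]) (q.[a] / 2)%:E)%E).
  rewrite integral_cst//= lebesgue_measure_itv/= lte_fin ltrDl d0 -EFinB -EFinM lte_fin.
  by rewrite addrAC subrr add0r mulr_gt0// divr_gt0.
apply: (@le_trans _ _
  (\int[lebesgue_measure]_(s in `[a, (a + d)%R]) (q.[s])%:E)%E).
  apply: ge0_le_integral => //.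
  - by move=> s _; rewrite lee_fin divr_ge0// ltW.
  - by apply/measurable_EFinP; exact: measurable_poly.
  - move=> s; rewrite /= in_itv/= => /andP[s1 s2]; rewrite lee_fin he//.
    by rewrite ltr_distlC; apply/andP; split; lra.
apply: ge0_subset_integral => //.
- by apply/measurable_EFinP; exact: measurable_poly.
- by move=> s _; rewrite lee_fin.
- by move=> s; rewrite /= !in_itv/= => /andP[? ?]; apply/andP; split; lra.
Qed.

End poly_integral.

Lemma poly_eq0_of_roots (R : idomainType) p (t : 'I_p -> R) (q : {poly R}) :
  injective t -> (size q <= p)%N -> (forall k, root q (t k)) -> q = 0.
Proof.
move=> tinj sq qt; apply/eqP; apply: contraT => q0.
have qall : all (root q) (codom t) by apply/allP => _ /codomP[k ->].
have tuniq : uniq (codom t) by rewrite map_inj_uniq ?enum_uniq.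
by have := max_poly_roots q0 qall tuniq; rewrite size_codom card_ord ltnNge sq.
Qed.

(** Integrate by parts [p] times: the boundary terms vanish and the last
    derivative of [q] is 0. *)
Lemma polyint_derivn_orth (R : realType) (w : {poly R}) p (q : {poly R}) :
  (forall k, (k < p)%N -> w^`(k).[1] = 0 /\ w^`(k).[-1] = 0) ->
  (size q <= p)%N -> polyint (w^`(p) * q) = 0.
Proof.
move=> hw.
suff orth j (r : {poly R}) : (j <= p)%N -> (size r <= j)%N ->
    polyint (w^`(j) * r) = 0 by exact: orth.
elim: j r => [|j IHj] r jp sr.
  by move: sr; rewrite leqn0 size_poly_eq0 => /eqP ->; rewrite mulr0 polyint0.
have -> : w^`(j.+1) * r = (w^`(j) * r)^`() - w^`(j) * r^`().
  by rewrite derivM addrK derivnS.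
have [w1 w2] := hw _ jp.
rewrite polyintB polyint_deriv !hornerM w1 w2 !mul0r subrr sub0r.
rewrite IHj ?oppr0 ?(ltnW jp)//.
have [->|r0] := eqVneq r 0; first by rewrite deriv0 size_poly0.
by rewrite -ltnS (leq_trans (lt_size_deriv r0)).
Qed.

Section gauss_legendre.
Context (R : realType) (p : nat) (t : 'I_p -> R) (ht : gauss_nodes t).

Let tinj : injective t. Proof. by case: ht. Qed.

Let w : {poly R} := ('X^2 - 1) ^+ p.

(* Each derivative of [('X^2 - 1) ^+ p] lowers the multiplicity of the
   roots 1 and -1 by at most one. *)
Let w_deriv_ends k : (k < p)%N -> w^`(k).[1] = 0 /\ w^`(k).[-1] = 0.
Proof.
move=> kp.
suff [v ->] : exists v, w^`(k) = ('X^2 - 1) ^+ (p - k) * v.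
  rewrite -(subnSK kp) exprS !hornerM !hornerE.
  by split; ring.
elim: k kp => [|k IHk] kp; first by exists 1; rewrite subn0 mulr1.
have [v wk] := IHk (ltnW kp).
rewrite derivnS wk -(subnSK (ltnW kp)); set m := (p - k.+1)%N.
move: ('X^2 - 1 : {poly R}) => u; exists (u^`() * m.+1%:R * v + u * v^`()).
by rewrite derivM deriv_exp /= -mulr_natr exprS; ring.
Qed.

Let legendre_orth (q : {poly R}) : (size q <= p)%N -> polyint (legendre R p * q) = 0.
Proof.
move=> sq; rewrite /legendre -scalerAl polyintZ -/w.
by rewrite (polyint_derivn_orth w_deriv_ends sq) mulr0.
Qed.

Let N : {poly R} := \prod_(k < p) ('X - (t k)%:P).

Let N_monic : N \is monic. Proof. exact: monic_prod_XsubC. Qed.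

Let size_N : size N = p.+1.
Proof. by rewrite size_prod_XsubC -[index_enum _]enumT size_enum_ord. Qed.

Let root_N k : root N (t k).
Proof. by rewrite /root horner_prod (bigD1 k)//= hornerXsubC subrr mul0r. Qed.

(* The [p] nodes are roots of the Legendre polynomial, which has degree [p],
   so they are all of them and it is a multiple of the nodal polynomial
   [N]. *)
Let legendreE : exists2 c, c != 0 & legendre R p = c *: N.
Proof.
have w_monic : w \is monic by rewrite monic_exp// monicXnsubC.
have size_w : size w = (2 * p).+1.
  have -> : w = ('X^2 - 1%:P) ^+ p by [].
  rewrite -[LHS]prednK ?size_exp; last first.
    by rewrite size_poly_gt0; exact: monic_neq0 w_monic.
  by rewrite size_XnsubC//=.
pose c := (legendre R p)`_p.
exists c.
  rewrite /c /legendre coefZ coef_derivn -/w addnn -mul2n.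
  rewrite (_ : w`_(2 * p) = 1); last first.
    by have /monicP := w_monic; rewrite lead_coefE size_w.
  apply: mulf_neq0.
    by rewrite invr_eq0 mulf_neq0// ?expf_neq0// pnatr_eq0 -lt0n fact_gt0.
  by rewrite pnatr_eq0 -lt0n ffact_gt0 mul2n -addnn leq_addr.
apply/eqP; rewrite -subr_eq0; apply/eqP.
apply: (poly_eq0_of_roots tinj) => [|k]; last first.
  have [_ _ /(_ k)/rootP lk] := ht.
  by apply/rootP; rewrite hornerD lk hornerN hornerZ (rootP (root_N k)) mulr0 subrr.
apply/leq_sizeP => j; rewrite leq_eqVlt => /predU1P[<-|pj].
  rewrite coefB [X in _ - X]coefZ -/c (_ : N`_p = 1) ?mulr1 ?subrr//.
  by have /monicP := N_monic; rewrite lead_coefE size_N.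
rewrite coefB [(c *: N)`_j]nth_default; last first.
  by rewrite (leq_trans (size_scale_leq _ _))// size_N.
rewrite coefZ coef_derivn -/w nth_default ?mul0rn ?mulr0 ?subrr//.
by rewrite size_w mul2n -addnn ltn_add2l.
Qed.

Let N_orth (q : {poly R}) : (size q <= p)%N -> polyint (N * q) = 0.
Proof.
move=> /legendre_orth; have [c c0 ->] := legendreE.
by rewrite -scalerAl polyintZ => /eqP; rewrite mulf_eq0 (negPf c0) => /eqP.
Qed.

Let ell (k : 'I_p) : {poly R} :=
  \prod_(j < p | j != k) ((t k - t j)^-1 *: ('X - (t j)%:P)).

Let ellE k s : (ell k).[s] = \prod_(j < p | j != k) ((s - t j) / (t k - t j)).
Proof.
rewrite /ell horner_prod; apply: eq_bigr => j _.
by rewrite hornerZ hornerXsubC mulrC.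
Qed.

Let gauss_weightE k : gauss_weight t k = polyint (ell k).
Proof. by apply: eq_Rintegral => s _; rewrite ellE. Qed.

Let ell_node k l : (ell k).[t l] = (k == l)%:R.
Proof.
rewrite ellE; have [->|kl] := eqVneq k l.
  rewrite big1// => j jl; rewrite divff// subr_eq0.
  by apply: contra jl => /eqP/tinj ->.
by rewrite (bigD1 l)/= ?(eq_sym l)// subrr !mul0r.
Qed.

Let size_ell k : (size (ell k) <= p)%N.
Proof.
have p0 : (0 < p)%N by exact: leq_ltn_trans (ltn_ord k).
have -> : ell k = (\prod_(j < p | j != k) (t k - t j)^-1) *:
    \prod_(j < p | j != k) ('X - (t j)%:P).
  by rewrite /ell scaler_prod.
rewrite (leq_trans (size_scale_leq _ _))//.
rewrite -big_filter size_prod_XsubC size_filter.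
rewrite -sum1_count (eq_bigl (mem (predC1 k)))//.
by rewrite sum1_card cardC1 card_ord prednK.
Qed.

Let interp (r : {poly R}) : (size r <= p)%N -> r = \sum_k r.[t k] *: ell k.
Proof.
move=> sr; apply/eqP; rewrite -subr_eq0; apply/eqP.
apply: (poly_eq0_of_roots tinj) => [|k].
  rewrite (leq_trans (size_polyD _ _))// geq_max sr size_polyN/=.
  apply: (leq_trans (size_sum _ _ _)); apply/bigmax_leqP => k _.
  by rewrite (leq_trans (size_scale_leq _ _)).
rewrite /root hornerD hornerN horner_sum (bigD1 k)//= big1 => [|j jk].
  by rewrite hornerZ ell_node eqxx mulr1 addr0 subrr.
by rewrite hornerZ ell_node (negPf jk) mulr0.
Qed.

(** Divide [f] by the nodal polynomial [N]: the quotient has degree less than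
    [p], so it does not contribute to the integral, by orthogonality, nor to
    the sum, as [N] vanishes at the nodes. The remainder is interpolated
    exactly. *)
Lemma gauss_exact (f : {poly R}) : (size f <= 2 * p)%N ->
  polyint f = \sum_k gauss_weight t k * f.[t k].
Proof.
move=> sf; rewrite {1}(divp_eq f N) mulrC polyintD N_orth ?add0r; last first.
  by rewrite size_divp -?size_poly_eq0 size_N//= leq_subLR addnn -mul2n.
have sr : (size (f %% N)%R <= p)%N.
  by rewrite -ltnS -size_N ltn_modp -size_poly_eq0 size_N.
rewrite (interp sr) polyint_sum; apply: eq_bigr => k _.
rewrite polyintZ -gauss_weightE mulrC; congr (_ * _).
rewrite {2}(divp_eq f N) hornerD hornerM.
by rewrite (rootP (root_N k)) mulr0 add0r.
Qed.

(** The squared Lagrange polynomial has degree [2 * p - 2], so by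
    exactness its integral is the weight. *)
Lemma gauss_weight_gt0 k : 0 < gauss_weight t k.
Proof.
have p0 : (0 < p)%N by exact: leq_ltn_trans (ltn_ord k).
have -> : gauss_weight t k = polyint (ell k ^+ 2).
  rewrite gauss_exact.
    rewrite (bigD1 k)//= big1 => [|j jk].
      by rewrite horner_exp ell_node eqxx expr1n mulr1 addr0.
    by rewrite horner_exp ell_node eq_sym (negPf jk) expr0n mulr0.
  rewrite (leq_trans (size_polyMleq _ _))// mul2n -addnn.
  by rewrite (leq_trans (leq_pred _))// leq_add.
have [_ /(_ k) tk _] := ht.
apply: (@polyint_gt0 _ _ (t k)) => // [|s]; rewrite horner_exp ?sqr_ge0//.
by rewrite ell_node eqxx expr1n.
Qed.

End gauss_legendre.

(** * Tensor product quadrature *)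

Section integral_sum_real.
Context d (T : measurableType d) (R : realType) (mu : {measure set T -> \bar R})
  (D : set T) (mD : measurable D).

Lemma integrable_sum_real (I : Type) (s : seq I) (f : I -> T -> R) :
  (forall i, mu.-integrable D (EFin \o f i)) ->
  mu.-integrable D (EFin \o (fun x => \sum_(i <- s) f i x)).
Proof.
move=> intf; elim: s => [|i s IHs].
  by under [X in EFin \o X]eq_fun do rewrite big_nil; exact: integrable0.
under [X in EFin \o X]eq_fun do rewrite big_cons.
exact: (integrableD mD (intf i) IHs).
Qed.

Lemma Rintegral_sum (I : Type) (s : seq I) (f : I -> T -> R) :
  (forall i, mu.-integrable D (EFin \o f i)) ->
  \int[mu]_(x in D) (\sum_(i <- s) f i x) = \sum_(i <- s) \int[mu]_(x in D) f i x.
Proof.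
move=> intf; elim: s => [|i s IHs].
  under eq_Rintegral do rewrite big_nil.
  by rewrite Rintegral_cst// mul0r big_nil.
under eq_Rintegral do rewrite big_cons.
by rewrite RintegralD//; [rewrite IHs big_cons|exact: integrable_sum_real].
Qed.

End integral_sum_real.

Lemma ref_cubeE (R : realType) n : ref_cube = ccube (0 : 'rV[R]_n) 1.
Proof.
by apply/seteqP; split=> x h i; have := h i; rewrite [(0 : 'rV_n) _ _]mxE subr0 ler_norml.
Qed.

(** Polynomial of degree at most [m] in the i-th coordinate when the others
    are frozen. Tensor product quadrature and interpolation proceed one
    coordinate at a time and use only this; under products the degrees add, so
    it passes to determinants. *)
Definition deg_in (R : realType) n (m : nat) (i : 'I_n) (f : 'rV[R]_n -> R) : Prop :=
  forall x, exists2 q : {poly R}, (size q <= m.+1)%N &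
    forall s, f (upd x i s) = q.[s].

Section fubini_cube.
Context (R : realType) (n : nat) (f : 'rV[R]_n.+1 -> R).
Hypothesis cf : continuous f.

Notation K := (ccube (0 : 'rV[R]_n) 1).
Notation K1 := (ccube (0 : 'rV[R]_n.+1) 1).

Lemma row_cons_ccube (z : measurableTypeR R * 'rV[R]_n) :
  K1 (row_cons z) <-> (-1 <= z.1 <= 1) /\ K z.2.
Proof.
rewrite -!ref_cubeE; case: z => t y /=; split=> [h|[ht hy] i].
  split; first by have := h ord0; rewrite row_cons0.
  by move=> i; have := h (lift ord0 i); rewrite row_consS.
have [->|[j ->]] := ord_0_or_lift i; first by rewrite row_cons0.
by have := hy j; rewrite row_consS.
Qed.

(** Fubini's theorem, with the inner integral already evaluated as that of a
    polynomial. *)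
Lemma Rintegral_cubeS (F : 'rV[R]_n -> R) :
  (forall y, exists2 q : {poly R}, F y = polyint q &
     forall t, f (row_cons (t, y)) = q.[t]) ->
  \int[lebesgue_row R n.+1]_(x in K1) f x = \int[lebesgue_row R n]_(y in K) F y.
Proof.
move=> fF; rewrite /Rintegral; congr fine.
pose m := @lebesgue_measure R.
pose rc := @row_cons R n.
pose D := rc @^-1` K1.
have mD : measurable D.
  exact: measurable_preimage (@measurable_row_cons R n) (measurable_ccube 0 1).
have mf : measurable_fun setT f by exact: continuous_measurable_row.
have [C C0 fC] := bounded_continuous_cube cf.
have intD : (m \x lebesgue_row R n)%E.-integrable D (EFin \o f \o rc).
  apply: (@integrable_bounded_fin _ _ _ _ _ (f \o rc) C) => //.
  - have := @lebesgue_cube_fin R n.+1; by [].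
  - apply: measurable_funTS; apply: measurableT_comp => //.
    exact: measurable_row_cons.
  - by move=> z Dz; exact: fC.
transitivity (\int[(m \x lebesgue_row R n)]_(z in D) (f (rc z))%:E)%E.
  apply: (@integral_pushforward _ _ _ _ _ rc (@measurable_row_cons R n)
    (m \x lebesgue_row R n)%E K1 (EFin \o f)) => //.
  - exact/measurable_EFinP.
  - exact: measurable_ccube.
have intT := (integrable_mkcond _ mD).1 intD.
rewrite [LHS]integral_mkcond.
apply: (etrans (esym (@integral21_prod_meas1 _ _ _ _ _ m (lebesgue_row R n)
  _ intT))).
rewrite [RHS]integral_mkcond; apply: eq_integral => y _.
rewrite /fubini_G patchE.
have [q Fy fq] := fF y.
case: ifPn => [|]; rewrite ?inE ?notin_setE => Ky.
  rewrite Fy /polyint /Rintegral fineK; last first.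
    by apply: integrable_fin_num => //; exact: integrable_poly.
  rewrite [RHS]integral_mkcond; apply: eq_integral => t _; rewrite !patchE.
  have -> : ((t, y) \in D) = (t \in [set` `[(-1 : R), 1]]).
    apply/idP/idP; rewrite !inE /D /= in_itv/=.
      by move=> /row_cons_ccube[].
    by move=> ht; apply/row_cons_ccube.
  by case: ifP => // _ /=; rewrite fq.
rewrite integral0_eq// => t _; rewrite patchE ifF//.
by apply/negP; rewrite inE => /row_cons_ccube[].
Qed.

End fubini_cube.

Section tensor_quadrature.
Context (R : realType) (p m : nat) (t w : 'I_p -> R).
Hypothesis exact1 : forall q : {poly R}, (size q <= m.+1)%N ->
  polyint q = \sum_k w k * q.[t k].

Let ffcons n (z : 'I_p * {ffun 'I_n -> 'I_p}) : {ffun 'I_n.+1 -> 'I_p} :=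
  [ffun i => if unlift ord0 i is Some j then z.2 j else z.1].

Let ffcons0 n z : @ffcons n z ord0 = z.1.
Proof. by rewrite ffunE unlift_none. Qed.

Let ffconsS n z (i : 'I_n) : @ffcons n z (lift ord0 i) = z.2 i.
Proof. by rewrite ffunE liftK. Qed.

Let ffcons_bij n : bijective (@ffcons n).
Proof.
exists (fun k : {ffun 'I_n.+1 -> 'I_p} =>
    (k ord0, [ffun i : 'I_n => k (lift ord0 i)])) => [[a b]|k].
  by rewrite ffcons0; congr pair; apply/ffunP => i; rewrite ffunE ffconsS.
apply/ffunP => i; have [->|[j ->]] := ord_0_or_lift i; first by rewrite ffcons0.
by rewrite ffconsS ffunE.
Qed.

Lemma upd_row_cons n (s s' : R) (y : 'rV[R]_n) :
  upd (row_cons (s', y)) ord0 s = row_cons (s, y).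
Proof.
apply/rowP => i; have [->|[j ->]] := ord_0_or_lift i.
  by rewrite upd_same row_cons0.
by rewrite upd_other ?neq_lift// !row_consS.
Qed.

Lemma upd_row_consS n (s s' : R) (y : 'rV[R]_n) j :
  upd (row_cons (s', y)) (lift ord0 j) s = row_cons (s', upd y j s).
Proof.
apply/rowP => i; have [->|[k ->]] := ord_0_or_lift i.
  by rewrite upd_other ?neq_lift// !row_cons0.
rewrite row_consS [in RHS]mxE; have [->|kj] := eqVneq k j.
  by rewrite upd_same.
by rewrite upd_other ?row_consS// (inj_eq (@lift_inj _ _)).
Qed.

Lemma continuous_row_cons n (s : R) :
  continuous (fun y : 'rV[R]_n => row_cons (s, y)).
Proof.
apply: (@dist_continuous _ _ _ _ 1) => x y; rewrite mul1r.
apply/rV_normrP => // i; have [->|[j ->]] := ord_0_or_lift i.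
  by rewrite mxE [X in _ + X]mxE !row_cons0 subrr normr0.
rewrite mxE [X in _ + X]mxE !row_consS.
by have := rV_norm_coord (x - y) j; rewrite !mxE.
Qed.

Lemma gauss_point_ffcons n z :
  gauss_point t (@ffcons n z) = row_cons (t z.1, gauss_point t z.2).
Proof.
apply/rowP => i; have [->|[j ->]] := ord_0_or_lift i.
  by rewrite mxE ffcons0 row_cons0.
by rewrite mxE ffconsS row_consS mxE.
Qed.

(** Induction on the dimension: the rule is exact in the first coordinate, and
    each slice at a node is again of degree at most [m] in each of the
    remaining coordinates. *)
Lemma tensor_quadrature_exact n (f : 'rV[R]_n -> R) : continuous f ->
  (forall i, deg_in m i f) ->
  \int[lebesgue_row R n]_(x in ccube 0 1) f x =
  \sum_(k : {ffun 'I_n -> 'I_p}) (\prod_i w (k i)) * f (gauss_point t k).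
Proof.
elim: n f => [|n IHn] f cf df.
  have f0 x : f x = f 0 by rewrite (thinmx0 x).
  under eq_Rintegral do rewrite f0.
  rewrite Rintegral_cst; last exact: measurable_ccube.
  rewrite [X in fine X](_ : _ = 1%E); last first.
    by apply: etrans (lebesgue_row_ccube _ ltr01) _; rewrite expr0.
  rewrite (eq_bigr (fun=> f 0)) => [|k _].
    by rewrite sumr_const card_ffun !card_ord expn0 mulr1n mulr1.
  by rewrite big_ord0 mul1r f0.
pose g k (y : 'rV[R]_n) := f (row_cons (t k, y)).
have cg k : continuous (g k).
  by move=> y; exact: (continuous_comp (@continuous_row_cons n (t k) y) (@cf _)).
rewrite (@Rintegral_cubeS _ _ _ cf (fun y => \sum_k w k * g k y)); last first.
  move=> y; have [q sq fq] := df ord0 (row_cons (0, y)).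
  exists q => [|s]; last by rewrite -fq upd_row_cons.
  by rewrite exact1//; apply: eq_bigr => k _; rewrite -fq upd_row_cons.
have int k : (lebesgue_row R n).-integrable (ccube 0 1) (EFin \o (fun y => w k * g k y)).
  apply: integrable_continuous_cube => y.
  exact: (continuousM (@cst_continuous _ _ (w k) y) (@cg k y)).
transitivity (\sum_k w k * \int[lebesgue_row R n]_(y in ccube 0 1) g k y).
  rewrite Rintegral_sum//; last exact: measurable_ccube.
  apply: eq_bigr => k _; rewrite RintegralZl//; first exact: measurable_ccube.
  exact: integrable_continuous_cube.
rewrite (reindex (@ffcons n)); last exact/onW_bij/ffcons_bij.
rewrite -(pair_bigA _ (fun a b => (\prod_i w (ffcons (a, b) i)) *
  f (gauss_point t (ffcons (a, b))))) /=.
apply: eq_bigr => k _; rewrite IHn//; last first.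
  move=> i y; have [q sq fq] := df (lift ord0 i) (row_cons (t k, y)).
  by exists q => // s; rewrite /g -fq upd_row_consS.
rewrite mulr_sumr; apply: eq_bigr => l _.
rewrite big_ord_recl ffcons0 gauss_point_ffcons mulrA /g.
by congr (_ * _ * _); apply: eq_bigr => i _; rewrite ffconsS.
Qed.

End tensor_quadrature.

(** * Degrees in each variable, unisolvence and exactness on an element *)

Section degree_in_coordinate.
Context (R : realType) (n : nat) (i : 'I_n).
Implicit Types f g : 'rV[R]_n -> R.

Lemma deg_inW m m' f : (m <= m')%N -> deg_in m i f -> deg_in m' i f.
Proof.
move=> mm' df x; have [q sq fq] := df x; exists q => //.
by rewrite (leq_trans sq).
Qed.

Lemma deg_in_cst c : deg_in 0 i (fun _ : 'rV[R]_n => c).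
Proof.
by move=> x; exists c%:P => [|s]; [exact: size_polyC_leq1|rewrite hornerC].
Qed.

Lemma deg_inD m f g : deg_in m i f -> deg_in m i g ->
  deg_in m i (fun x => f x + g x).
Proof.
move=> df dg x; have [q sq fq] := df x; have [r sr gr] := dg x.
exists (q + r) => [|s]; last by rewrite hornerD fq gr.
by rewrite (leq_trans (size_polyD _ _))// geq_max sq.
Qed.

Lemma deg_inM m m' f g : deg_in m i f -> deg_in m' i g ->
  deg_in (m + m') i (fun x => f x * g x).
Proof.
move=> df dg x; have [q sq fq] := df x; have [r sr gr] := dg x.
exists (q * r) => [|s]; last by rewrite hornerM fq gr.
rewrite (leq_trans (size_polyMleq _ _))// -subn1 leq_subLR.
by rewrite (leq_trans (leq_add sq sr))// addSn addnS.
Qed.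

Lemma deg_inZ m c f : deg_in m i f -> deg_in m i (fun x => c * f x).
Proof. exact: (deg_inM (deg_in_cst c)). Qed.

Lemma deg_inB m f g : deg_in m i f -> deg_in m i g ->
  deg_in m i (fun x => f x - g x).
Proof.
move=> df dg; rewrite (_ : (fun x => _) = fun x => f x + -1 * g x).
  exact/(deg_inD df)/deg_inZ.
by apply/funext => x; rewrite mulN1r.
Qed.

Lemma deg_in_sum m I (s : seq I) (f : I -> 'rV[R]_n -> R) :
  (forall k, deg_in m i (f k)) -> deg_in m i (fun x => \sum_(k <- s) f k x).
Proof.
move=> df; elim: s => [|k s IHs].
  under eq_fun do rewrite big_nil.
  by apply: deg_inW (deg_in_cst 0).
under eq_fun do rewrite big_cons.
exact: (deg_inD (df k) IHs).
Qed.

Lemma deg_in_prod I (s : seq I) (m : I -> nat) (f : I -> 'rV[R]_n -> R) :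
  (forall k, deg_in (m k) i (f k)) ->
  deg_in (\sum_(k <- s) m k) i (fun x => \prod_(k <- s) f k x).
Proof.
move=> df; elim: s => [|k s IHs].
  rewrite big_nil (_ : (fun x => _) = fun=> 1); first exact: deg_in_cst.
  by apply/funext => x; rewrite big_nil.
rewrite big_cons (_ : (fun x => _) = fun x => f k x * \prod_(l <- s) f l x).
  exact: (deg_inM (df k) IHs).
by apply/funext => x; rewrite big_cons.
Qed.

Lemma deg_in_coordX (j : 'I_n) (k : nat) :
  deg_in (if j == i then k else 0) i (fun x : 'rV[R]_n => x ord0 j ^+ k).
Proof.
have [->|ji] := eqVneq j i => x.
  by exists 'X^k => [|s]; [rewrite size_polyXn|rewrite hornerXn upd_same].
exists (x ord0 j ^+ k)%:P => [|s]; first exact: size_polyC_leq1.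
by rewrite hornerC upd_other.
Qed.

Lemma in_P_deg_in r f : in_P r f -> deg_in r i f.
Proof.
move=> [c fE]; have -> : f = (fun x => \sum_a c a * \prod_j x ord0 j ^+ a j).
  exact/funext.
apply: deg_in_sum => a.
apply: deg_inW (deg_inZ (c a)
  (deg_in_prod (index_enum 'I_n) (fun j => deg_in_coordX j (a j)))).
by rewrite -big_mkcond big_pred1_eq -ltnS.
Qed.

End degree_in_coordinate.

Lemma continuous_coordX (R : realType) n (j : 'I_n) k :
  continuous (fun x : 'rV[R]_n => x ord0 j ^+ k).
Proof.
elim: k => [|k IHk]; first by under eq_fun do rewrite expr0; exact: cst_continuous.
under eq_fun do rewrite exprS.
by move=> x; exact: (continuousM (@coord_continuous _ _ _ ord0 j x) (@IHk x)).
Qed.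

Lemma in_P_continuous (R : realType) n r (f : 'rV[R]_n -> R) :
  in_P r f -> continuous f.
Proof.
move=> [c fE]; have -> : f = (fun x => \sum_a c a * \prod_j x ord0 j ^+ a j).
  exact/funext.
apply: continuous_sum_real => a x.
have cp : continuous (fun x : 'rV[R]_n => \prod_j x ord0 j ^+ a j).
  by apply: continuous_prod_real => j; exact: continuous_coordX.
exact: (continuousM (@cst_continuous _ _ (c a) x) (@cp x)).
Qed.

Section unisolvence.
Context (R : realType) (n p : nat) (t : 'I_p -> R) (tinj : injective t).

(** Free the coordinates one after the other: on a line parallel to a free
    axis [f] is a polynomial with [p] roots and degree less than [p]. *)
Lemma deg_in_grid0 (f : 'rV[R]_n -> R) : (0 < p)%N ->
  (forall i, deg_in p.-1 i f) ->
  (forall k : {ffun 'I_n -> 'I_p}, f (gauss_point t k) = 0) -> forall x, f x = 0.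
Proof.
move=> p0 df f0.
(* The first [j] coordinates are free; the others are nodes. *)
suff main j (x : 'rV[R]_n) :
    (forall i : 'I_n, (j <= i)%N -> exists l, x ord0 i = t l) -> f x = 0.
  by move=> x; apply: (main n) => i; rewrite leqNgt ltn_ord.
elim: j x => [|j IHj] x xt.
  have kx i : {l | x ord0 i = t l} by apply/cid; exact: xt.
  rewrite -(f0 [ffun i => sval (kx i)]); congr f.
  by apply/rowP => i; rewrite mxE ffunE; case: (kx i).
have [jn|nj] := ltnP j n; last first.
  by apply: IHj => i ji; have := ltn_ord i; rewrite ltnNge (leq_trans nj ji).
pose i := Ordinal jn; have [q sq fq] := df i x.
have q0 : q = 0.
  apply: (poly_eq0_of_roots tinj) => [|l]; first by rewrite -(prednK p0).
  apply/rootP; rewrite -fq; apply: IHj => k jk.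
  have [->|ki] := eqVneq k i; first by exists l; rewrite upd_same.
  rewrite upd_other//; apply: xt; rewrite ltn_neqAle jk andbT.
  by apply: contra ki => /eqP jk'; apply/eqP/val_inj.
by rewrite -[x](upd_id x i) fq q0 horner0.
Qed.

Lemma lagrange_expansion (phihat : {ffun 'I_n -> 'I_p} -> 'rV[R]_n -> R)
    (f : 'rV[R]_n -> R) : (0 < p)%N ->
  (forall k, in_P p.-1 (phihat k)) ->
  (forall k l, phihat k (gauss_point t l) = (k == l)%:R) ->
  (forall i, deg_in p.-1 i f) ->
  forall x, f x = \sum_k f (gauss_point t k) * phihat k x.
Proof.
move=> p0 hphi phiE df x; apply/eqP; rewrite -subr_eq0; apply/eqP.
apply: (@deg_in_grid0
  (fun x => f x - \sum_k f (gauss_point t k) * phihat k x) p0) => [i|l].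
  apply: (deg_inB (df i)); apply: deg_in_sum => k.
  by apply: deg_inZ; exact: in_P_deg_in.
rewrite (bigD1 l)//= big1 => [|k kl]; last by rewrite phiE (negPf kl) mulr0.
by rewrite phiE eqxx mulr1 addr0 subrr.
Qed.

End unisolvence.

Section element_quadrature.
Context (R : realType) (n : nat) (F : 'rV[R]_n -> 'rV[R]_n).
Hypothesis rF : regular_map F.

Notation K := (ccube (0 : 'rV[R]_n) 1).

(** [F] is affine in [x_k], hence so are its slopes, and the k-th slope does
    not involve [x_k]. *)
Lemma deg_in_slope (i j k : 'I_n) :
  deg_in (i != k) k (fun x => slope F i x ord0 j).
Proof.
have [->|ik] := eqVneq i k => x.
  exists (slope F k x ord0 j)%:P => [|s]; first exact: size_polyC_leq1.
  by rewrite hornerC slope_upd.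
pose a := slope F i (upd x k 0) ord0 j.
pose b := (slope F i (upd x k 1) - slope F i (upd x k 0)) ord0 j.
exists (a%:P + b *: 'X) => [|s].
  rewrite (leq_trans (size_polyD _ _))// geq_max.
  rewrite (leq_trans (size_polyC_leq1 _))//=.
  by rewrite (leq_trans (size_scale_leq _ _))// size_polyX.
rewrite hornerD hornerC hornerZ hornerX.
have F1 u v : F (upd (upd x k u) i v) = F (upd (upd x i v) k u).
  by rewrite upd_comm// eq_sym.
rewrite /a /b /slope !F1 (reg_multi_affine rF (upd x i 1) k s).
rewrite (reg_multi_affine rF (upd x i 0) k s) !mxE; ring.
Qed.

(** In the Leibniz formula every row but the k-th contributes degree at most
    one in [x_k]. *)
Lemma deg_in_det_slope (k : 'I_n) : deg_in n.-1 k (fun x => \det (slope_mx F x)).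
Proof.
apply: deg_in_sum => s; apply: deg_inZ.
rewrite (_ : (fun x => _) = fun x => \prod_i slope F i x ord0 (s i)); last first.
  by apply/funext => x; apply: eq_bigr => i _; rewrite mxE.
have := deg_in_prod (index_enum 'I_n) (fun i => deg_in_slope i (s i) k).
have -> : (\sum_(i < n) (i != k) = n.-1)%N.
  rewrite (eq_bigr (fun i => if i != k then 1 else 0)%N); last first.
    by move=> i _; case: ifP.
  by rewrite -big_mkcond sum1_card cardC1 card_ord.
by [].
Qed.

(** Intermediate value theorem on the segment from 0 to [x]. *)
Lemma continuous_gt0_cube (g : 'rV[R]_n -> R) : continuous g ->
  (forall x, K x -> g x != 0) -> 0 < g 0 -> forall x, K x -> 0 < g x.
Proof.
move=> cg g0 g00 x Kx; rewrite ltNge; apply/negP => gx.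
have cs : continuous (fun s : R => s *: x).
  by move=> s; apply: cvgZr_tmp; exact: cvg_id.
have ch : continuous (fun s : R => g (s *: x)).
  by move=> s; exact: (continuous_comp (@cs s) (@cg _)).
have [||s s01 gs] := @IVT R (fun s => g (s *: x)) 0 1 0 ler01.
- exact: continuous_subspaceT.
- by rewrite scale0r scale1r ge_min gx orbT le_max ltW.
have /eqP := gs; apply/negP/g0; rewrite -ref_cubeE in Kx *.
move=> i; have := Kx i; rewrite mxE; move: s01; rewrite in_itv/= -!ler_norml.
by move=> /andP[s0 s1] xi; rewrite normrM ger0_norm// mulr_ile1.
Qed.

(** The determinant has a constant sign on the cube, so the volume factor is a
    polynomial there. *)
Lemma volume_factor_sign : exists e : R, forall x, K x ->
  volume_factor F x = e * \det (slope_mx F x).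
Proof.
have cd := continuous_det_slope (reg_continuous rF).
have d0 x : K x -> \det (slope_mx F x) != 0.
  by move=> Kx; rewrite -unitfE -unitmxE; exact: (reg_unit rF).
have K0 : K 0 by move=> i; rewrite subrr normr0.
have [d00|d00|] := ltgtP 0 (\det (slope_mx F 0)).
- exists 1 => x Kx; rewrite mul1r /volume_factor gtr0_norm//.
  exact: continuous_gt0_cube cd d0 d00 _ Kx.
- exists (-1) => x Kx; rewrite mulN1r /volume_factor ltr0_norm// -oppr_gt0.
  have cN : continuous (fun x => - \det (slope_mx F x)).
    by move=> y; exact: (continuousN (@cd y)).
  apply: (continuous_gt0_cube cN _ _ Kx) => [y Ky|]; first by rewrite oppr_eq0 d0.
  by rewrite oppr_gt0.
- by move/esym/eqP; rewrite (negPf (d0 0 K0)).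
Qed.

(** The integrand has degree at most
    [(p - 1) + (n - 1) <= 2 * p - 1] in each coordinate, within
    the range of exactness of the [p]-point Gauss rule. *)
Lemma element_quadrature_exact p (t : 'I_p -> R) (f : 'rV[R]_n -> R) :
  gauss_nodes t -> (n.-1 <= p)%N -> (0 < p)%N -> continuous f ->
  (forall i, deg_in p.-1 i f) ->
  \sum_(k : {ffun 'I_n -> 'I_p}) gauss_point_weight t k *
    volume_factor F (gauss_point t k) * f (gauss_point t k) =
  \int[lebesgue_row R n]_(x in K) (f x * volume_factor F x).
Proof.
move=> ht np p0 cf df; have [e eE] := volume_factor_sign.
have cd := continuous_det_slope (reg_continuous rF).
have Kt k : K (gauss_point t k).
  have [_ t1 _] := ht; rewrite -ref_cubeE => i; rewrite mxE.
  by have /andP[? ?] := t1 (k i); rewrite !ltW.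
pose h x := f x * (e * \det (slope_mx F x)).
have ch : continuous h.
  move=> x; apply: (continuousM (@cf x)).
  exact: (continuousM (@cst_continuous _ _ e x) (@cd x)).
have dh i : deg_in (2 * p).-1 i h.
  apply: (@deg_inW _ _ _ (p.-1 + n.-1)).
    by case: (p) p0 np => // q _ qn; rewrite mul2n -addnn addSn /= leq_add2l.
  by apply: (deg_inM (df i)); apply: deg_inZ; exact: deg_in_det_slope.
have ex1 (q : {poly R}) : (size q <= (2 * p).-1.+1)%N ->
    polyint q = \sum_k gauss_weight t k * q.[t k].
  by rewrite prednK ?muln_gt0// => sq; exact: gauss_exact.
transitivity (\int[lebesgue_row R n]_(x in K) h x); last first.
  by apply: eq_Rintegral => x; rewrite inE => Kx; rewrite eE.
rewrite (tensor_quadrature_exact ex1 ch dh); apply: eq_bigr => k _.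
by rewrite eE// /h -mulrA; congr (_ * _); rewrite mulrC.
Qed.

End element_quadrature.

(** * Geometry of the mesh *)

Section elements.
Context (R : realType) (d : nat) (E : finType) (M : mesh R d E) (T : E).

Let coef (s : {ffun 'I_d -> bool}) (x : 'rV[R]_d) : R :=
  \prod_i ((if s i then 1 + x ord0 i else 1 - x ord0 i) / 2).

Lemma elt_map_multi_affine : multi_affine (elt_map M T).
Proof.
move=> x i s.
have cE b : coef b (upd x i s) = coef b (upd x i 0) +
    s * (coef b (upd x i 1) - coef b (upd x i 0)).
  have E1 u : coef b (upd x i u) = ((if b i then 1 + u else 1 - u) / 2) *
      \prod_(j < d | j != i) ((if b j then 1 + x ord0 j else 1 - x ord0 j) / 2).
    rewrite /coef (bigD1 i)//= upd_same; congr (_ * _).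
    by apply: eq_bigr => j ji; rewrite upd_other.
  by rewrite !E1; case: (b i); field.
rewrite /elt_map -sumrB scaler_sumr -big_split/=; apply: eq_bigr => b _.
rewrite -!/(coef b _) cE scalerDl -scalerA.
by rewrite scalerBl.
Qed.

Lemma continuous_elt_map : continuous (elt_map M T).
Proof.
have cc b : continuous (coef b).
  apply: continuous_prod_real => i x.
  have cx : continuous (fun x : 'rV[R]_d => x ord0 i) by exact: coord_continuous.
  have c1 : continuous (fun _ : 'rV[R]_d => 1 : R) by exact: cst_continuous.
  have c2 : continuous (fun _ : 'rV[R]_d => 2^-1 : R) by exact: cst_continuous.
  case: (b i).
    exact: (continuousM (continuousD (@c1 x) (@cx x)) (@c2 x)).
  exact: (continuousM (continuousB (@c1 x) (@cx x)) (@c2 x)).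
have cs (r : seq {ffun 'I_d -> bool}) :
    continuous (fun x => \sum_(b <- r) coef b x *: vertex M T b).
  elim: r => [|b r IHr].
    by under eq_fun do rewrite big_nil; exact: cst_continuous.
  under eq_fun do rewrite big_cons.
  move=> x; have cb : {for x, continuous (fun x => coef b x *: vertex M T b)}.
    exact: (@cvgZr_tmp _ _ _ _ (nbhs_filter x) _ _ _ (@cc b x)).
  exact: (continuousD cb (@IHr x)).
exact: cs.
Qed.

Lemma elt_map_regular Omega kappa : fe_mesh M Omega kappa ->
  regular_map (elt_map M T).
Proof.
move=> [_ bij sr _ _]; split.
- exact: continuous_elt_map.
- exact: elt_map_multi_affine.
- move=> x y; rewrite -!ref_cubeE => Kx Ky.
  by apply: (bij T).1; rewrite inE.
- move=> x; rewrite -ref_cubeE => Kx; have [+ _ _] := sr T x Kx.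
  rewrite jacobian_multi_affine//; first exact: elt_map_multi_affine.
  exact: continuous_elt_map.
Qed.

Lemma jacobian_elt_map x : `|\det ('J (elt_map M T) x)| = volume_factor (elt_map M T) x.
Proof.
rewrite jacobian_multi_affine//; first exact: elt_map_multi_affine.
exact: continuous_elt_map.
Qed.

End elements.

Lemma open_ref_cubeE (R : realType) n : open_ref_cube = ocube (0 : 'rV[R]_n) 1.
Proof.
by apply/seteqP; split=> x h i; have := h i; rewrite [(0 : 'rV_n) _ _]mxE subr0 ltr_norml.
Qed.

Section mesh_geometry.
Context (R : realType) (d : nat) (Omega : set 'rV[R]_d)
  (hOmega : lipschitz_domain Omega) (E : finType) (M : mesh R d E) (kappa : R)
  (hM : fe_mesh M Omega kappa).

Notation mu := (lebesgue_row R d).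
Notation K := (ccube (0 : 'rV[R]_d) 1).
Notation Ko := (ocube (0 : 'rV[R]_d) 1).

Let rF T := elt_map_regular T hM.

Lemma eltE T : elt M T = elt_map M T @` K.
Proof. by rewrite /elt ref_cubeE. Qed.

Lemma measurable_Omega : measurable Omega.
Proof. by apply: open_measurable_row; case: hOmega. Qed.

Lemma measurable_elt T : measurable (elt M T).
Proof. by rewrite eltE; exact: (measurable_image_ccube1 (rF T)). Qed.

Lemma open_elt_sub_interior T : elt_map M T @` Ko `<=` interior (elt M T).
Proof.
move=> y yo; rewrite /interior /=; apply: (@filterS _ _ _ (elt_map M T @` Ko)).
  by rewrite eltE; exact/image_subset/sub_ocube.
by apply: open_nbhs_nbhs; split=> //; exact: (open_image_ocube (rF T)).
Qed.

(** The open element is an open subset of the closure of [Omega], hence of its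
    interior. *)
Lemma open_elt_sub T : elt_map M T @` Ko `<=` Omega.
Proof.
move=> y yo; apply: (interior_closure_lipschitz hOmega).
apply: filterS (open_elt_sub_interior yo).
have [[-> _] _ _ _ _] := hM; exact: bigcup_sup.
Qed.

(** The image of the open cube is open and would meet the other element in a
    point of the image of its open cube; that point would be interior to
    both. *)
Lemma elts_disjoint T T' x z : T != T' -> K x -> Ko z ->
  elt_map M T x <> elt_map M T' z.
Proof.
move=> TT' Kx Koz xz.
have [x' Kox' [z' Koz' zx']] := image_ccube_meets (rF T) (open_image_ocube (rF T')) Kx
  (ex_intro2 _ _ z Koz (esym xz)).
have [[_ /(_ _ _ TT')]] := hM; rewrite -subset0 => disj _ _ _ _.
apply: (disj (elt_map M T x')); split; first by apply: open_elt_sub_interior; exists x'.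
by rewrite -zx'; apply: open_elt_sub_interior; exists z'.
Qed.

Definition open_elts : set 'rV[R]_d := \bigcup_T (elt_map M T @` Ko).

(** The closed elements cover [Omega], and each exceeds its open element by a
    null set. *)
Lemma skeleton_null : mu.-negligible (Omega `\` open_elts).
Proof.
pose B := \big[setU/set0]_T (elt_map M T @` K `\` elt_map M T @` Ko).
have mB T : measurable (elt_map M T @` K `\` elt_map M T @` Ko).
  by apply: measurableD;
    [exact: (measurable_image_ccube1 (rF T))|exact: (measurable_image_ocube1 (rF T))].
have : mu.-negligible B.
  rewrite /B; elim/big_ind : _ => [|A C|T _].
  - exact: negligible_set0.
  - exact: negligibleU.
  - by exists (elt_map M T @` K `\` elt_map M T @` Ko); split=> //;
      exact: (lebesgue_image_boundary (rF T)).
apply: negligibleS => y [Oy nSy].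
have : closure Omega y by exact: subset_closure.
have [[-> _] _ _ _ _] := hM => -[T _]; rewrite eltE => yT.
rewrite /B (bigD1 T)//=; left; split=> // yo; apply: nSy.
by exists T.
Qed.

Lemma lebesgue_Omega_fin : (mu Omega < +oo)%E.
Proof.
have [_ _ _ bO _] := hOmega.
have [r r0 Or] : exists2 r, 0 < r & Omega `<=` ccube 0 r.
  have [C [_ hC]] := bO; exists (`|C| + 1); first by rewrite ltr_wpDl.
  move=> x Ox; apply/ccubeP; first by rewrite addr_ge0.
  rewrite subr0; apply: (hC (`|C| + 1)) => //.
  by rewrite (le_lt_trans (ler_norm C))// ltrDl.
apply: le_lt_trans (lebesgue_row_le measurable_Omega (measurable_ccube 0 r) Or) _.
by rewrite lebesgue_row_ccube// ltry.
Qed.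

Lemma elt_map_pinv T x : K x -> pinv ref_cube (elt_map M T) (elt_map M T x) = x.
Proof.
move=> Kx; apply: pinvKV; last by rewrite inE ref_cubeE.
by have [_ bij _ _ _] := hM; exact: (bij T).1.
Qed.

Lemma push_elt_in T f x : K x -> push_elt M T f (elt_map M T x) = f x.
Proof.
move=> Kx; rewrite /push_elt patchE mem_set.
  by rewrite /= elt_map_pinv.
by rewrite eltE; exists x.
Qed.

Lemma push_elt_out T T' f x : T != T' -> Ko x ->
  push_elt M T f (elt_map M T' x) = 0.
Proof.
move=> TT' Kox; rewrite /push_elt patchE memNset//.
by rewrite eltE => -[z Kz]; exact: elts_disjoint TT' Kz Kox.
Qed.

Lemma measurable_push_elt T f : continuous f -> measurable_fun Omega (push_elt M T f).
Proof.
move=> cf; apply: measurable_funTS.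
apply/(measurable_restrictT _ (measurable_elt T)).
rewrite eltE; apply: (measurable_regular (rF T) cf) => x Kx /=.
by rewrite elt_map_pinv.
Qed.

Lemma push_elt_bounded T f : continuous f ->
  exists2 C, 0 < C & forall y, `|push_elt M T f y| <= C.
Proof.
move=> cf; have [C C0 fC] := bounded_continuous_cube cf; exists C => // y.
rewrite /push_elt patchE; case: ifPn => [|_]; last by rewrite normr0 ltW.
by rewrite inE eltE => -[x Kx <-] /=; rewrite elt_map_pinv// fC.
Qed.

Lemma L2_push_elt T f : continuous f -> L2 Omega (push_elt M T f).
Proof.
move=> cf; have mf := measurable_push_elt T cf; split=> //.
have [C C0 fC] := push_elt_bounded T cf.
apply: (@integrable_bounded_fin _ _ _ _ _ (fun x => push_elt M T f x ^+ 2) (C ^+ 2)).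
- exact: measurable_Omega.
- exact: lebesgue_Omega_fin.
- exact: measurable_funX.
- by move=> x _; rewrite normrX lerXn2r// nnegrE ltW.
Qed.

(** The element minus its boundary lies in [Omega], so integrating over
    [Omega] or over the element is the same, and the latter integral is pulled
    back to the cube. *)
Lemma Rintegral_push_elt T f : continuous f ->
  \int[mu]_(y in Omega) push_elt M T f y =
  \int[mu]_(x in K) (f x * volume_factor (elt_map M T) x).
Proof.
move=> cf; rewrite /push_elt -Rintegral_mkcondr.
pose g := f \o pinv ref_cube (elt_map M T).
have gF x : K x -> g (elt_map M T x) = f x by move=> Kx; rewrite /g /= elt_map_pinv.
rewrite -(change_of_variables (rF T) cf gF) -eltE.
have mO := measurable_Omega; have mT := measurable_elt T.
have Tdec : elt M T = (Omega `&` elt M T) `|` (elt M T `\` Omega).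
  by rewrite setIC setDE -setIUr setUv setIT.
rewrite [in RHS]Tdec Rintegral_setU//; last 4 first.
- exact: measurableI.
- exact: measurableD.
- by rewrite -Tdec eltE; exact: (integrable_regular (rF T) cf gF).
- by apply/disj_setPS => x [[Ox _] [_ /(_ Ox)]].
have null : mu (elt M T `\` Omega) = 0%E.
  apply/eqP; rewrite eq_le measure_ge0 andbT -(lebesgue_image_boundary (rF T)).
  apply: lebesgue_row_le; first exact: measurableD.
    by apply: measurableD;
      [exact: (measurable_image_ccube1 (rF T))|exact: (measurable_image_ocube1 (rF T))].
  by rewrite eltE; apply: setDS; exact: open_elt_sub.
rewrite [X in _ = _ + X](_ : _ = 0) ?addr0//.
rewrite /Rintegral null_set_integral//; first exact: measurableD.
apply/measurable_EFinP; apply: (measurable_funS mT) => [x []//|].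
by rewrite eltE; exact: (measurable_regular (rF T) cf gF).
Qed.

End mesh_geometry.

(** * Moments of square integrable matrix fields and projection onto a ball *)

Section L2_calculus.
Context (R : realType) (d : nat) (Omega : set 'rV[R]_d) (mO : measurable Omega).
Implicit Types f g : 'rV[R]_d -> R.
Notation mu := (lebesgue_row R d).

Lemma integrable_L2M f g : L2 Omega f -> L2 Omega g ->
  mu.-integrable Omega (EFin \o (fun x => f x * g x)).
Proof.
move=> [mf if2] [mg ig2].
apply: (le_integrable mO _ _ (integrableD mO if2 ig2)).
  by apply/measurable_EFinP; exact: measurable_funM.
move=> x Ox /=; rewrite lee_fin [leRHS]ger0_norm ?addr_ge0 ?sqr_ge0//.
rewrite ler_norml; have := sqr_ge0 (f x + g x); have := sqr_ge0 (f x - g x).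
rewrite sqrrB sqrrD; move: (sqr_ge0 (f x)) (sqr_ge0 (g x)).
by move=> ? ? ? ?; apply/andP; split; lra.
Qed.

Lemma L2Z c f : L2 Omega f -> L2 Omega (fun x => c * f x).
Proof.
move=> [mf if2]; split; first exact: measurable_funM.
have := integrableZl mO (c ^+ 2) if2.
apply: eq_integrable => // x _ /=; by rewrite -EFinM exprMn.
Qed.

Lemma L2D f g : L2 Omega f -> L2 Omega g -> L2 Omega (fun x => f x + g x).
Proof.
move=> Lf Lg; have ifg := integrable_L2M Lf Lg.
have [mf if2] := Lf; have [mg ig2] := Lg.
split; first exact: measurable_funD.
have := integrableD mO (integrableD mO if2 ig2) (integrableZl mO 2 ifg).
apply: eq_integrable => // x _ /=; rewrite -!EFinM -!EFinD; congr EFin; ring.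
Qed.

Lemma L2_zero : L2 Omega (fun=> 0).
Proof.
split; first exact: measurable_cst.
by apply: eq_integrable (integrable0 _ _) => // x _ /=; rewrite expr0n.
Qed.

Lemma L2_sum (I : Type) (s : seq I) (f : I -> 'rV[R]_d -> R) :
  (forall i, L2 Omega (f i)) -> L2 Omega (fun x => \sum_(i <- s) f i x).
Proof.
move=> Lf; elim: s => [|i s IHs].
  by under eq_fun do rewrite big_nil; exact: L2_zero.
by under eq_fun do rewrite big_cons; exact: L2D.
Qed.

Lemma ip_sum_l (I : Type) (s : seq I) (f : I -> 'rV[R]_d -> R) g :
  (forall i, L2 Omega (f i)) -> L2 Omega g ->
  ip Omega (fun x => \sum_(i <- s) f i x) g = \sum_(i <- s) ip Omega (f i) g.
Proof.
move=> Lf Lg; rewrite /ip -Rintegral_sum//.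
  by apply: eq_Rintegral => x _; rewrite mulr_suml.
by move=> i; exact: integrable_L2M.
Qed.

Lemma ipZl c f g : L2 Omega f -> L2 Omega g ->
  ip Omega (fun x => c * f x) g = c * ip Omega f g.
Proof.
move=> Lf Lg; rewrite /ip -RintegralZl//; last exact: integrable_L2M.
by apply: eq_Rintegral => x _; rewrite mulrA.
Qed.

Lemma ipDl f f' g : L2 Omega f -> L2 Omega f' -> L2 Omega g ->
  ip Omega (fun x => f x + f' x) g = ip Omega f g + ip Omega f' g.
Proof.
move=> Lf Lf' Lg; rewrite /ip -RintegralD//; try exact: integrable_L2M.
by apply: eq_Rintegral => x _; rewrite mulrDl.
Qed.

Lemma L2_cst c : (mu Omega < +oo)%E -> L2 Omega (fun=> c).
Proof.
move=> fO; split; first exact: measurable_cst.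
by apply: (@integrable_bounded_fin _ _ _ _ _ (fun=> c ^+ 2) `|c ^+ 2|).
Qed.

Lemma ipC f g : ip Omega f g = ip Omega g f.
Proof. by apply: eq_Rintegral => x _; rewrite mulrC. Qed.

End L2_calculus.

Section moments.
Context (R : realType) (d N : nat) (Omega : set 'rV[R]_d) (mO : measurable Omega)
  (phi : 'I_N -> 'rV[R]_d -> R) (Lphi : forall i, L2 Omega (phi i)).
Implicit Types (m q : 'rV[R]_d -> 'M[R]_d) (c : 'I_N -> 'M[R]_d).

(** The pairing with [q], for [q] a combination of the [phi i], depends on
    [m] only through these matrices ([ip_mx_lincomb]). *)
Definition moment m (i : 'I_N) : 'M[R]_d :=
  \matrix_(a, b) ip Omega (fun x => m x a b) (phi i).

Lemma lincombE c (psi : 'I_N -> 'rV[R]_d -> R) x a b :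
  lincomb c psi x a b = \sum_i c i a b * psi i x.
Proof.
by rewrite /lincomb summxE; apply: eq_bigr => i _; rewrite mxE mulrC.
Qed.

Lemma L2_lincomb c (psi : 'I_N -> 'rV[R]_d -> R) a b :
  (forall i, L2 Omega (psi i)) -> L2 Omega (fun x => lincomb c psi x a b).
Proof.
move=> Lpsi; under eq_fun do rewrite lincombE.
by apply: L2_sum => // i; exact: L2Z.
Qed.

Lemma ip_mx_lincomb m c : (forall a b, L2 Omega (fun x => m x a b)) ->
  ip_mx Omega m (lincomb c phi) = \sum_i frob_inner (moment m i) (c i).
Proof.
move=> Lm.
transitivity (\int[lebesgue_row R d]_(x in Omega)
    \sum_i \sum_a \sum_b (c i a b * (m x a b * phi i x))).
  apply: eq_Rintegral => x _; rewrite /frob_inner.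
  rewrite [RHS]exchange_big/=; apply: eq_bigr => a _.
  rewrite [RHS]exchange_big/=; apply: eq_bigr => b _.
  by rewrite lincombE mulr_sumr; apply: eq_bigr => i _; rewrite mulrCA.
have int i a b : (lebesgue_row R d).-integrable Omega
    (EFin \o (fun x => c i a b * (m x a b * phi i x))).
  have := integrableZl mO (c i a b) (integrable_L2M mO (Lm a b) (Lphi i)).
  by apply: eq_integrable => // x _ /=; rewrite EFinM.
rewrite Rintegral_sum//; last first.
  by move=> i; do 2 apply: integrable_sum_real => // ?.
apply: eq_bigr => i _; rewrite Rintegral_sum//; last first.
  by move=> a; apply: integrable_sum_real.
apply: eq_bigr => a _; rewrite Rintegral_sum//.
apply: eq_bigr => b _; rewrite RintegralZl//; last exact: integrable_L2M.
by rewrite mxE mulrC.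
Qed.

Lemma ip_mx_ae m q q' (S : set 'rV[R]_d) :
  (forall a b, L2 Omega (fun x => m x a b)) ->
  (forall a b, L2 Omega (fun x => q x a b)) ->
  (forall a b, L2 Omega (fun x => q' x a b)) ->
  (lebesgue_row R d).-negligible (Omega `\` S) ->
  (forall x, S x -> q x = q' x) -> ip_mx Omega m q = ip_mx Omega m q'.
Proof.
move=> Lm Lq Lq' nS qq'; rewrite /ip_mx /Rintegral; congr fine.
have mfrob (r : 'rV[R]_d -> 'M[R]_d) : (forall a b, L2 Omega (fun x => r x a b)) ->
    measurable_fun Omega (fun x => (frob_inner (m x) (r x))%:E).
  move=> Lr; apply/measurable_EFinP.
  apply: measurable_sum => a; apply: measurable_sum => b.
  exact: (measurable_funM (Lm a b).1 (Lr a b).1).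
apply: ae_eq_integral => //; [exact: mfrob|exact: mfrob|].
apply: negligibleS nS => x /= h; apply: contrapT => nOS; apply: h => Ox.
rewrite qq'//; apply: contrapT => nSx; exact: nOS.
Qed.

Lemma moment_sym_traceless m i : L2_sym_traceless Omega m ->
  sym_traceless (moment m i).
Proof.
move=> [Lm st]; split.
  apply/matrixP => a b; rewrite !mxE; apply: eq_Rintegral => x.
  by rewrite inE => /st[mT _]; rewrite -{1}mT mxE.
rewrite /mxtrace; under eq_bigr do rewrite mxE.
rewrite -ip_sum_l// /ip; transitivity (\int[lebesgue_row R d]_(x in Omega) (0 : R)).
  apply: eq_Rintegral => x; rewrite inE => /st[_ tr0].
  by rewrite -[X in X * _]/(\tr (m x)) tr0 mul0r.
by rewrite Rintegral_cst// mul0r.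
Qed.

End moments.

Section frobenius.
Context (R : realType) (m n : nat).
Implicit Types A B : 'M[R]_(m, n).

Lemma frob_innerC A B : frob_inner A B = frob_inner B A.
Proof.
by rewrite /frob_inner; do 2 (apply: eq_bigr => ? _); rewrite mulrC.
Qed.

Lemma frob_innerDl A A' B : frob_inner (A + A') B = frob_inner A B + frob_inner A' B.
Proof.
rewrite /frob_inner -big_split; apply: eq_bigr => a _; rewrite -big_split.
by apply: eq_bigr => b _; rewrite mxE mulrDl.
Qed.

Lemma frob_innerZl c A B : frob_inner (c *: A) B = c * frob_inner A B.
Proof.
rewrite /frob_inner mulr_sumr; apply: eq_bigr => a _; rewrite mulr_sumr.
by apply: eq_bigr => b _; rewrite mxE mulrA.
Qed.

Lemma frob_innerBl A A' B : frob_inner (A - A') B = frob_inner A B - frob_inner A' B.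
Proof. by rewrite -scaleN1r frob_innerDl frob_innerZl mulN1r. Qed.

Lemma frob_innerZr c A B : frob_inner A (c *: B) = c * frob_inner A B.
Proof. by rewrite frob_innerC frob_innerZl frob_innerC. Qed.

Lemma frob_innerBr A B B' : frob_inner A (B - B') = frob_inner A B - frob_inner A B'.
Proof. by rewrite frob_innerC frob_innerBl !(frob_innerC A). Qed.

Lemma frob_inner_ge0 A : 0 <= frob_inner A A.
Proof. by do 2 apply: sumr_ge0 => ? _; rewrite -expr2 sqr_ge0. Qed.

Lemma frob_inner_eq0 A : frob_inner A A = 0 -> A = 0.
Proof.
move=> /eqP; rewrite psumr_eq0 => [/allP h|a _]; last first.
  by apply: sumr_ge0 => ? _; rewrite -expr2 sqr_ge0.
apply/matrixP => a b; rewrite mxE.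
have := h a (mem_index_enum a); rewrite psumr_eq0 => [/allP/(_ b)|? _]; last first.
  by rewrite -expr2 sqr_ge0.
by rewrite mem_index_enum -expr2 sqrf_eq0 => /(_ isT)/eqP.
Qed.

Lemma frob_ge0 A : 0 <= frob A. Proof. exact: sqrtr_ge0. Qed.

Lemma frob_sqr A : frob A ^+ 2 = frob_inner A A.
Proof. by rewrite sqr_sqrtr// frob_inner_ge0. Qed.

Lemma frobZ c A : frob (c *: A) = `|c| * frob A.
Proof.
rewrite /frob frob_innerZl frob_innerZr mulrA -expr2 sqrtrM ?sqr_ge0//.
by rewrite sqrtr_sqr.
Qed.

Lemma frob_eq0 A : frob A = 0 -> A = 0.
Proof. by move=> A0; apply: frob_inner_eq0; rewrite -frob_sqr A0 expr0n. Qed.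

Lemma frob_cauchy_schwarz A B : frob_inner A B <= frob A * frob B.
Proof.
have [B0|B0] := eqVneq (frob B) 0.
  rewrite (frob_eq0 B0) -(scale0r (0 : 'M[R]_(m, n))) frob_innerZr mul0r.
  by rewrite mulr_ge0// frob_ge0.
have [A0|A0] := eqVneq (frob A) 0.
  rewrite (frob_eq0 A0) -(scale0r (0 : 'M[R]_(m, n))) frob_innerZl mul0r.
  by rewrite mulr_ge0// frob_ge0.
have a0 : 0 < frob A by rewrite lt_def A0 frob_ge0.
have b0 : 0 < frob B by rewrite lt_def B0 frob_ge0.
have := frob_inner_ge0 (frob B *: A - frob A *: B).
rewrite frob_innerBl !frob_innerZl !frob_innerBr !frob_innerZr.
rewrite (frob_innerC B A) -!frob_sqr => h.
have ab : 0 < frob A * frob B by rewrite mulr_gt0.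
rewrite -(ler_pM2l ab).
move: (frob A) (frob B) (frob_inner A B) h => u v w h; lra.
Qed.

End frobenius.

(** The variational inequality says that [lambda] is the projection of
    [lambda + rho *: p] onto the ball of radius [sigma], and [chi]
    vanishes exactly when [lambda] is that projection: it is the point itself
    if this lies in the ball, and otherwise its rescaling to the sphere.
    Concretely, either [p = 0], or the linear form given by [p] is maximal
    on the ball only at [nu = (sigma / frob p) *: p], which must be
    [lambda]. *)
Lemma projection_chi (R : realType) d (rho sigma : R) (p lambda : 'M[R]_d) :
  0 < rho -> 0 < sigma -> sym_traceless p -> frob lambda <= sigma ->
  (forall nu, sym_traceless nu -> frob nu <= sigma ->
     frob_inner (nu - lambda) p <= 0) <->
  chi rho sigma p lambda = 0.
Proof.
move=> rho0 sigma0 hp hl; split => [h|].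
  have [p0|p0] := eqVneq (frob p) 0.
    rewrite /chi (frob_eq0 p0) scaler0 addr0 max_l//.
    by rewrite subrr.
  have pp : 0 < frob p by rewrite lt_def p0 frob_ge0.
  pose nu := (sigma / frob p) *: p.
  have c0 : 0 < sigma / frob p by rewrite divr_gt0.
  have nuF : frob nu = sigma by rewrite frobZ gtr0_norm// divfK.
  have nust : sym_traceless nu.
    have [pT ptr] := hp; split; first by rewrite /nu linearZ /= pT.
    by rewrite /nu mxtraceZ ptr mulr0.
  have := h nu nust; rewrite nuF lexx => /(_ isT).
  rewrite frob_innerBl frob_innerZl -frob_sqr => hle.
  have lnu : lambda = nu.
    apply/eqP; rewrite -subr_eq0; apply/eqP/frob_inner_eq0/eqP.
    rewrite eq_le frob_inner_ge0 andbT.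
    rewrite frob_innerBl !frob_innerBr (frob_innerC nu lambda) -!frob_sqr nuF.
    rewrite [frob_inner lambda nu]frob_innerZr.
    have l2 : frob lambda ^+ 2 <= sigma ^+ 2.
      by rewrite lerXn2r// nnegrE ?frob_ge0// ltW.
    have e1 : sigma / frob p * frob p ^+ 2 = sigma * frob p.
      by field.
    have e2 : sigma / frob p * (sigma * frob p) = sigma ^+ 2 by field.
    have : sigma / frob p * (sigma * frob p) <=
        sigma / frob p * frob_inner lambda p.
      by rewrite ler_pM2l//; rewrite e1 in hle; lra.
    rewrite e2; lra.
  have zE : lambda + rho *: p = (1 + rho * frob p / sigma) *: lambda.
    rewrite {1 2}lnu /nu scalerDl scale1r scalerA; congr (_ + _ *: _).
    by field; rewrite p0 gt_eqF.
  have k0 : 0 < rho * frob p / sigma by rewrite !mulr_gt0 ?invr_gt0.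
  rewrite /chi zE frobZ lnu nuF max_r; last first.
    by rewrite gtr0_norm ?addr_gt0// ler_peMl ?(ltW sigma0)// lerDl ltW.
  by rewrite gtr0_norm ?addr_gt0// scalerA mulrC subrr.
rewrite /chi; set z := lambda + rho *: p => hchi nu _ hnu.
have [zs|zs] := leP (frob z) sigma.
  move: hchi; rewrite max_l// /z scalerDr opprD addrA subrr add0r => /eqP.
  rewrite oppr_eq0 !scaler_eq0 !gt_eqF//= => /eqP ->.
  by rewrite -(scale0r (0 : 'M[R]_d)) frob_innerZr mul0r.
move: hchi; rewrite (max_r (ltW zs)) => /eqP; rewrite subr_eq0 => /eqP zl.
have z0 : 0 < frob z by exact: lt_trans zs.
have lF : frob lambda = sigma.
  have := congr1 (@frob _ _ _) zl; rewrite !frobZ !gtr0_norm// [RHS]mulrC.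
  by move/(mulfI (lt0r_neq0 z0)).
have pE : p = ((frob z - sigma) / (sigma * rho)) *: lambda.
  have : (frob z - sigma) *: lambda = (sigma * rho) *: p.
    by rewrite scalerBl zl /z scalerDr addrC addKr scalerA.
  move/(congr1 (fun v => (sigma * rho)^-1 *: v)); rewrite !scalerA mulVf.
    by rewrite scale1r mulrC => <-.
  by rewrite mulf_neq0 ?gt_eqF.
rewrite pE frob_innerZr pmulr_rle0; last first.
  by rewrite divr_gt0 ?mulr_gt0// subr_gt0.
rewrite frob_innerBl -frob_sqr lF subr_le0.
by rewrite (le_trans (frob_cauchy_schwarz _ _))// lF expr2 ler_wpM2r// ltW.
Qed.

(** * Nodal description of the multiplier set *)

Lemma in_P_sum (R : realType) n r (I : finType) (a : I -> R)
    (f : I -> 'rV[R]_n -> R) :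
  (forall i, in_P r (f i)) -> in_P r (fun x => \sum_i a i * f i x).
Proof.
move=> /choice[c cE]; exists (fun k => \sum_i a i * c i k) => x.
under [RHS]eq_bigr do rewrite mulr_suml.
rewrite exchange_big/=; apply: eq_bigr => i _; rewrite cE mulr_sumr.
by apply: eq_bigr => k _; rewrite mulrA.
Qed.

Lemma in_P0 (R : realType) n r : in_P r (fun _ : 'rV[R]_n => 0).
Proof. by exists (fun=> 0) => x; rewrite big1// => k _; rewrite mul0r. Qed.

(** The Legendre polynomial of degree 1 is X, so for one point per direction
    the Gauss point is the midpoint of the cube, as in the separate rule for
    degree one. *)
Lemma legendre1_root (R : realType) p (t : 'I_p -> R) (k : 'I_p) :
  p = 1%N -> gauss_nodes t -> t k = 0.
Proof.
move=> p1 [_ _ /(_ k)]; rewrite /legendre p1 rootZ.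
  rewrite expr1 derivn1 derivB derivXn derivC subr0 expr1 /=.
  rewrite rootE hornerMn ?hornerXn ?hornerX ?expr1 -mulr_natr mulf_eq0.
  by rewrite pnatr_eq0 orbF => /eqP.
by rewrite invr_eq0 mulf_neq0// ?pnatr_eq0// expr1 pnatr_eq0.
Qed.

Section gauss_mesh.
Context (R : realType) (d : nat) (hd : (d = 2 \/ d = 3)%N) (Omega : set 'rV[R]_d)
  (hOmega : lipschitz_domain Omega) (E : finType) (Th : mesh R d E) (kappa : R)
  (hTh : fe_mesh Th Omega kappa)
  (t : forall p, 'I_p -> R) (ht : forall p, gauss_nodes (@t p))
  (phihat : forall T, {ffun 'I_d -> 'I_(degree Th T)} -> 'rV[R]_d -> R)
  (hphihat : lagrange_basis t phihat).

Notation mu := (lebesgue_row R d).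
Notation K := (ccube (0 : 'rV[R]_d) 1).
Notation Ko := (ocube (0 : 'rV[R]_d) 1).

Let rF T := elt_map_regular T hTh.

Let deg_gt0 T : (0 < degree Th T)%N.
Proof. by have [_ _ _ _ [h _]] := hTh; exact: h. Qed.

Let d2 : (d.-1 <= 2)%N. Proof. by case: hd => ->. Qed.

Let cphi T k : continuous (@phihat T k).
Proof. by apply: in_P_continuous; exact: (hphihat k).1. Qed.

Let gauss_K p k : K (gauss_point (@t p) k : 'rV[R]_d).
Proof.
have [_ t1 _] := ht p; rewrite -ref_cubeE => i; rewrite mxE.
by have /andP[? ?] := t1 (k i); rewrite !ltW.
Qed.

Let gauss_Ko p k : Ko (gauss_point (@t p) k : 'rV[R]_d).
Proof.
have [_ t1 _] := ht p; rewrite -open_ref_cubeE => i; rewrite mxE.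
exact: t1.
Qed.

Let gauss_point_weight_gt0 p k : 0 < gauss_point_weight (@t p) (k : {ffun 'I_d -> 'I_p}).
Proof. by apply: prodr_gt0 => i _; exact: gauss_weight_gt0. Qed.

Definition elt_node T k : 'rV[R]_d :=
  elt_map Th T (gauss_point (@t (degree Th T)) k).

Definition elt_mass T k : R :=
  \int[mu]_(x in K) (@phihat T k x * volume_factor (elt_map Th T) x).

(** The volume factor has degree at most 2 in each coordinate, since d <= 3,
    so the integral is the 2-point Gauss sum of positive terms. *)
Lemma volume_gt0 T : 0 < \int[mu]_(x in K) volume_factor (elt_map Th T) x.
Proof.
have := element_quadrature_exact (rF T) (ht 2) d2 isT
  (@cst_continuous _ _ (1 : R)) (fun i => deg_inW (leq0n _) (deg_in_cst i 1)).
have -> : \int[mu]_(x in K) (1 * volume_factor (elt_map Th T) x) =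
    \int[mu]_(x in K) volume_factor (elt_map Th T) x.
  by apply: eq_Rintegral => x _; rewrite mul1r.
move=> <-.
pose k0 : {ffun 'I_d -> 'I_2} := [ffun=> ord0].
have pos k : 0 < gauss_point_weight (@t 2) k *
    volume_factor (elt_map Th T) (gauss_point (@t 2) k) * 1.
  by rewrite mulr1 mulr_gt0// (volume_factor_gt0 (rF T)).
rewrite (bigD1 k0)//= ltr_pwDl//; apply: sumr_ge0 => k _; exact: ltW.
Qed.

(** Gauss quadrature is exact for [phihat k * volume_factor] as soon as
    [d - 1 <= p], and only the k-th node contributes. *)
Lemma elt_massE T k : (1 < degree Th T)%N -> elt_mass k =
  gauss_point_weight (@t (degree Th T)) k *
  volume_factor (elt_map Th T) (gauss_point (@t (degree Th T)) k).
Proof.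
move=> p1; rewrite /elt_mass -(@element_quadrature_exact _ _ _ (rF T) _ (@t (degree Th T))
  (@phihat T k) (ht _))//.
- rewrite (bigD1 k)//= big1 => [|l lk].
    by rewrite (hphihat k).2 eqxx mulr1 addr0.
  by rewrite (hphihat k).2 eq_sym (negPf lk) mulr0.
- exact: leq_trans d2 p1.
- by move=> i; apply: in_P_deg_in; exact: (hphihat k).1.
Qed.

(** The only Lagrange function is the constant 1. *)
Lemma elt_mass_deg1 T k : degree Th T = 1%N ->
  elt_mass k = \int[mu]_(x in K) volume_factor (elt_map Th T) x /\
  forall l : {ffun 'I_d -> 'I_(degree Th T)}, l = k.
Proof.
move=> p1.
have ord_eq0 (j : 'I_(degree Th T)) : val j = 0%N.
  by apply/eqP; rewrite -leqn0 -ltnS (leq_trans (ltn_ord j))// p1.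
have uniq1 (l : {ffun 'I_d -> 'I_(degree Th T)}) : l = k.
  by apply/ffunP => i; apply/val_inj; rewrite !ord_eq0.
split=> //; apply: eq_Rintegral => x _.
have [tinj _ _] := ht (degree Th T).
have := @lagrange_expansion _ _ _ _ tinj (@phihat T) (fun=> 1) (deg_gt0 T)
  (fun k => (hphihat k).1) (fun k => (hphihat k).2)
  (fun i => deg_inW (leq0n _) (deg_in_cst i 1)) x.
rewrite (bigD1 k)//= big1 => [|l]; last by rewrite (uniq1 l) eqxx.
by rewrite addr0 mul1r => <-; rewrite mul1r.
Qed.

(** The Lagrange functions take both signs when [p >= 2], so positivity of
    their integrals comes from that of the quadrature weights. *)
Lemma elt_mass_gt0 T k : 0 < @elt_mass T k.
Proof.
have [p1|p1] := leqP (degree Th T) 1.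
  rewrite (elt_mass_deg1 k _).1 ?volume_gt0//.
  by apply/eqP; rewrite eqn_leq p1 deg_gt0.
by rewrite elt_massE// mulr_gt0// (volume_factor_gt0 (rF T)).
Qed.

(** Both quadrature rules have the integrals of the basis functions as
    weights: for [p >= 2] by exactness, for [p = 1] because the midpoint
    rule is defined with the volume of the element. *)
Lemma quadratureE T f : quadrature Th t T f = \sum_k elt_mass k * f (@elt_node T k).
Proof.
rewrite /quadrature; case: eqP => [p1|/eqP p1]; last first.
  have p2 : (1 < degree Th T)%N by rewrite ltn_neqAle eq_sym p1 deg_gt0.
  by apply: eq_bigr => k _; rewrite jacobian_elt_map elt_massE.
pose k0 : {ffun 'I_d -> 'I_(degree Th T)} := [ffun=> Ordinal (deg_gt0 T)].
have [mE uniq1] := elt_mass_deg1 k0 p1.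
rewrite (bigD1 k0)//= big1 => [|l]; last by rewrite (uniq1 l) eqxx.
rewrite addr0 mE /elt_node (_ : gauss_point _ k0 = 0); last first.
  by apply/rowP => i; rewrite !mxE (legendre1_root _ p1).
congr (_ * _); rewrite eltE -[RHS]/(fine (_)%:E); congr fine.
exact: (lebesgue_image (rF T)).1.
Qed.

Context (zeta : dof Th -> 'I_(ndof Th)) (zinv : 'I_(ndof Th) -> dof Th)
  (zK : cancel zeta zinv) (Kz : cancel zinv zeta)
  (phi : 'I_(ndof Th) -> 'rV[R]_d -> R)
  (hphi : forall T k, phi (zeta (existT _ T k)) = push_elt Th T (@phihat T k)).

Let phiE i : phi i = push_elt Th (tag (zinv i)) (@phihat _ (tagged (zinv i))).
Proof. by rewrite -hphi -[in LHS](Kz i); case: (zinv i). Qed.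

Definition dof_node i : 'rV[R]_d := elt_node (tagged (zinv i)).

Let sum_dof (G : 'I_(ndof Th) -> R) :
  \sum_i G i = \sum_T \sum_(k : {ffun 'I_d -> 'I_(degree Th T)})
    G (zeta (existT _ T k)).
Proof.
rewrite (reindex zeta); last by apply: onW_bij; exists zinv.
rewrite [RHS](@sig_big_dep _ _ _ _ (fun T => {ffun 'I_d -> 'I_(degree Th T)})
  xpredT (fun=> xpredT) (fun T k => G (zeta (existT _ T k))))/=.
by apply: eq_bigr => -[T k].
Qed.

Lemma L2_phi i : L2 Omega (phi i).
Proof. by rewrite phiE; exact: (L2_push_elt hOmega hTh). Qed.

Lemma piecewise_phi i : piecewise_P Th (phi i).
Proof.
rewrite phiE => T; have [Ti|Ti] := eqVneq (tag (zinv i)) T.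
  subst T; exists (@phihat _ (tagged (zinv i))); first exact: (hphihat _).1.
  by move=> x; rewrite open_ref_cubeE => /sub_ocube Kx; rewrite (push_elt_in hTh).
exists (fun=> 0); first exact: in_P0.
by move=> x; rewrite open_ref_cubeE => Kox; rewrite (push_elt_out hTh).
Qed.

Definition dof_mass i : R := ip Omega (phi i) (fun=> 1).

Lemma dof_massE i : dof_mass i = elt_mass (tagged (zinv i)).
Proof.
rewrite /dof_mass /ip; under eq_Rintegral do rewrite mulr1.
by rewrite phiE (Rintegral_push_elt hOmega hTh).
Qed.

Lemma dof_mass_gt0 i : 0 < dof_mass i.
Proof. by rewrite dof_massE elt_mass_gt0. Qed.

(** Mass lumping: the weights of the discrete functional are the scaling
    factors [D_i] of the biorthogonality relation. *)
Lemma psi_hpE sigma q :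
  psi_hp Th t sigma q = \sum_i dof_mass i * (sigma * frob (q (dof_node i))).
Proof.
rewrite /psi_hp sum_dof; apply: eq_bigr => T _; rewrite quadratureE.
by apply: eq_bigr => k _; rewrite dof_massE /dof_node zK.
Qed.

Lemma phi_dof_node i j : phi i (dof_node j) = (i == j)%:R.
Proof.
rewrite phiE /dof_node /elt_node.
have [Tij|Tij] := eqVneq (tag (zinv i)) (tag (zinv j)); last first.
  rewrite (push_elt_out hTh)//.
  by have [ij|//] := eqVneq i j; rewrite ij eqxx in Tij.
have [ij|ij] := eqVneq i j.
  by rewrite ij (push_elt_in hTh)// (hphihat _).2 eqxx.
have zij : zinv i != zinv j by apply: contra ij => /eqP/(can_inj Kz) ->.
case: (zinv i) (zinv j) Tij zij => [T k] [T' l] /= TT'; subst T' => kl.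
rewrite (push_elt_in hTh)// (hphihat _).2; case: eqP => // kl'.
by rewrite kl' eqxx in kl.
Qed.

(** On the skeleton, a null set, the values of [q] are not determined by its
    polynomial pieces. *)
Lemma nodal_expansion (q : 'rV[R]_d -> 'M[R]_d) y :
  (forall a b, piecewise_P Th (fun x => q x a b)) ->
  open_elts Th y -> q y = lincomb (fun i => q (dof_node i)) phi y.
Proof.
move=> hq [T _ [x Kox <-]]; apply/matrixP => a b; rewrite lincombE sum_dof.
rewrite (bigD1 T)//= [X in _ = _ + X]big1 ?addr0 => [|T' T'T]; last first.
  apply: big1 => k _; rewrite hphi (push_elt_out hTh)// mulr0//.
have [P PP qP] := hq a b T; have [tinj _ _] := ht (degree Th T).
rewrite qP ?open_ref_cubeE//.
rewrite (@lagrange_expansion _ _ _ _ tinj (@phihat T) P (deg_gt0 T)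
  (fun k => (hphihat k).1) (fun k => (hphihat k).2)
  (fun i => in_P_deg_in i PP)).
apply: eq_bigr => k _; rewrite hphi (push_elt_in hTh); last exact: sub_ocube.
by rewrite /dof_node zK /elt_node /= qP// open_ref_cubeE.
Qed.

Lemma Q_hp_lincomb (c : 'I_(ndof Th) -> 'M[R]_d)
    (psi : 'I_(ndof Th) -> 'rV[R]_d -> R) :
  (forall i, sym_traceless (c i)) ->
  (forall i, L2 Omega (psi i) /\ piecewise_P Th (psi i)) ->
  Q_hp Th Omega (lincomb c psi).
Proof.
move=> hc hpsi; split; [split|].
- move=> a b; apply: L2_lincomb; first exact: measurable_Omega hOmega.
  by move=> i; exact: (hpsi i).1.
- move=> x _; split.
    rewrite /lincomb linear_sum /=; apply: eq_bigr => i _.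
    by rewrite linearZ /= (hc i).1.
  rewrite /lincomb linear_sum /=; apply: big1 => i _.
  by rewrite linearZ /= (hc i).2 mulr0.
- move=> a b T.
  have /choice[P hP] i : exists P, in_P (degree Th T).-1 P /\
      forall x, open_ref_cube x -> psi i (elt_map Th T x) = P x.
    by have [P PP hP] := (hpsi i).2 T; exists P.
  exists (fun x => \sum_i c i a b * P i x).
    by apply: in_P_sum => i; exact: (hP i).1.
  by move=> x xo; rewrite lincombE; apply: eq_bigr => i _; rewrite (hP i).2.
Qed.

(** Exact integration against [m] reduces to the nodal values of [q], the same
    data that [psi_hp] sees. *)
Lemma ip_mx_nodal m q : Q_hp Th Omega m -> Q_hp Th Omega q ->
  ip_mx Omega m q = \sum_i frob_inner (moment Omega phi m i) (q (dof_node i)).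
Proof.
move=> [[Lm _] _] [[Lq _] Pq].
have mO := measurable_Omega hOmega.
rewrite -(ip_mx_lincomb mO L2_phi (fun i => q (dof_node i)) Lm).
have sk := skeleton_null hTh.
have Lc a b : L2 Omega (fun x => lincomb (fun i => q (dof_node i)) phi x a b).
  by apply: L2_lincomb => //; exact: L2_phi.
apply: (ip_mx_ae mO Lm Lq Lc sk) => x xS.
exact: nodal_expansion.
Qed.

Context (sigma : R) (sigma0 : 0 < sigma).

(** Test the defining inequality with [q = A phi_i], where [A] is the i-th
    moment of [m]: it reads [|A|^2 <= D_i sigma |A|]. *)
Lemma Lambda_hp_moment m i : Lambda_hp Th t Omega sigma m ->
  frob (moment Omega phi m i) <= dof_mass i * sigma.
Proof.
move=> [[Lst Pm] hm].
set A := moment Omega phi m i.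
have mO := measurable_Omega hOmega.
have stA : sym_traceless A by exact: (moment_sym_traceless mO L2_phi).
pose c j := if j == i then A else 0.
have Qc : Q_hp Th Omega (lincomb c phi).
  apply: Q_hp_lincomb => j; last by split; [exact: L2_phi|exact: piecewise_phi].
  rewrite /c; case: ifP => // _.
  by split; [exact: trmx0|exact: mxtrace0].
have cn j : lincomb c phi (dof_node j) = c j.
  apply/matrixP => a b; rewrite lincombE (bigD1 j)//= phi_dof_node eqxx mulr1.
  by rewrite big1 ?addr0// => k kj; rewrite phi_dof_node (negPf kj) mulr0.
have := hm _ Qc; rewrite (ip_mx_lincomb mO L2_phi); last by case: Lst.
rewrite psi_hpE (bigD1 i)//= big1 => [|j ji]; last first.
  by rewrite /c (negPf ji) -(scale0r A) frob_innerZr mul0r.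
rewrite (bigD1 i)//= big1 => [|j ji]; last first.
  by rewrite cn /c (negPf ji) -(scale0r A) frobZ normr0 mul0r !mulr0.
rewrite cn !addr0 /c eqxx -/A -frob_sqr mulrA expr2.
have [->|A0] := eqVneq (frob A) 0; last first.
  by rewrite ler_pM2r// lt_def A0 frob_ge0.
by rewrite mulr_ge0// ltW// dof_mass_gt0.
Qed.

Context (varphi : 'I_(ndof Th) -> 'rV[R]_d -> R)
  (hvarphi : biorthogonal Omega phi varphi).

Lemma moment_lincomb c i :
  moment Omega phi (lincomb c varphi) i = dof_mass i *: c i.
Proof.
have mO := measurable_Omega hOmega.
apply/matrixP => a b; rewrite !mxE.
rewrite (_ : (fun x => _) = fun x => \sum_j c j a b * varphi j x); last first.
  by apply/funext => x; rewrite lincombE.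
rewrite ip_sum_l//; last 2 first.
- by move=> j; apply: L2Z => //; exact: (hvarphi.1 j).1.
- exact: L2_phi.
rewrite (bigD1 i)//= big1 => [|j ji].
  rewrite ipZl//; [|exact: (hvarphi.1 i).1|exact: L2_phi].
  by rewrite ipC hvarphi.2 eqxx mul1r addr0 mulrC.
rewrite ipZl//; [|exact: (hvarphi.1 j).1|exact: L2_phi].
by rewrite ipC hvarphi.2 eq_sym (negPf ji) mul0r mulr0.
Qed.

(** Pointwise constraints on the coefficients: necessary by
    [Lambda_hp_moment], as the moments are [D_i c_i], and sufficient by the
    Cauchy-Schwarz inequality at each node. *)
Lemma Lambda_hp_lincomb c : (forall i, sym_traceless (c i)) ->
  Lambda_hp Th t Omega sigma (lincomb c varphi) <->
  forall i, frob (c i) <= sigma.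
Proof.
move=> hc; split=> [hL i|hF].
  have := Lambda_hp_moment i hL; rewrite moment_lincomb frobZ.
  by rewrite gtr0_norm ?dof_mass_gt0// ler_pM2l// dof_mass_gt0.
have Qc : Q_hp Th Omega (lincomb c varphi).
  by apply: Q_hp_lincomb => // i; exact: hvarphi.1.
split=> // q Qq; rewrite (ip_mx_nodal Qc Qq) psi_hpE; apply: ler_sum => i _.
rewrite moment_lincomb frob_innerZl ler_pM2l ?dof_mass_gt0//.
by rewrite (le_trans (frob_cauchy_schwarz _ _))// ler_wpM2r// frob_ge0.
Qed.

Lemma sigma_iE i : sigma_i Omega sigma (phi i) = sigma.
Proof.
have g0 := dof_mass_gt0 i.
rewrite /sigma_i -/(dof_mass i) (_ : ip Omega _ _ = sigma * dof_mass i).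
  by rewrite mulrCA mulVf ?mulr1// gt_eqF.
have mO := measurable_Omega hOmega.
have L1 := L2_cst mO 1 (lebesgue_Omega_fin hOmega).
rewrite /dof_mass [in RHS]ipC -ipZl//; last exact: L2_phi.
by apply: eq_Rintegral => x _; rewrite mulr1.
Qed.

Context (rho : R) (rho0 : 0 < rho) (p lambda : 'I_(ndof Th) -> 'M[R]_d)
  (hp : forall i, sym_traceless (p i)) (hlambda : forall i, sym_traceless (lambda i))
  (hL : Lambda_hp Th t Omega sigma (lincomb lambda varphi)).

Lemma ip_mx_diff m : Lambda_hp Th t Omega sigma m ->
  ip_mx Omega (fun x => m x - lincomb lambda varphi x) (lincomb p phi) =
  \sum_i frob_inner (moment Omega phi m i - dof_mass i *: lambda i) (p i).
Proof.
move=> [[[Lm _] _] _].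
have mO := measurable_Omega hOmega.
have Ll a b : L2 Omega (fun x => lincomb lambda varphi x a b).
  by have [[[Ll _] _] _] := hL.
have LN a b : L2 Omega (fun x => -1 * lincomb lambda varphi x a b) by exact: L2Z.
rewrite (ip_mx_lincomb mO L2_phi).
  apply: eq_bigr => i _; congr frob_inner; rewrite -moment_lincomb.
  apply/matrixP => a b; rewrite !mxE.
  rewrite (_ : (fun x => _) = fun x => m x a b + -1 * lincomb lambda varphi x a b).
    by rewrite ipDl ?ipZl ?mulN1r//; exact: L2_phi.
  by apply/funext => x; rewrite !mxE mulN1r.
move=> a b; rewrite (_ : (fun x => _) =
  fun x => m x a b + -1 * lincomb lambda varphi x a b).
  exact: L2D.
by apply/funext => x; rewrite !mxE mulN1r.
Qed.

(** The pairing is a sum over the nodes, and the constraint on the multipliers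
    acts on each node separately, so the inequality splits into one projection
    problem per node. A single coefficient can be varied within the ball;
    conversely any element of the multiplier set enters only through its
    rescaled moments [nu], which lie in the ball. *)
Lemma variational_ineq_chi :
  (forall m, Lambda_hp Th t Omega sigma m ->
     ip_mx Omega (fun x => m x - lincomb lambda varphi x) (lincomb p phi) <= 0)
  <->
  (forall i, chi rho (sigma_i Omega sigma (phi i)) (p i) (lambda i) = 0).
Proof.
have lF := (Lambda_hp_lincomb hlambda).1 hL.
split=> [h i|h m hm].
  rewrite sigma_iE; apply/(projection_chi rho0 sigma0 (hp i) (lF i)) => nu snu nuF.
  pose c j := if j == i then nu else lambda j.
  have sc j : sym_traceless (c j) by rewrite /c; case: ifP.
  have hc : Lambda_hp Th t Omega sigma (lincomb c varphi).
    by apply/Lambda_hp_lincomb => // j; rewrite /c; case: ifP.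
  have := h _ hc; rewrite (ip_mx_diff hc) (bigD1 i)//= big1 => [|j ji].
    rewrite moment_lincomb /c eqxx -scalerBr frob_innerZl addr0.
    by rewrite pmulr_rle0// dof_mass_gt0.
  by rewrite moment_lincomb /c (negPf ji) subrr -(scale0r (0 : 'M[R]_d))
    frob_innerZl mul0r.
rewrite (ip_mx_diff hm); apply: sumr_le0 => i _.
have g0 := dof_mass_gt0 i; pose nu := (dof_mass i)^-1 *: moment Omega phi m i.
have -> : moment Omega phi m i - dof_mass i *: lambda i = dof_mass i *: (nu - lambda i).
  by rewrite scalerBr scalerA divff ?scale1r// gt_eqF.
rewrite frob_innerZl pmulr_rle0//.
have := h i; rewrite sigma_iE => /(projection_chi rho0 sigma0 (hp i) (lF i)); apply.
- have mO := measurable_Omega hOmega.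
  have [mT mtr] := moment_sym_traceless mO L2_phi i hm.1.1.
  by split; [rewrite /nu linearZ /= mT|rewrite /nu mxtraceZ mtr mulr0].
- rewrite frobZ gtr0_norm ?invr_gt0// mulrC ler_pdivrMr// mulrC.
  exact: Lambda_hp_moment.
Qed.

End gauss_mesh.

Theorem theorem6 (R : realType) (d : nat) (hd : (d = 2 \/ d = 3)%N)
    (Omega : set 'rV[R]_d) (hOmega : lipschitz_domain Omega)
    (sigma_y : R) (hsigma_y : 0 < sigma_y)
    (E : finType) (Th : mesh R d E) (kappa : R) (hTh : fe_mesh Th Omega kappa)
    (t : forall p, 'I_p -> R) (ht : forall p, gauss_nodes (@t p))
    (phihat : forall T, {ffun 'I_d -> 'I_(degree Th T)} -> 'rV[R]_d -> R)
    (hphihat : lagrange_basis t phihat)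
    (zeta : dof Th -> 'I_(ndof Th)) (phi : 'I_(ndof Th) -> 'rV[R]_d -> R)
    (hphi : global_basis phihat zeta phi)
    (varphi : 'I_(ndof Th) -> 'rV[R]_d -> R)
    (hvarphi : biorthogonal Omega phi varphi)
    (rho : R) (hrho : 0 < rho)
    (p lambda : 'I_(ndof Th) -> 'M[R]_d)
    (hp : forall i, sym_traceless (p i))
    (hlambda : forall i, sym_traceless (lambda i))
    (hp_hp : Q_hp Th Omega (lincomb p phi))
    (hlambda_hp : Lambda_hp Th t Omega sigma_y (lincomb lambda varphi)) :
  (forall mu_hp, Lambda_hp Th t Omega sigma_y mu_hp ->
     ip_mx Omega (fun x => mu_hp x - lincomb lambda varphi x)
       (lincomb p phi) <= 0)
  <->
  (forall i, chi rho (sigma_i Omega sigma_y (phi i)) (p i) (lambda i) = 0).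
Proof.
have [[zinv zK Kz] hphi'] := hphi.
exact: (variational_ineq_chi hd hOmega hTh ht hphihat zK Kz hphi' hsigma_y
  hvarphi hrho hp hlambda hlambda_hp).
Qed.
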